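(* (i) Let $p\in(0,1)$ and a rate $r=k/n$ be constants with $1-r-2p>0$. For the block-encoding ensemble $\mathfrak S_n^B$ with block size $4\xi$, $\xi=\log(n/\varepsilon)$, the expected Choi error against strength-$p$ i.i.d. erasure errors satisfies $$\mathbb E_{U\sim\mathfrak S_n^B}\epsilon_{\mathrm{Choi}}\ge\min\left\{n\Big(\frac\varepsilon n\Big)^{8D\left(\frac{1-k/n}2\,\big\|\,p\right)+o(1)},\ \Omega(1)\right\},$$ where $o(1)\to0$ as $\xi\to\infty$ and $\Omega(1)$ denotes a quantity bounded below by a positive constant. (ii) There exist regimes of $p$, the encoding rate $k/n$ and $\varepsilon$ such that, for strength-$p$ i.i.d. erasure errors and with the same $\xi=\log(n/\varepsilon)$ for both ensembles, as $n\to\infty$, $$\mathbb E_{U\sim\mathfrak S_n^B}\epsilon_{\mathrm{Choi}}=\Omega(1)\qquad\text{while}\qquad\lim_{n\to\infty}\mathbb E_{U\sim\mathfrak C_n^\varepsilon}\epsilon_{\mathrm{Choi}}=0 .$$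
   Context: All logarithms are base 2. $D(a\|b)=a\log\frac ab+(1-a)\log\frac{1-a}{1-b}$ is the binary relative entropy. The $n$ physical qubits on a line are divided into $2N$ consecutive regions of $\xi=n/2N$ qubits each, where $\xi=\log(n/\varepsilon)$; each region contains $\frac kn\xi$ logical qubits and $\frac{n-k}n\xi$ ancillas in $|0\rangle$. Parameters are taken such that all these numbers, and $N/2$, are integers; $n\to\infty$ is along such parameters. Block-encoding ensemble $\mathfrak S_n^B$: $U=\bigotimes_{i=1}^{N/2}U_C^{4i-3,4i-2,4i-1,4i}$, independent uniformly random Clifford unitaries on the $4\xi$ qubits of four consecutive regions. Double-layer blocked ensemble $\mathfrak C_n^\varepsilon$: $U=U_2U_1$, $U_1=\bigotimes_{i=1}^NU_C^{2i-1,2i}$, $U_2=\bigotimes_{i=1}^{N-1}U_C^{2i,2i+1}$, independent uniformly random Clifford unitaries on pairs of regions. Choi error: $L$ is the $k$-qubit logical system, $S$ the $n$-qubit physical system, $R$ a $k$-qubit reference, $\hat\phi_{LR}$ the maximally entangled state, $\mathcal E(\rho)=U(\rho\otimes|0^{n-k}\rangle\langle0^{n-k}|)U^\dagger$. For a noise channel $\mathcal N$, $\epsilon_{\mathrm{Choi}}=\min_{\mathcal D}P(\hat\phi_{LR},[(\mathcal D\circ\mathcal N\circ\mathcal E)_L\otimes I_R](\hat\phi_{LR}))$ over channels $\mathcal D$ to $L$, with $P=\sqrt{1-F^2}$, $F(\rho,\sigma)=\Vert\sqrt\rho\sqrt\sigma\Vert_1$. Strength-$p$ i.i.d. erasure: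 $\mathcal N=\mathcal N_e^{\otimes n}$, $\mathcal N_e(\rho)=(1-p)\rho+p|2\rangle\langle2|$, $|2\rangle$ orthogonal to the qubit space. *)

(* Defs.v *)
From HB Require Import structures.
From mathcomp Require Import all_boot all_order all_algebra.
From mathcomp Require Import complex.
From mathcomp Require Import all_classical all_reals all_analysis.

Set Implicit Arguments.
Unset Strict Implicit.
Unset Printing Implicit Defensive.

Import Order.TTheory GRing.Theory Num.Theory.
Import numFieldNormedType.Exports.

Local Open Scope classical_set_scope.
Local Open Scope ring_scope.
Local Open Scope sesquilinear_scope.

(* A finite-dimensional system is given by a finite type T labelling an     *)
(* orthonormal basis; its operators are the #|T| x #|T| complex matrices.   *)
(* A composite system A (x) B has basis A * B, and a register of qubits     *)
(* (resp. qutrits) placed at the sites of a finite type Q has basis         *)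
(* {ffun Q -> bool} (resp. {ffun Q -> option bool}).                        *)
Definition op (R : realType) (T : finType) : Type := 'M[R[i]]_#|T|.

(* matrix element <x| A |y> *)
Definition ent (R : realType) (T : finType) (A : op R T) (x y : T) : R[i] :=
  A (enum_rank x) (enum_rank y).

Definition mkop (R : realType) (T : finType) (f : T -> T -> R[i]) : op R T :=
  \matrix_(i, j) f (enum_val i) (enum_val j).

(* |x><y| *)
Definition munit (R : realType) (T : finType) (x y : T) : op R T :=
  delta_mx (enum_rank x) (enum_rank y).

(* Over the complex numbers the condition below forces A to be Hermitian:   *)
(* 0 <= z in R[i] means that z is real and nonnegative.                     *)
Definition psd (R : realType) (T : finType) (A : op R T) : Prop :=
  forall v : 'cV[R[i]]_#|T|, 0 <= (v ^t* *m A *m v) 0 0.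

Definition superop (R : realType) (T1 T2 : finType) : Type :=
  op R T1 -> op R T2.

(* Phi (x) id_Z: the linear map Phi is applied to each block <.,z| X |.,w>. *)
Definition ext_id (R : realType) (T1 T2 Z : finType) (Phi : superop R T1 T2) :
    superop R (T1 * Z)%type (T2 * Z)%type :=
  fun X => mkop (fun u v =>
    ent (Phi (mkop (fun x y => ent X (x, u.2) (y, v.2)))) u.1 v.1).

Definition completely_positive (R : realType) (T1 T2 : finType)
    (Phi : superop R T1 T2) : Prop :=
  forall (m : nat) (X : op R (T1 * 'I_m)%type),
    psd X -> psd (ext_id Phi X).

Definition trace_preserving (R : realType) (T1 T2 : finType)
    (Phi : superop R T1 T2) : Prop :=
  forall X : op R T1, \tr (Phi X) = \tr X.

Definition channel (R : realType) (T1 T2 : finType)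
    (Phi : superop R T1 T2) : Prop :=
  [/\ linear Phi, completely_positive Phi & trace_preserving Phi].

(* Phi^{(x) Q}, obtained by expanding the input in products of matrix units. *)
Definition tensor_power (R : realType) (Q T1 T2 : finType)
    (Phi : superop R T1 T2) :
    superop R {ffun Q -> T1} {ffun Q -> T2} :=
  fun X => mkop (fun u v : {ffun Q -> T2} =>
    \sum_(s : {ffun Q -> T1}) \sum_(t : {ffun Q -> T1})
      ent X s t * \prod_(q : Q) ent (Phi (munit R (s q) (t q))) (u q) (v q)).

(* The positive square root of a positive semidefinite operator. *)
Definition msqrt (R : realType) (T : finType) (A : op R T) : op R T :=
  xget 0 [set B : op R T | psd B /\ B *m B = A].

Definition trace_norm (R : realType) (T : finType) (A : op R T) : R :=
  complex.Re (\tr (msqrt (A ^t* *m A : op R T))).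

Definition fidelity (R : realType) (T : finType) (rho sigma : op R T) : R :=
  trace_norm (msqrt rho *m msqrt sigma : op R T).

Definition purified_distance (R : realType) (T : finType)
    (rho sigma : op R T) : R :=
  Num.sqrt (1 - fidelity rho sigma ^+ 2).

(* The projector onto #|T|^(-1/2) \sum_x |x>|x>. *)
Definition max_entangled (R : realType) (T : finType) : op R (T * T)%type :=
  mkop (fun u v =>
    (#|T|%:R)^-1 * (u.1 == u.2)%:R * (v.1 == v.2)%:R).

Definition pauli_string (Q : finType) : finType := {ffun Q -> bool * bool}.

(* (c, f) stands for i^c times the tensor product of the X^x Z^z over the   *)
(* sites q, where f q = (x, z).                                             *)
Definition pauli_elt (Q : finType) : finType := ('I_4 * pauli_string Q)%type.

Definition pauli (R : realType) (Q : finType) (g : pauli_elt Q) :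
    op R {ffun Q -> bool} :=
  mkop (fun s t : {ffun Q -> bool} => 'i ^+ g.1 *
    \prod_(q : Q) ((s q == t q (+) (g.2 q).1)%:R
                   * (-1) ^+ ((g.2 q).2 && t q))).

Definition clifford (R : realType) (Q : finType)
    (U : op R {ffun Q -> bool}) : Prop :=
  U \is unitarymx /\
  forall g : pauli_elt Q, exists h : pauli_elt Q,
    U *m pauli R g *m U ^t* = pauli R h.

(* The action of a Clifford unitary by conjugation on Pauli strings. It     *)
(* determines the unitary up to a global phase, so the Clifford group       *)
(* modulo phases, a finite group, is identified with the type               *)
(* clifford_class of the actions that occur. A uniformly random Clifford    *)
(* is clifford_rep of a uniformly random class; the phase picked by         *)
(* clifford_rep is irrelevant because Choi errors do not depend on it.      *)
Definition clifford_action (Q : finType) : finType :=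
  {ffun pauli_string Q -> pauli_elt Q}.

Definition acts_as (R : realType) (Q : finType) (U : op R {ffun Q -> bool})
    (t : clifford_action Q) : Prop :=
  clifford U /\
  forall f : pauli_string Q,
    U *m pauli R ((ord0, f) : pauli_elt Q) *m U ^t* = pauli R (t f).

Definition clifford_class (R : realType) (Q : finType) : finType :=
  {t : clifford_action Q | `[< exists U : op R _, acts_as U t >]}.

Definition clifford_rep (R : realType) (Q : finType)
    (t : clifford_class R Q) : op R {ffun Q -> bool} :=
  sval (cid (asboolW (valP t))).

Definition uniform_average (R : realType) (T : finType) (f : T -> R) : R :=
  (\sum_(x : T) f x) / #|T|%:R.

(* There are m consecutive regions (m = 2N below), each with a logical      *)
(* qubits (positions 0..a-1) and b ancillas (positions a..a+b-1); a site is *)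
(* a pair (region, position), and xi = a + b.                               *)
Definition site (m a b : nat) : finType := ('I_m * 'I_(a + b))%type.

Definition logical (m a : nat) : finType := ('I_m * 'I_a)%type.

Definition logical_part (m a b : nat) (y : {ffun site m a b -> bool}) :
    {ffun logical m a -> bool} :=
  [ffun q : logical m a => y (q.1, lshift b q.2)].

Definition ancillas_zero (m a b : nat) (y : {ffun site m a b -> bool}) : bool :=
  [forall r : 'I_m, forall j : 'I_b, y (r, rshift a j) == false].

(* rho |-> rho (x) |0...0><0...0|, the zeros being at the ancilla sites *)
Definition adjoin_ancillas (R : realType) (m a b : nat) :
    superop R {ffun logical m a -> bool} {ffun site m a b -> bool} :=
  fun rho => mkop (fun y z =>
    ent rho (logical_part y) (logical_part z)
    * (ancillas_zero y)%:R * (ancillas_zero z)%:R).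

Definition encoding (R : realType) (m a b : nat)
    (U : op R {ffun site m a b -> bool}) :
    superop R {ffun logical m a -> bool} {ffun site m a b -> bool} :=
  fun rho => U *m adjoin_ancillas b rho *m U ^t*.

(* A gate on w consecutive regions acts on the register 'I_w * 'I_xi; these *)
(* are the sites of the w regions s, ..., s + w - 1.                        *)
Definition gate_sites (m a b s w : nat) (sw : (s + w <= m)%N)
    (q : site w a b) : site m a b :=
  (widen_ord sw (rshift s q.1), q.2).

Definition restrict (Q Q' T : finType) (g : Q' -> Q) (y : {ffun Q -> T}) :
    {ffun Q' -> T} := [ffun q => y (g q)].

(* The tensor product of the gates V i, acting on the registers g i with    *)
(* pairwise disjoint images, and of the identity on the remaining sites.    *)
Definition layer (R : realType) (Q Q' : finType) (l : nat)
    (g : 'I_l -> Q' -> Q) (V : 'I_l -> op R {ffun Q' -> bool}) :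
    op R {ffun Q -> bool} :=
  mkop (fun y z =>
    (\prod_(i < l) ent (V i) (restrict (g i) y) (restrict (g i) z))
    * [forall q : Q, [exists i : 'I_l, q \in codom (g i)] || (y q == z q)]%:R).

Lemma block_bound (N : nat) (i : 'I_(N./2)) : (4 * i + 4 <= 2 * N)%N.
Proof.
rewrite -mulnSr -[X in (X * _)%N]/(2 * 2)%N -mulnA leq_pmul2l // mul2n.
by rewrite -[leqRHS]odd_double_half (leq_trans _ (leq_addl _ _)) // leq_double.
Qed.

Lemma layer1_bound (N : nat) (i : 'I_N) : (2 * i + 2 <= 2 * N)%N.
Proof. by rewrite -mulnSr leq_pmul2l. Qed.

Lemma layer2_bound (N : nat) (i : 'I_N.-1) : (2 * i + 1 + 2 <= 2 * N)%N.
Proof.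
case: N i => [[]//|N] i.
rewrite addnAC -mulnSr addn1 (mulnS 2%N N) add2n ltnS (leq_trans _ (leqnSn _)) //.
by rewrite leq_pmul2l.
Qed.

(* U = (x)_{i=1}^{N/2} U_C^{4i-3,4i-2,4i-1,4i}, regions numbered from 0 here *)
Definition block_circuit (R : realType) (N a b : nat)
    (V : {ffun 'I_(N./2) -> clifford_class R (site 4 a b)}) :
    op R {ffun site (2 * N) a b -> bool} :=
  layer (fun i => @gate_sites (2 * N) a b _ 4 (block_bound i))
        (fun i => clifford_rep (V i)).

(* U = U_2 U_1; the first and last regions are not touched by U_2 *)
Definition double_layer_circuit (R : realType) (N a b : nat)
    (V : {ffun 'I_N -> clifford_class R (site 2 a b)}
         * {ffun 'I_N.-1 -> clifford_class R (site 2 a b)}) :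
    op R {ffun site (2 * N) a b -> bool} :=
  layer (fun i => @gate_sites (2 * N) a b _ 2 (layer2_bound i))
        (fun i => clifford_rep (V.2 i))
  *m
  layer (fun i => @gate_sites (2 * N) a b _ 2 (layer1_bound i))
        (fun i => clifford_rep (V.1 i)).

(* rho |-> (1 - p) rho + p tr(rho) |2><2|; Some x is the qubit state |x> and *)
(* None is the orthogonal flag state |2>.                                   *)
Definition erasure (R : realType) (p : R) : superop R bool (option bool) :=
  fun rho =>
    (1 - p)%:C%C *: (mkop (fun u v : option bool =>
       if (u, v) is (Some x, Some y) then ent rho x y else 0) : op R _)
    + (p%:C%C * \tr rho) *: munit R None None.

Definition iid_erasure (R : realType) (Q : finType) (p : R) :
    superop R {ffun Q -> bool} {ffun Q -> option bool} :=
  tensor_power (erasure p).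

(* The minimum over decoders is attained (channels between fixed            *)
(* finite-dimensional systems form a compact set), hence equals the infimum. *)
Definition choi_error (R : realType) (L S S' : finType)
    (N : superop R S S') (E : superop R L S) : R :=
  inf [set purified_distance (max_entangled R L)
             (ext_id (D \o N \o E) (max_entangled R L))
      | D in [set D : superop R S' L | channel D]].

(* Expected Choi errors against strength-p i.i.d. erasure for 2N regions    *)
(* of a logical qubits and b ancillas.                                      *)
Definition expected_choi_block (R : realType) (p : R) (N a b : nat) : R :=
  uniform_average (fun V : {ffun 'I_(N./2) -> clifford_class R (site 4 a b)} =>
    choi_error (iid_erasure p) (encoding (block_circuit V))).

Definition expected_choi_double_layer (R : realType) (p : R) (N a b : nat) : R :=
  uniform_average (fun V : {ffun 'I_N -> clifford_class R (site 2 a b)}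
                           * {ffun 'I_N.-1 -> clifford_class R (site 2 a b)} =>
    choi_error (iid_erasure p) (encoding (double_layer_circuit V))).

Definition log2 (R : realType) (x : R) : R := ln x / ln 2.

(* Binary relative entropy D(x || y), meant for 0 < x < 1 and 0 < y < 1. *)
Definition relative_entropy (R : realType) (x y : R) : R :=
  x * log2 (x / y) + (1 - x) * log2 ((1 - x) / (1 - y)).

(* The parameters of both ensembles: n qubits, k of them logical, in 2N     *)
(* regions of xi = a + b = log (n / eps) qubits, a = (k/n) xi of them       *)
(* logical and b = ((n-k)/n) xi of them ancillas, with N/2 an integer.      *)
Definition admissible (R : realType) (n k N a b : nat) (eps : R) : Prop :=
  [/\ (0 < n)%N /\ 0 < eps,
      ~~ odd N,
      n = (2 * N * (a + b))%N,
      (k * (a + b) = a * n)%N &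
      (a + b)%:R = log2 (n%:R / eps)].

(* Main.v *)
(* A Clifford unitary acts on Pauli strings, and an erasure pattern is fatal
   exactly when some string, nontrivial and logical on the code space, is moved
   by this action into the erased sites: then the erased output does not depend
   on a logical Pauli, while otherwise measuring the syndrome restores the state.
   Hence the Choi error lies between sqrt(q / 2) and sqrt(q), with q the
   probability of a fatal pattern.

   Block ensemble: by the quantum MacWilliams identity, among two disjoint
   patterns of size 2 b + 1 in a block with 4 b ancillas one is fatal, so half
   of the patterns of this size are; the binomial tail gives the exponent.

   Double layer: a random Clifford maps a nonzero string to a uniformly random
   nonzero one, so E q is bounded by a sum over the strings between the layers.
   Each first-layer gate contributes tau = 2^(-2b) unless it outputs the
   identity, each second-layer gate contributes alpha = ((1 + 3p)/4)^(2 xi)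
   unless its input is the identity. This is a transfer-matrix sum along the
   line, equal to 1 + O(tau N + tau (1 + 3p)^(2 xi)), the 1 being the identity
   string.

   Regime of (ii): p = 1/8, rate 1/2, n of order 2^(3 xi / 4). *)

Require Import Defs.
From HB Require Import structures.
From mathcomp Require Import all_boot all_order all_algebra.
From mathcomp Require Import complex.
From mathcomp Require Import all_classical all_reals all_analysis.
From mathcomp Require Import ring lra zify.

Set Implicit Arguments.
Unset Strict Implicit.
Unset Printing Implicit Defensive.

Import Order.TTheory GRing.Theory Num.Theory.
Import numFieldNormedType.Exports.

Local Open Scope classical_set_scope.
Local Open Scope ring_scope.

(** * Positive semidefinite matrices and their square roots *)

Section PositiveMatrices.
Local Open Scope sesquilinear_scope.
Variable C : numClosedFieldType.

(** The purified distance to a maximally entangled state is sqrt (1 - F), F being the entanglement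
    fidelity. F is linear in the channel, so erasure patterns are treated one at a time: a fatal one
    leaves F <= 1/2 for every decoder, and a single decoder, which reads the pattern from the flags,
    reaches F = 1 on all the others. Hence sqrt (q / 2) and sqrt q.

    The block bound holds for every choice of gates; only the double layer exploits the randomness.
    There the transfer-matrix sum is close to 1 while the first moment must tend to 0, so the
    identity string has to be removed exactly. Each first-layer factor is therefore expanded over a
    flag, and the configuration with all flags raised is exactly the 1 to be subtracted.

    At rate 1/2, 2 b = xi and tau = 2^(-xi). For n of order 2^(c xi), the block error stays away
    from 0 when 8 D(1/4 || 1/8) < c, and tau N tends to 0 when c < 1; tau (11/8)^(2 xi) tends to 0
    because (11/8)^2 < 2. Since 8 D(1/4 || 1/8) < 3/4, the value c = 3/4 satisfies both. *)

Definition psdmx n (A : 'M[C]_n) : Prop :=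
  forall v : 'cV[C]_n, 0 <= (v ^t* *m A *m v) 0 0.

Lemma adjM m n p (A : 'M[C]_(m, n)) (B : 'M[C]_(n, p)) :
  (A *m B) ^t* = B ^t* *m A ^t*.
Proof. by rewrite trmx_mul map_mxM. Qed.

Lemma adjD m n (A B : 'M[C]_(m, n)) : (A + B) ^t* = A ^t* + B ^t*.
Proof. by rewrite linearD /= map_mxD. Qed.

Lemma adjB m n (A B : 'M[C]_(m, n)) : (A - B) ^t* = A ^t* - B ^t*.
Proof. by rewrite linearB /= map_mxB. Qed.

Lemma adjZ m n a (A : 'M[C]_(m, n)) : (a *: A) ^t* = a^* *: A ^t*.
Proof. by rewrite linearZ /= map_mxZ. Qed.

Lemma adj1 n : (1%:M : 'M[C]_n) ^t* = 1%:M.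
Proof. by rewrite trmx1 map_mx1. Qed.

Lemma gram_ge0 n (v : 'cV[C]_n) : 0 <= (v ^t* *m v) 0 0.
Proof.
rewrite mxE; apply: sumr_ge0 => i _.
by rewrite !mxE mulrC mul_conjC_ge0.
Qed.

Lemma gram_eq0 n (v : 'cV[C]_n) : (v ^t* *m v) 0 0 = 0 -> v = 0.
Proof.
rewrite mxE => /eqP; rewrite psumr_eq0; last first.
  by move=> i _; rewrite !mxE mulrC mul_conjC_ge0.
move=> /allP v0; apply/matrixP => i j; rewrite ord1 mxE.
have := v0 i (mem_index_enum _); rewrite !mxE /= mulf_eq0 conjC_eq0 orbb.
by move=> /eqP.
Qed.

Lemma gram_mx_eq0 m n (A : 'M[C]_(m, n)) : A ^t* *m A = 0 -> A = 0.
Proof.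
move=> A0; apply/matrixP => i j; rewrite mxE.
have /gram_eq0/matrixP/(_ i 0) : ((col j A) ^t* *m col j A) 0 0 = 0.
  have /matrixP/(_ j j) := A0; rewrite !mxE => A0j.
  by rewrite -[RHS]A0j; apply: eq_bigr => k _; rewrite !mxE.
by rewrite !mxE.
Qed.

Lemma psdmx_gram m n (A : 'M[C]_(m, n)) : psdmx (A ^t* *m A).
Proof.
move=> v; have -> : v ^t* *m (A ^t* *m A) *m v = (A *m v) ^t* *m (A *m v).
  by rewrite adjM !mulmxA.
exact: gram_ge0.
Qed.

Lemma psdmx_outer m n (A : 'M[C]_(m, n)) : psdmx (A *m A ^t*).
Proof. by have := @psdmx_gram _ _ (A ^t*); rewrite trmxCK. Qed.

Lemma psdmx_conj m n (K : 'M[C]_(m, n)) (A : 'M[C]_n) :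
  psdmx A -> psdmx (K *m A *m K ^t*).
Proof.
move=> Apsd v; have := Apsd (K ^t* *m v).
by rewrite adjM trmxCK !mulmxA.
Qed.

Lemma psdmxD n (A B : 'M[C]_n) : psdmx A -> psdmx B -> psdmx (A + B).
Proof.
by move=> hA hB v; rewrite mulmxDr mulmxDl mxE addr_ge0 ?hA ?hB.
Qed.

Lemma psdmx0 n : psdmx (0 : 'M[C]_n).
Proof. by move=> v; rewrite mulmx0 mul0mx mxE. Qed.

Lemma psdmx_sum n (I : Type) (r : seq I) (P : pred I) (A : I -> 'M[C]_n) :
  (forall i, P i -> psdmx (A i)) -> psdmx (\sum_(i <- r | P i) A i).
Proof. by move=> hA; apply: big_ind => //; [exact: psdmx0 | exact: psdmxD]. Qed.

Lemma form_delta n (A : 'M[C]_n) i j :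
  (delta_mx i 0 : 'cV[C]_n) ^t* *m A *m (delta_mx j 0 : 'cV[C]_n)
    = (A i j)%:M.
Proof.
apply/matrixP => a b; rewrite !ord1 mxE (bigD1 j) //= big1 ?addr0; last first.
  by move=> k kj; rewrite [X in _ * X]mxE (negPf kj) mulr0.
rewrite [X in _ * X]mxE !eqxx mulr1 mxE (bigD1 i) //= big1 ?addr0; last first.
  by move=> k ki; rewrite !mxE (negPf ki) conjC0 mul0r.
by rewrite !mxE !eqxx conjC1 mul1r mulr1n.
Qed.

Lemma psdmx_diag n (A : 'M[C]_n) i : psdmx A -> 0 <= A i i.
Proof. by move=> /(_ (delta_mx i 0)); rewrite form_delta mxE eqxx. Qed.

Lemma psdmx_tr n (A : 'M[C]_n) : psdmx A -> 0 <= \tr A.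
Proof. by move=> Ap; apply: sumr_ge0 => i _; exact: psdmx_diag. Qed.

(** Polarisation: the form at e_i + c e_j being real, so is c A_ij plus the conjugate of c times
    A_ji. Taking for c first 1, then the imaginary unit, gives two equations that determine A_ji
    from A_ij. *)
Lemma psdmx_adj n (A : 'M[C]_n) : psdmx A -> A ^t* = A.
Proof.
move=> Ap; apply/matrixP => i j; rewrite !mxE.
have key (c : C) : c * A i j + c^* * A j i \is Num.real.
  set v : 'cV[C]_n := delta_mx i 0 + c *: delta_mx j 0.
  have := Ap v; rewrite /v adjD adjZ !mulmxDl !mulmxDr -!scalemxAl -!scalemxAr.
  rewrite !form_delta !mxE !mulr1n => /ger0_real h.
  have hi := ger0_real (psdmx_diag i Ap).
  have hj : c^* * (c * A j j) \is Num.real.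
    by rewrite mulrCA mulrA realM ?ger0_real ?mul_conjC_ge0 // psdmx_diag.
  have -> : c * A i j + c^* * A j i =
    A i i + c * A i j + (c^* * A j i + c^* * (c * A j j)) - A i i
      - c^* * (c * A j j).
    by ring.
  by apply: realB => //; apply: realB.
have /CrealP := key 1; have /CrealP := key 'i.
rewrite !rmorphD !rmorphM /= !conjCK !conjC1 !mul1r conjCi.
set x := A i j; set y := A j i => e1 e2.
have e3 : y^* - x^* = x - y.
  apply: (mulfI (neq0Ci C)); rewrite !mulrBr.
  by move: e1; rewrite !mulNr addrC => ->.
have : 2 * (y^* - x) = 0.
  have -> : 2 * (y^* - x) = ((x^* + y^*) - (x + y)) + ((y^* - x^*) - (x - y)).
    by ring.
  by rewrite e2 e3 !subrr addr0.
by move=> /eqP; rewrite mulf_eq0 pnatr_eq0 /= subr_eq0 => /eqP.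
Qed.

Lemma psdmx_sqrt_ex n (A : 'M[C]_n) :
  psdmx A -> exists B : 'M[C]_n, psdmx B /\ B *m B = A.
Proof.
move=> Ap.
have Anorm : A \is normalmx.
  by apply/normalmxP; rewrite psdmx_adj.
have /orthomx_spectralP := Anorm.
have Pu := spectral_unitarymx A.
set P := spectralmx A in Pu *; set d := spectral_diag A => AE.
have PV := invmx_unitary Pu; rewrite PV in AE.
have PP : P *m P ^t* = 1%:M by apply/unitarymxP.
have PP' : P ^t* *m P = 1%:M by apply: mulmx1C.
have dE : diag_mx d = P *m A *m P ^t*.
  by rewrite AE !mulmxA PP mul1mx -mulmxA PP mulmx1.
have d_ge0 i : 0 <= d 0 i.
  have := psdmx_diag i (psdmx_conj P Ap).
  by rewrite -dE mxE eqxx mulr1n.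
exists (P ^t* *m diag_mx (map_mx sqrtC d) *m P); split; last first.
  rewrite !mulmxA -[_ *m P *m P ^t*]mulmxA PP mulmx1 [in RHS]AE.
  rewrite -[_ *m _ *m diag_mx _]mulmxA mulmx_diag.
  congr (_ *m diag_mx _ *m _); apply/matrixP => i j.
  by rewrite ord1 !mxE -expr2 sqrtCK.
rewrite -[X in _ *m X]trmxCK; apply: psdmx_conj => v.
rewrite -mulmxA mxE; apply: sumr_ge0 => i _.
rewrite mul_diag_mx !mxE mulrCA mulr_ge0 ?sqrtC_ge0 //.
by rewrite mulrC mul_conjC_ge0.
Qed.

(** Uniqueness of the positive root in rank one: [msqrt] is a mere choice, so any B with this square
    has to be identified. B vanishes on the complement of u, hence is a multiple of the projector on
    u. The second identity is cleared of denominators so that u = 0 is included. *)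
Lemma psdmx_sqrt_outer n (u : 'cV[C]_n) (B : 'M[C]_n) :
  psdmx B -> B *m B = u *m u ^t* ->
  \tr B = sqrtC ((u ^t* *m u) 0 0) /\
  (u ^t* *m u) 0 0 *: B = \tr B *: (u *m u ^t*).
Proof.
move=> Bp BB; have BH := psdmx_adj Bp.
have [u0|u_neq0] := eqVneq u 0.
  have /gram_mx_eq0 -> : B ^t* *m B = 0 by rewrite BH BB u0 mul0mx.
  by rewrite mxtrace0 u0 mulmx0 mxE sqrtC0 scaler0 scale0r.
set c := (u ^t* *m u) 0 0.
have cE : u ^t* *m u = c%:M by rewrite [LHS]mx11_scalar.
have c_neq0 : c != 0 by apply: contra u_neq0 => /eqP/gram_eq0 ->.
have c_ge0 : 0 <= c by exact: gram_ge0.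
(* M is B composed with the projector onto the complement of u; its Gram matrix is 0 because the
   square of B lives on u. *)
set M := B - c^-1 *: (B *m u *m u ^t*).
have uM : u *m u ^t* *m (1%:M - c^-1 *: (u *m u ^t*)) = 0.
  rewrite mulmxBr mulmx1 -scalemxAr !mulmxA -[_ *m u]mulmxA cE.
  by rewrite mul_mx_scalar -!scalemxAl scalerA mulVf // scale1r subrr.
have M0 : M = 0.
  have ME : M = B *m (1%:M - c^-1 *: (u *m u ^t*)).
    by rewrite mulmxBr mulmx1 -scalemxAr mulmxA.
  apply: gram_mx_eq0.
  by rewrite {1}ME adjM BH ME -mulmxA [B *m (B *m _)]mulmxA BB uM mulmx0.
have BE : B = c^-1 *: (B *m u *m u ^t*) by apply/eqP; rewrite -subr_eq0 -/M M0.
set b := (u ^t* *m B *m u) 0 0.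
have bE : u ^t* *m B *m u = b%:M by rewrite [LHS]mx11_scalar.
have BE2 : B = (c^-1 * c^-1 * b) *: (u *m u ^t*).
  have BE' : B = c^-1 *: (u *m u ^t* *m B).
    rewrite -{1}BH {1}BE adjZ !adjM trmxCK BH mulmxA fmorphV /=.
    by rewrite (CrealP (ger0_real c_ge0)).
  rewrite {1}BE BE' -!scalemxAl scalerA -[RHS]scalerA.
  congr (_ *: _); rewrite -!mulmxA [u ^t* *m _]mulmxA [u ^t* *m _ *m _]mulmxA.
  by rewrite bE mul_scalar_mx -scalemxAr.
have b_ge0 : 0 <= b by exact: Bp.
have trE : \tr B = c^-1 * b.
  rewrite BE2 mxtraceZ mxtrace_mulC cE mxtrace_scalar mulr1n.
  by field.
have bb : b ^+ 2 = c ^+ 3.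
  have : (u ^t* *m (B *m B) *m u) 0 0 = c ^+ 2.
    rewrite BB !mulmxA cE -[_ *m u]mulmxA cE -scalar_mxM mxE eqxx mulr1n.
    by rewrite expr2.
  rewrite {2}BE2 -scalemxAr -scalemxAr -scalemxAl mxE !mulmxA bE.
  rewrite -[_ *m u]mulmxA cE -scalar_mxM mxE eqxx mulr1n => h.
  have : c * (c^-1 * c^-1 * b * (b * c)) = c ^+ 3 by rewrite h -exprS.
  by move=> <-; field.
split; last by rewrite {1}BE2 trE scalerA; congr (_ *: _); field.
rewrite trE; apply/eqP; rewrite -(@eqrXn2 _ 2) ?mulr_ge0 ?invr_ge0 ?sqrtC_ge0 //.
by rewrite sqrtCK exprMn bb; apply/eqP; field.
Qed.
End PositiveMatrices.

(** * Fidelity with a pure state *)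

Section Fidelity.
Local Open Scope sesquilinear_scope.
Variable R : realType.
Local Notation C := R[i].

Lemma msqrtP (T : finType) (A : op R T) :
  psd A -> psd (msqrt A) /\ msqrt A *m msqrt A = A.
Proof.
by move=> Ap; apply: (@xgetPex _ 0 [set B : op R T | psd B /\ B *m B = A]);
  exact: psdmx_sqrt_ex.
Qed.

Lemma msqrt_projector (T : finType) (v : 'cV[C]_#|T|) :
  v ^t* *m v = 1%:M ->
  msqrt (v *m v ^t* : op R T) = v *m v ^t*.
Proof.
move=> v1.
have [Bp BB] := @msqrtP T (v *m v ^t*) (psdmx_outer _).
set B := msqrt _ in Bp BB *.
have [] := psdmx_sqrt_outer Bp BB.
by rewrite v1 mxE eqxx mulr1n sqrtC1 => ->; rewrite !scale1r.
Qed.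

(** With S the root of s, the matrix under the trace norm has absolute square equal to the rank-one
    matrix of the vector S v, whose root has trace the norm of S v. *)
Lemma fidelity_projector (T : finType) (v : 'cV[C]_#|T|) (s : op R T) :
  v ^t* *m v = 1%:M -> psd s ->
  fidelity (v *m v ^t* : op R T) s ^+ 2 = complex.Re ((v ^t* *m s *m v) 0 0).
Proof.
move=> v1 sp; rewrite /fidelity msqrt_projector // /trace_norm.
have [Sp SS] := msqrtP sp; set S := msqrt s in Sp SS *.
have SH := psdmx_adj Sp.
set X := _ *m _; have XE : X = (S *m v) *m (S *m v) ^t*.
  by rewrite /X !adjM trmxCK SH !mulmxA -[_ *m v ^t* *m v]mulmxA v1 mulmx1.
have Xp : psd (X : op R T) by rewrite XE; exact: psdmx_outer.
have [Yp YY] := msqrtP Xp.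
rewrite [RHS]XE in YY; have [-> _] := psdmx_sqrt_outer Yp YY.
have -> : (S *m v) ^t* *m (S *m v) = v ^t* *m s *m v.
  by rewrite adjM SH !mulmxA -[_ *m S *m S]mulmxA SS.
set c := _ 0 0; have c0 : 0 <= c by exact: sp.
have : 0 <= sqrtC c by rewrite sqrtC_ge0.
rewrite -[in RHS](sqrtCK c); case: (sqrtC c) => x y; rewrite lecE /= => /andP[/eqP -> _].
by rewrite !expr2 /= mulr0 subr0.
Qed.
End Fidelity.

Lemma prod_natb (S : comNzRingType) (I : finType) (F : I -> bool) :
  \prod_i (F i)%:R = [forall i, F i]%:R :> S.
Proof.
have [/forallP F1|] := boolP [forall i, F i]; first by rewrite big1 // => i _; rewrite F1.
by rewrite negb_forall => /existsP[i /negPf Fi]; rewrite (bigD1 i) //= Fi mul0r.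
Qed.

(** * Matrix elements, Kraus maps, and the Choi error in terms of the entanglement fidelity *)

Section Operators.
Local Open Scope sesquilinear_scope.
Variable R : realType.
Local Notation C := R[i].

(** Rectangular version of [ent], as Kraus operators go between different systems. *)
Definition kent (T1 T2 : finType) (A : 'M[C]_(#|T2|, #|T1|)) (y : T2) (x : T1) : C :=
  A (enum_rank y) (enum_rank x).

Definition mkk (T1 T2 : finType) (f : T2 -> T1 -> C) : 'M[C]_(#|T2|, #|T1|) :=
  \matrix_(i, j) f (enum_val i) (enum_val j).

Lemma sum_enum_rank (T : finType) (V : nmodType) (F : 'I_#|T| -> V) :
  \sum_i F i = \sum_(x : T) F (enum_rank x).
Proof. by rewrite (reindex (@enum_rank T)) //; apply: onW_bij; exact: enum_rank_bij. Qed.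

Lemma sum_pair (T Z : finType) (V : nmodType) (F : T * Z -> V) :
  \sum_u F u = \sum_x \sum_z F (x, z).
Proof. by rewrite pair_bigA; apply: eq_bigr => -[]. Qed.

Lemma sum_mulb (T : finType) (F : T -> C) (x : T) :
  \sum_y F y * (y == x)%:R = F x.
Proof.
rewrite (bigD1 x) //= eqxx mulr1 big1 ?addr0 // => y /negPf ->.
by rewrite mulr0.
Qed.

Lemma kentE (T1 T2 : finType) (f : T2 -> T1 -> C) y x : kent (mkk f) y x = f y x.
Proof. by rewrite /kent mxE !enum_rankK. Qed.

Lemma entE (T : finType) (f : T -> T -> C) x y : ent (mkop f : op R T) x y = f x y.
Proof. exact: kentE. Qed.

Lemma ent_kent (T : finType) (A : op R T) x y : ent A x y = kent A x y.
Proof. by []. Qed.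

Lemma kentP (T1 T2 : finType) (A B : 'M[C]_(#|T2|, #|T1|)) :
  (forall y x, kent A y x = kent B y x) -> A = B.
Proof.
move=> AB; apply/matrixP => i j.
by have := AB (enum_val i) (enum_val j); rewrite /kent !enum_valK.
Qed.

Lemma kentM (T1 T2 T3 : finType) (A : 'M[C]_(#|T3|, #|T2|)) (B : 'M[C]_(#|T2|, #|T1|)) z x :
  kent (A *m B) z x = \sum_y kent A z y * kent B y x.
Proof. by rewrite /kent mxE sum_enum_rank. Qed.

Lemma kent_adj (T1 T2 : finType) (A : 'M[C]_(#|T2|, #|T1|)) y x :
  kent (A ^t*) x y = (kent A y x)^*.
Proof. by rewrite /kent !mxE. Qed.

Lemma kentD (T1 T2 : finType) (A B : 'M[C]_(#|T2|, #|T1|)) y x :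
  kent (A + B) y x = kent A y x + kent B y x.
Proof. by rewrite /kent mxE. Qed.

Lemma kentZ (T1 T2 : finType) a (A : 'M[C]_(#|T2|, #|T1|)) y x :
  kent (a *: A) y x = a * kent A y x.
Proof. by rewrite /kent mxE. Qed.

Lemma kent0 (T1 T2 : finType) y x : kent (0 : 'M[C]_(#|T2|, #|T1|)) y x = 0.
Proof. by rewrite /kent mxE. Qed.

Lemma kent_sum (T1 T2 : finType) (I : Type) (r : seq I) (P : pred I)
    (A : I -> 'M[C]_(#|T2|, #|T1|)) y x :
  kent (\sum_(i <- r | P i) A i) y x = \sum_(i <- r | P i) kent (A i) y x.
Proof. by rewrite /kent summxE. Qed.

Lemma kent1 (T : finType) (y x : T) : kent (1%:M : 'M[C]_#|T|) y x = (y == x)%:R.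
Proof. by rewrite /kent mxE (inj_eq enum_rank_inj). Qed.

Lemma kent_munit (T : finType) (a b x y : T) :
  kent (munit R a b) x y = ((x == a) && (y == b))%:R.
Proof. by rewrite /kent mxE !(inj_eq enum_rank_inj). Qed.

Lemma kent_trace (T : finType) (A : 'M[C]_#|T|) : \tr A = \sum_x kent A x x.
Proof. exact: sum_enum_rank. Qed.

Lemma kent_conj (T1 T2 : finType) (K : 'M[C]_(#|T2|, #|T1|)) (X : op R T1) y y' :
  kent (K *m X *m K ^t*) y y' =
  \sum_x \sum_x' kent K y x * kent X x x' * (kent K y' x')^*.
Proof.
rewrite kentM exchange_big /=; apply: eq_bigr => x' _.
by rewrite kentM kent_adj big_distrl.
Qed.

Lemma psdP (T : finType) (A : op R T) :
  psd A <-> forall f : T -> C, 0 <= \sum_x \sum_y (f x)^* * ent A x y * f y.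
Proof.
have formE (v : 'cV[C]_#|T|) : (v ^t* *m A *m v) 0 0 =
    \sum_x \sum_y (v (enum_rank x) 0)^* * ent A x y * v (enum_rank y) 0.
  rewrite mxE sum_enum_rank exchange_big /=; apply: eq_bigr => y _.
  by rewrite mxE sum_enum_rank big_distrl; apply: eq_bigr => x _; rewrite !mxE.
split=> [Ap f|Af v]; last by rewrite formE; exact: (Af (fun x => v (enum_rank x) 0)).
have := Ap (\col_i f (enum_val i)); rewrite formE.
under eq_bigr do under eq_bigr do rewrite !mxE !enum_rankK.
by [].
Qed.

(** The filter [P] serves to select, later on, the Kraus operators of one erasure pattern. *)
Definition krausmap (T1 T2 I : finType) (P : pred I)
    (K : I -> 'M[C]_(#|T2|, #|T1|)) : superop R T1 T2 :=
  fun X => \sum_(i | P i) K i *m X *m (K i) ^t*.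

Lemma krausmap_linear (T1 T2 I : finType) (P : pred I)
    (K : I -> 'M[C]_(#|T2|, #|T1|)) : linear (krausmap P K).
Proof.
move=> a X Y; rewrite /krausmap scaler_sumr -big_split /=; apply: eq_bigr => i _.
by rewrite mulmxDr mulmxDl -scalemxAr -scalemxAl.
Qed.

Definition lift_id (T1 T2 Z : finType) (K : 'M[C]_(#|T2|, #|T1|)) :
    'M[C]_(#|((T2 * Z)%type : finType)|, #|((T1 * Z)%type : finType)|) :=
  mkk (fun u v => kent K u.1 v.1 * (v.2 == u.2)%:R).

Lemma ext_id_krausmap (T1 T2 Z I : finType) (P : pred I)
    (K : I -> 'M[C]_(#|T2|, #|T1|)) (X : op R (T1 * Z)%type) :
  ext_id (krausmap P K) X = krausmap P (fun i => lift_id Z (K i)) X.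
Proof.
apply: kentP => u v; rewrite /ext_id kentE /krausmap /ent -!/(kent _ _ _) !kent_sum.
apply: eq_bigr => i _; rewrite !kent_conj.
rewrite sum_pair; apply: eq_bigr => x _.
transitivity (\sum_z \sum_x' kent (K i) u.1 x * kent X (x, z) (x', v.2)
    * (kent (K i) v.1 x')^* * (z == u.2)%:R).
  rewrite exchange_big; apply: eq_bigr => x' _.
  by rewrite (sum_mulb (fun z => _ * kent X (x, z) _ * _)) kentE.
apply: eq_bigr => z _; rewrite sum_pair; apply: eq_bigr => x' _.
transitivity (\sum_z' kent (K i) u.1 x * (z == u.2)%:R * kent X (x, z) (x', z')
    * (kent (K i) v.1 x')^* * (z' == v.2)%:R).
  by rewrite (sum_mulb (fun z' => _ * kent X _ (x', z') * _)); ring.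
by apply: eq_bigr => z' _; rewrite !kentE /= rmorphM /= rmorph_nat mulrA.
Qed.

Lemma krausmap_psd (T1 T2 I : finType) (P : pred I)
    (K : I -> 'M[C]_(#|T2|, #|T1|)) (X : op R T1) :
  psd X -> psd (krausmap P K X).
Proof. by move=> Xp; apply: psdmx_sum => i _; exact: psdmx_conj. Qed.

Lemma krausmap_cp (T1 T2 I : finType) (P : pred I)
    (K : I -> 'M[C]_(#|T2|, #|T1|)) : completely_positive (krausmap P K).
Proof. by move=> m X Xp; rewrite ext_id_krausmap; exact: krausmap_psd. Qed.

Lemma krausmap_tr (T1 T2 I : finType) (P : pred I)
    (K : I -> 'M[C]_(#|T2|, #|T1|)) (X : op R T1) :
  \tr (krausmap P K X) = \tr (\sum_(i | P i) (K i) ^t* *m K i *m X).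
Proof.
rewrite /krausmap !raddf_sum /=; apply: eq_bigr => i _.
by rewrite mxtrace_mulC mulmxA.
Qed.

Lemma krausmap_channel (T1 T2 I : finType) (P : pred I)
    (K : I -> 'M[C]_(#|T2|, #|T1|)) :
  \sum_(i | P i) (K i) ^t* *m K i = 1%:M -> channel (krausmap P K).
Proof.
move=> K1; split; [exact: krausmap_linear | exact: krausmap_cp |].
by move=> X; rewrite krausmap_tr -mulmx_suml K1 mul1mx.
Qed.

(** [completely_positive] speaks of the references ['I_m] only; an arbitrary Z is transported along
    its enumeration. *)
Lemma channel_ext_id_psd (T1 T2 Z : finType) (D : superop R T1 T2)
    (X : op R (T1 * Z)%type) :
  completely_positive D -> psd X -> psd (ext_id D X).
Proof.
move=> Dcp /psdP Xp.
pose phi (T : finType) (u : T * 'I_#|Z|) := (u.1, enum_val u.2).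
pose psi (T : finType) (u : T * Z) := (u.1, enum_rank u.2).
have phiK T : cancel (phi T) (psi T) by move=> [x i]; rewrite /phi /psi enum_valK.
have psiK T : cancel (psi T) (phi T) by move=> [x i]; rewrite /phi /psi enum_rankK.
have phib T : {on [pred i | true], bijective (phi T)}.
  by apply: onW_bij; exists (psi T).
have psib T : {on [pred i | true], bijective (psi T)}.
  by apply: onW_bij; exists (phi T).
pose X' : op R (T1 * 'I_#|Z|)%type := mkop (fun u v => ent X (phi _ u) (phi _ v)).
have /Dcp/psdP Yp : psd X'.
  apply/psdP => f; have := Xp (f \o psi T1).
  rewrite (reindex (phi T1)) //=; congr (0 <= _); apply: eq_bigr => u _.
  rewrite (reindex (phi T1)) //=; apply: eq_bigr => v _.
  by rewrite !phiK entE.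
apply/psdP => f; have := Yp (f \o phi T2).
rewrite (reindex (psi T2)) //=; congr (0 <= _); apply: eq_bigr => u _.
rewrite (reindex (psi T2)) //=; apply: eq_bigr => v _.
rewrite !psiK !entE /=; congr (_ * ent (D _) _ _ * _).
by apply: kentP => x y; rewrite !kentE !entE /phi /= !enum_rankK.
Qed.

Lemma ext_id_trace (T1 T2 Z : finType) (D : superop R T1 T2)
    (X : op R (T1 * Z)%type) :
  trace_preserving D -> \tr (ext_id D X) = \tr X.
Proof.
move=> Dtp; rewrite !kent_trace !sum_pair exchange_big [RHS]exchange_big /=.
apply: eq_bigr => z _.
under eq_bigr do rewrite kentE /=.
have := Dtp (mkop (fun x y => ent X (x, z) (y, z))).
by rewrite !kent_trace => ->; apply: eq_bigr => x _; rewrite kentE.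
Qed.

Definition max_vec (L : finType) : 'cV[C]_#|((L * L)%type : finType)| :=
  \col_i (sqrtC (#|L|%:R)^-1 * ((enum_val i).1 == (enum_val i).2)%:R).

Lemma max_vecE (L : finType) (u : L * L) :
  max_vec L (enum_rank u) 0 = sqrtC (#|L|%:R)^-1 * (u.1 == u.2)%:R.
Proof. by rewrite mxE enum_rankK. Qed.

Lemma max_coef (L : finType) :
  (sqrtC (#|L|%:R)^-1 : C)^* * sqrtC (#|L|%:R)^-1 = (#|L|%:R)^-1.
Proof.
rewrite (CrealP (ger0_real _)) ?sqrtC_ge0 ?invr_ge0 ?ler0n //.
by rewrite -expr2 sqrtCK.
Qed.

Lemma max_entangledE (L : finType) : max_entangled R L = max_vec L *m (max_vec L) ^t*.
Proof.
apply: kentP => u v; rewrite /max_entangled kentE /kent mxE big_ord1 !mxE !enum_rankK.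
rewrite rmorphM /= rmorph_nat mulrACA [X in _ = X * _]mulrC max_coef.
by rewrite mulrA.
Qed.

Lemma sum_eq_fst (L : finType) (F : L -> L -> C) :
  \sum_x \sum_y F x y * (x == y)%:R = \sum_x F x x.
Proof.
apply: eq_bigr => x _; rewrite -(sum_mulb (F x)).
by apply: eq_bigr => y _; rewrite eq_sym.
Qed.

Lemma max_vec_form (L : finType) (s : op R (L * L)%type) :
  ((max_vec L) ^t* *m s *m max_vec L) 0 0 =
  (#|L|%:R)^-1 * \sum_x \sum_y ent s (x, x) (y, y).
Proof.
rewrite mxE sum_enum_rank sum_pair.
transitivity (\sum_y \sum_z (\sum_x (sqrtC (#|L|%:R)^-1)^* * sqrtC (#|L|%:R)^-1
   * ent s (x, x) (y, z)) * (y == z)%:R).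
  apply: eq_bigr => y _; apply: eq_bigr => z _.
  rewrite max_vecE mulrA; congr (_ * _).
  rewrite mxE sum_enum_rank sum_pair big_distrl /=.
  rewrite -(sum_eq_fst (fun x x' => (sqrtC (#|L|%:R)^-1)^* * sqrtC (#|L|%:R)^-1
   * ent s (x, x') (y, z))) /=; apply: eq_bigr => x _.
  rewrite big_distrl /=; apply: eq_bigr => x' _.
  rewrite !mxE enum_rankK /= rmorphM /= rmorph_nat; rewrite /ent.
  ring.
rewrite (sum_eq_fst (fun y z => \sum_x _ * ent s (x, x) (y, z))) exchange_big /=.
rewrite big_distrr /=; apply: eq_bigr => x _.
rewrite big_distrr /=; apply: eq_bigr => y _.
by rewrite max_coef.
Qed.

Lemma max_vec_unit (L : finType) : (0 < #|L|)%N ->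
  (max_vec L) ^t* *m max_vec L = 1%:M.
Proof.
move=> L0; apply/matrixP => i j; rewrite !ord1 -[in LHS](mulmx1 ((max_vec L) ^t*)).
rewrite max_vec_form [RHS]mxE eqxx mulr1n.
under eq_bigr do under eq_bigr do rewrite ent_kent kent1 xpair_eqE andbb eq_sym.
under eq_bigr => x _ do rewrite -(eq_bigr _ (fun y _ => mul1r _)) (sum_mulb (fun=> 1)).
by rewrite sumr_const mulVf // pnatr_eq0 -lt0n.
Qed.

Lemma linear_map0 (T1 T2 : finType) (T : superop R T1 T2) : linear T -> T 0 = 0.
Proof. by move=> Tl; have := Tl (-1) 0 0; rewrite scaler0 addr0 scaleN1r addNr. Qed.

Lemma linear_mapD (T1 T2 : finType) (T : superop R T1 T2) X Y :
  linear T -> T (X + Y) = T X + T Y.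
Proof. by move=> Tl; have := Tl 1 X Y; rewrite !scale1r. Qed.

Lemma linear_mapZ (T1 T2 : finType) (T : superop R T1 T2) a X :
  linear T -> T (a *: X) = a *: T X.
Proof. by move=> Tl; have := Tl a X 0; rewrite (linear_map0 Tl) !addr0. Qed.

Lemma linear_map_sum (T1 T2 I : finType) (P : pred I) (T : superop R T1 T2)
    (X : I -> op R T1) :
  linear T -> T (\sum_(i | P i) X i) = \sum_(i | P i) T (X i).
Proof.
move=> Tl; apply: (big_morph T) => [Y Z|]; [exact: linear_mapD | exact: linear_map0].
Qed.

(* Entanglement fidelity of a linear map with the identity channel. *)
Definition efid (L : finType) (T : superop R L L) : C :=
  (#|L|%:R)^-2 * \sum_x \sum_y ent (T (munit R x y)) x y.

Lemma max_vec_ext_id (L : finType) (T : superop R L L) : linear T ->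
  ((max_vec L) ^t* *m ext_id T (max_entangled R L) *m max_vec L) 0 0 = efid T.
Proof.
move=> Tlin; rewrite max_vec_form /efid expr2 invfM -mulrA; congr (_ * _).
rewrite big_distrr /=; apply: eq_bigr => x _.
rewrite big_distrr /=; apply: eq_bigr => y _.
rewrite entE /=.
have T0 := linear_map0 Tlin.
have -> : mkop (fun a b => ent (max_entangled R L) (a, x) (b, y)) =
    (#|L|%:R)^-1 *: munit R x y + 0.
  apply: kentP => a b; rewrite kentE entE /= addr0 kentZ kent_munit.
  by rewrite -mulrA -natrM mulnb.
by rewrite Tlin T0 addr0 !ent_kent kentZ.
Qed.

Lemma purified_distance_max (L : finType) (s : op R (L * L)%type) :
  (0 < #|L|)%N -> psd s ->
  purified_distance (max_entangled R L) s =
  Num.sqrt (1 - complex.Re (((max_vec L) ^t* *m s *m max_vec L) 0 0)).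
Proof.
move=> L0 sp; rewrite /purified_distance max_entangledE fidelity_projector //.
exact: max_vec_unit.
Qed.

Lemma max_entangled_psd (L : finType) : psd (max_entangled R L).
Proof. by rewrite max_entangledE; exact: psdmx_outer. Qed.

Lemma max_entangled_trace (L : finType) : (0 < #|L|)%N -> \tr (max_entangled R L) = 1.
Proof.
by move=> L0; rewrite max_entangledE mxtrace_mulC max_vec_unit // mxtrace1.
Qed.

Lemma ext_id_comp (T1 T2 T3 Z : finType) (D : superop R T2 T3) (F : superop R T1 T2)
    (X : op R (T1 * Z)%type) :
  ext_id (D \o F) X = ext_id D (ext_id F X).
Proof.
apply: kentP => u v; rewrite !kentE /=; congr (ent (D _) _ _).
by apply: kentP => x y; rewrite !kentE entE.
Qed.

Lemma ent_linear_sum (T : finType) (I : Type) (r : seq I) (P : pred I)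
    (A : I -> op R T) x y :
  ent (\sum_(i <- r | P i) A i) x y = \sum_(i <- r | P i) ent (A i) x y.
Proof. exact: kent_sum. Qed.

Lemma purified_distance_efid (L S : finType) (D : superop R S L) (F : superop R L S) :
  (0 < #|L|)%N -> channel D -> linear F -> completely_positive F ->
  purified_distance (max_entangled R L) (ext_id (D \o F) (max_entangled R L))
  = Num.sqrt (1 - complex.Re (efid (D \o F))).
Proof.
move=> L0 [Dlin Dcp Dtp] Flin Fcp.
rewrite purified_distance_max // ?max_vec_ext_id //.
  by move=> a X Y /=; rewrite Flin Dlin.
rewrite ext_id_comp; do 2! apply: channel_ext_id_psd => //.
exact: max_entangled_psd.
Qed.

(** Witnesses that decoders exist, so that a lower bound valid for each decoder passes to the
    infimum. *)
Lemma constant_channel (S L : finType) (l : L) :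
  channel (krausmap xpredT (fun s : S =>
    mkk (fun (y : L) (x : S) => (y == l)%:R * (x == s)%:R))).
Proof.
apply: krausmap_channel; apply: kentP => x x'; rewrite kent_sum kent1.
transitivity (\sum_s (x == s)%:R * (s == x')%:R : C).
  apply: eq_bigr => s _; rewrite kentM (bigD1 l) //= big1 ?addr0.
    by rewrite kent_adj !kentE eqxx !mul1r rmorph_nat [s == x']eq_sym.
  by move=> y /negPf yl; rewrite !kentE yl !mul0r mulr0.
by rewrite sum_mulb.
Qed.

Lemma choi_error_ge (L S S' : finType) (N : superop R S S') (E : superop R L S) (y : R) :
  (0 < #|L|)%N -> linear (N \o E) -> completely_positive (N \o E) ->
  (forall D, channel D -> complex.Re (efid (D \o (N \o E))) <= 1 - y) ->
  Num.sqrt y <= choi_error N E.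
Proof.
move=> L0 NElin NEcp H; rewrite /choi_error; apply: lb_le_inf.
  have /card_gt0P[l _] := L0.
  by eexists; exists (krausmap xpredT (fun s : S' =>
    mkk (fun (y : L) (x : S') => (y == l)%:R * (x == s)%:R))) => //;
    exact: constant_channel.
move=> _ [D Dch <-]; rewrite (@purified_distance_efid _ _ D (N \o E)) //.
by apply: ler_wsqrtr; rewrite lerBrDr -lerBrDl H.
Qed.

Lemma choi_error_le (L S S' : finType) (N : superop R S S') (E : superop R L S)
    (D : superop R S' L) (y : R) :
  (0 < #|L|)%N -> linear (N \o E) -> completely_positive (N \o E) -> channel D ->
  1 - y <= complex.Re (efid (D \o (N \o E))) ->
  choi_error N E <= Num.sqrt y.
Proof.
move=> L0 NElin NEcp Dch H.
apply: le_trans (_ : Num.sqrt (1 - complex.Re (efid (D \o (N \o E)))) <= _); last first.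
  by apply: ler_wsqrtr; rewrite lerBlDr -lerBlDl.
rewrite -purified_distance_efid //; apply: ge_inf; last by exists D.
by exists 0 => _ [D' _ <-]; exact: sqrtr_ge0.
Qed.

Lemma choi_error_ge0 (L S S' : finType) (N : superop R S S') (E : superop R L S) :
  0 <= choi_error N E.
Proof.
rewrite /choi_error /inf oppr_ge0.
have [->|] := pselect ([set purified_distance (max_entangled R L)
             (ext_id (D \o N \o E) (max_entangled R L))
      | D in [set D : superop R S' L | channel D]] = set0).
  by rewrite image_set0 sup0.
move=> /eqP/set0P ne; apply: ge_sup; first by case: ne => x; exists (- x); exists x.
by move=> _ [_ [D _ <-] <-]; rewrite oppr_le0 sqrtr_ge0.
Qed.
End Operators.

(** * Pauli strings and their commutation signs *)

Section Pauli.
Local Open Scope sesquilinear_scope.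
Variable R : realType.
Local Notation C := R[i].
Variable Q : finType.
Local Notation bits := {ffun Q -> bool}.
Local Notation pstr := {ffun Q -> bool * bool}.

(* The additive structures are those of the field bool = F_2. *)
Definition xpart (f : pstr) : bits := [ffun q => (f q).1].
Definition zdot (f : pstr) (t : bits) : bool := \sum_q ((f q).2 * t q).
(** The symplectic form over F_2, true exactly when the two strings anticommute ([pauliC]). *)
Definition symp (f g : pstr) : bool := zdot f (xpart g) + zdot g (xpart f).

Lemma addbb_ffun (t : bits) : t + t = 0.
Proof. by apply/ffunP => q; rewrite !ffunE; exact: addbb. Qed.

Lemma addff (f : pstr) : f + f = 0.
Proof.
apply/ffunP => q; rewrite !ffunE; case: (f q) => x z.
by rewrite -[LHS]/(addb x x, addb z z) !addbb.
Qed.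

Lemma oppff (f : pstr) : - f = f.
Proof. by apply/eqP; rewrite eq_sym -addr_eq0 addff. Qed.

Lemma addff_eq0 (f g : pstr) : (f + g == 0) = (f == g).
Proof. by rewrite addr_eq0 oppff. Qed.

Lemma xpartD f g : xpart (f + g) = xpart f + xpart g.
Proof. by apply/ffunP => q; rewrite !ffunE. Qed.

Lemma zdotDr f t u : zdot f (t + u) = zdot f t + zdot f u.
Proof. by rewrite /zdot -big_split; apply: eq_bigr => q _; rewrite !ffunE mulrDr. Qed.

Lemma zdotDl f g t : zdot (f + g) t = zdot f t + zdot g t.
Proof. by rewrite /zdot -big_split; apply: eq_bigr => q _; rewrite !ffunE mulrDl. Qed.

Lemma symC f g : symp f g = symp g f. Proof. exact: addrC. Qed.

Lemma sympDl f g h : symp (f + g) h = symp f h + symp g h.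
Proof. by rewrite /symp xpartD zdotDl zdotDr addrACA. Qed.

Lemma sympff f : symp f f = false. Proof. exact: addbb. Qed.

Definition sgn (b : bool) : C := (-1) ^+ b.

Lemma sgnD (b c : bool) : sgn (b + c) = sgn b * sgn c.
Proof. exact: signr_addb. Qed.

Lemma sgnK b : sgn b * sgn b = 1.
Proof. by case: b; rewrite /sgn ?expr0 ?expr1 ?mulr1 // mulrNN mulr1. Qed.

Lemma sgn_inj : injective sgn.
Proof.
have N1 : (1 : C) != -1.
  by rewrite -subr_eq0 opprK -[1 + 1]/(2%:R) pnatr_eq0.
by move=> [] [] //; rewrite /sgn expr0 expr1 => /eqP; rewrite ?(negPf N1) // eq_sym (negPf N1).
Qed.

Lemma sgn_neq0 b : sgn b != 0.
Proof. by rewrite /sgn signr_eq0. Qed.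

Lemma sgn_conj b : (sgn b)^* = sgn b.
Proof. by rewrite /sgn rmorphXn /= rmorphN rmorph1. Qed.

Lemma sgn_sum (I : finType) (F : I -> bool) : sgn (\sum_i F i) = \prod_i sgn (F i).
Proof. by apply: (big_morph sgn sgnD); rewrite /sgn expr0. Qed.

Lemma eq_ffunb (s t : bits) : (s == t) = [forall q, s q == t q].
Proof.
by apply/eqP/forallP => [-> // | st]; apply/ffunP => q; exact/eqP.
Qed.

Definition pauli0 (f : pstr) : op R bits := pauli R ((ord0, f) : pauli_elt Q).

Lemma pauliE (c : 'I_4) (f : pstr) s t :
  kent (pauli R ((c, f) : pauli_elt Q)) s t
  = 'i ^+ c * (s == t + xpart f)%:R * sgn (zdot f t).
Proof.
rewrite kentE big_split /= prod_natb -mulrA; congr (_ * ((nat_of_bool _)%:R * _)).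
  by rewrite eq_ffunb; apply/forallP/forallP => h q; have := h q; rewrite !ffunE.
by rewrite /zdot sgn_sum.
Qed.

Lemma pauliZ c f : pauli R ((c, f) : pauli_elt Q) = 'i ^+ c *: pauli0 f.
Proof. by apply: kentP => s t; rewrite kentZ !pauliE expr0 mul1r mulrA. Qed.

Lemma pauli0E f s t :
  kent (pauli0 f) s t = (s == t + xpart f)%:R * sgn (zdot f t).
Proof. by rewrite pauliE expr0 mul1r. Qed.

Lemma kent_mul_pauli (T : finType) (A : 'M[C]_(#|T|, #|{ffun Q -> bool} : finType|)) f s t :
  kent (A *m pauli0 f) s t = kent A s (t + xpart f) * sgn (zdot f t).
Proof.
rewrite kentM (bigD1 (t + xpart f)) //= pauli0E eqxx mul1r big1 ?addr0 //.
by move=> u /negPf ut; rewrite pauli0E ut mul0r mulr0.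
Qed.

Lemma kent_pauli_mul (T : finType) (A : 'M[C]_(#|{ffun Q -> bool} : finType|, #|T|)) f s t :
  kent (pauli0 f *m A) s t = sgn (zdot f (s + xpart f)) * kent A (s + xpart f) t.
Proof.
rewrite kentM (bigD1 (s + xpart f)) //= pauli0E.
rewrite -addrA addbb_ffun addr0 eqxx mul1r big1 ?addr0 //.
move=> u us; rewrite pauli0E; case: eqP => [E|_]; last by rewrite !mul0r.
by move: us; rewrite E -addrA addbb_ffun addr0 eqxx.
Qed.

Lemma pauli00 : pauli0 0 = 1%:M.
Proof.
apply: kentP => s t; rewrite pauli0E kent1.
have -> : xpart 0 = 0 by apply/ffunP => q; rewrite !ffunE.
by rewrite addr0 /zdot big1 ?mulr1 // => q _; rewrite ffunE mul0r.
Qed.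

Lemma pauliM f g :
  pauli0 f *m pauli0 g = sgn (zdot f (xpart g)) *: pauli0 (f + g).
Proof.
apply: kentP => s t; rewrite kent_mul_pauli kentZ !pauli0E xpartD addrA.
rewrite (addrAC t) zdotDl zdotDr !sgnD.
by ring.
Qed.

Lemma pauliC f g :
  pauli0 f *m pauli0 g = sgn (symp f g) *: (pauli0 g *m pauli0 f).
Proof. by rewrite !pauliM scalerA addrC sgnD -mulrA sgnK mulr1. Qed.

Lemma pauli_adj f : (pauli0 f) ^t* = sgn (zdot f (xpart f)) *: pauli0 f.
Proof.
apply: kentP => s t; rewrite kent_adj kentZ !pauli0E rmorphM /= rmorph_nat sgn_conj.
have -> : (t == s + xpart f) = (s == t + xpart f).
  by apply/eqP/eqP => ->; rewrite -addrA addbb_ffun addr0.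
case: eqP => [->|_]; last by rewrite !mul0r mulr0.
by rewrite zdotDr sgnD; ring.
Qed.

Lemma pauli_sqr f : pauli0 f *m pauli0 f = sgn (zdot f (xpart f)) *: 1%:M.
Proof. by rewrite pauliM addff pauli00. Qed.

Lemma pauli_adjK f : (pauli0 f) ^t* *m pauli0 f = 1%:M.
Proof. by rewrite pauli_adj -scalemxAl pauli_sqr scalerA sgnK scale1r. Qed.

Lemma pauli_Kadj f : pauli0 f *m (pauli0 f) ^t* = 1%:M.
Proof. by rewrite pauli_adj -scalemxAr pauli_sqr scalerA sgnK scale1r. Qed.

(** The x part is read off the positions of the nonzero entries, the coefficient off column 0, and
    the z part off the columns with a single 1. *)
Lemma pauli_inj a b f g : a != 0 -> a *: pauli0 f = b *: pauli0 g -> a = b /\ f = g.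
Proof.
move=> a0 E.
have ev t : a * sgn (zdot f t) =
    b * (t + xpart f == t + xpart g)%:R * sgn (zdot g t).
  have := congr1 (fun A => kent A (t + xpart f) t) E.
  by rewrite !kentZ !pauli0E eqxx mul1r mulrA.
have z0 h : zdot h 0 = 0 by rewrite /zdot big1 // => q _; rewrite ffunE mulr0.
have xx : xpart f = xpart g.
  apply/eqP; have := ev 0; rewrite !z0 !add0r /sgn expr0 !mulr1.
  by case: eqP => // _; rewrite mulr0 => /eqP; rewrite (negPf a0).
have ab : a = b by have := ev 0; rewrite !z0 xx eqxx /sgn expr0 !mulr1.
split=> //; apply/ffunP => q.
have /(mulfI a0)/sgn_inj : a * sgn (zdot f [ffun p => p == q]) =
    a * sgn (zdot g [ffun p => p == q]).
  by rewrite ev xx eqxx mulr1 ab.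
have zq h : zdot h [ffun p => p == q] = (h q).2.
  rewrite /zdot (bigD1 q) //= ffunE eqxx mulr1 big1 ?addr0 // => p /negPf pq.
  by rewrite ffunE pq mulr0.
rewrite !zq; have /ffunP/(_ q) := xx; rewrite !ffunE.
by case: (f q) (g q) => [? ?] [? ?] /= -> ->.
Qed.

Definition symp1 (a b : bool * bool) : bool := a.2 * b.1 + b.2 * a.1.

Lemma sgn_symp f g : sgn (symp f g) = \prod_q sgn (symp1 (f q) (g q)).
Proof.
rewrite -sgn_sum /symp /zdot -big_split; congr sgn; apply: eq_bigr => q _.
by rewrite !ffunE.
Qed.

Lemma sum_symp1 (a : bool * bool) : \sum_b sgn (symp1 a b) = 4 * (a == 0)%:R.
Proof.
rewrite sum_pair !big_bool /= /symp1 /sgn.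
case: a => [[] []] /=; rewrite ?expr0 ?expr1 ?eqxx.
all: rewrite -?[(_, _) == 0]/false -?[(false, false) == 0]/true; ring.
Qed.

Lemma sum_symp_supp (e : pred Q) (g : pstr) :
  \sum_(f : pstr | [forall q, (f q != 0) ==> e q]) sgn (symp f g)
  = 4 ^+ #|e| * ([forall q, e q ==> (g q == 0)])%:R.
Proof.
pose F q (a : bool * bool) := ((a != 0) ==> e q)%:R * sgn (symp1 (g q) a).
rewrite big_mkcond /=.
transitivity (\sum_(f : pstr) \prod_q F q (f q)).
  apply: eq_bigr => f _; rewrite big_split /= prod_natb -sgn_symp symC.
  by case: ifP => _; rewrite ?mul1r ?mul0r.
rewrite -bigA_distr_bigA /=.
transitivity (\prod_q ((if e q then 4 else 1) * (e q ==> (g q == 0))%:R : C)).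
  apply: eq_bigr => q _; rewrite /F; case: (e q).
    by rewrite -sum_symp1; apply: eq_bigr => a _; rewrite implybT mul1r.
  rewrite mulr1 (bigD1 (0 : bool * bool)) //= mul1r big1 ?addr0.
    by rewrite /symp1 /= !mulr0 mul0r addr0 /sgn expr0.
  by move=> a a0; rewrite a0 /= mul0r.
by rewrite big_split /= -big_mkcond prodr_const prod_natb.
Qed.

Lemma sum_symp (g : pstr) : \sum_(f : pstr) sgn (symp f g) = 4 ^+ #|Q| * (g == 0)%:R.
Proof.
have := sum_symp_supp xpredT g; rewrite (eq_bigl xpredT); last first.
  by move=> f; apply/forallP => q; rewrite implybT.
move=> ->; rewrite cardT -cardE; congr (_ * (nat_of_bool _)%:R).
apply/forallP/eqP => [g0|-> q]; last by rewrite ffunE eqxx.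
by apply/ffunP => q; rewrite ffunE; exact/eqP/g0.
Qed.

(** The form is nondegenerate: if f commuted with everything, the character sum would count all
    strings instead of vanishing. *)
Lemma exists_anticomm (f : pstr) : f != 0 -> exists g, symp g f.
Proof.
move=> f0; apply/existsP; rewrite -[[exists _, _]]negbK negb_exists.
apply/negP => /forallP h; have := sum_symp f; rewrite (negPf f0) mulr0.
rewrite (eq_bigr (fun=> 1)) ?sumr_const; last first.
  by move=> g _; rewrite (negPf (h g)) /sgn expr0.
by move/eqP; rewrite pnatr_eq0 => /eqP/card0_eq/(_ 0).
Qed.

(** For f distinct from g, the sum over h of (1 - sign with f) (1 - sign with g) expands into
    character sums of f, g and f + g, all nonzero strings; it is thus the number of strings, so some
    term is nonzero. *)
Lemma exists_anticomm2 (f g : pstr) : f != 0 -> g != 0 ->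
  exists h, symp h f /\ symp h g.
Proof.
move=> f0 g0; have [->|fg] := eqVneq f g.
  by have [h hg] := exists_anticomm g0; exists h.
suff /existsP[h /andP[]] : [exists h, symp h f && symp h g] by exists h.
rewrite -[[exists _, _]]negbK negb_exists; apply/negP => /forallP hh.
have : \sum_(h : pstr) (1 - sgn (symp h f)) * (1 - sgn (symp h g)) = 0.
  apply: big1 => h _; have := hh h; rewrite negb_and => /orP[/negPf->|/negPf->].
    by rewrite /sgn expr0 subrr mul0r.
  by rewrite /sgn expr0 subrr mulr0.
under eq_bigr => h _.
  have -> : (1 - sgn (symp h f)) * (1 - sgn (symp h g)) =
    1 - sgn (symp h f) - sgn (symp h g) + sgn (symp h (f + g)).
    by rewrite [symp h (f + g)]symC sympDl ![symp _ h]symC sgnD; ring.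
  over.
rewrite big_split /= !sumrB !sum_symp (negPf f0) (negPf g0) addff_eq0 (negPf fg).
rewrite !mulr0 !subr0 addr0 sumr_const.
by move/eqP; rewrite pnatr_eq0 => /eqP/card0_eq/(_ 0).
Qed.

(** Conjugation by a string anticommuting with f keeps the trace and flips its sign. *)
Lemma pauli_trace f : f != 0 -> \tr (pauli0 f) = 0.
Proof.
move=> /exists_anticomm[g gf].
have : \tr (pauli0 g *m pauli0 f *m (pauli0 g) ^t*) = \tr (pauli0 f).
  by rewrite mxtrace_mulC mulmxA pauli_adjK mul1mx.
rewrite pauliC gf /sgn expr1 scaleN1r mulNmx -mulmxA pauli_Kadj mulmx1.
rewrite raddfN /= => /eqP; rewrite eq_sym -subr_eq0 opprK -mulr2n -mulr_natl.
by rewrite mulf_eq0 pnatr_eq0 /= => /eqP.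
Qed.
End Pauli.

(** * Cliffords acting on Pauli strings, and the image of a string under a random Clifford *)

Section CliffordAction.
Local Open Scope sesquilinear_scope.
Variable R : realType.
Local Notation C := R[i].

Lemma expCi_neq0 (k : nat) : ('i ^+ k : C) != 0.
Proof. by rewrite expf_neq0 // neq0Ci. Qed.

Lemma expCi_mod (k : nat) : exists c : 'I_4, 'i ^+ k = 'i ^+ c :> C.
Proof.
have k4 : (k %% 4 < 4)%N by rewrite ltn_mod.
exists (Ordinal k4) => /=; rewrite {1}(divn_eq k 4) exprD mulnC exprM.
by rewrite -[4%N]/(2 * 2)%N exprM sqrCi sqrrN expr1n expr1n mul1r.
Qed.

Lemma sgn_expCi b : sgn R b = 'i ^+ (2 * b).
Proof. by rewrite exprM sqrCi. Qed.

Section OneRegister.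
Variable Q : finType.
Local Notation pstr := {ffun Q -> bool * bool}.
Local Notation P := (pauli0 R).

(** The action modulo phases, enough here because whether an erasure pattern is fatal depends on
    strings alone. *)
Definition conj_action (U : op R {ffun Q -> bool}) (M : pstr -> pstr) : Prop :=
  U \is unitarymx /\
  forall f, exists c : 'I_4, U *m P f *m U ^t* = 'i ^+ c *: P (M f).

Lemma unitary_Kadj (T : finType) (U : op R T) : U \is unitarymx -> U *m U ^t* = 1%:M.
Proof. by move=> /unitarymxP. Qed.

Lemma unitary_adjK (T : finType) (U : op R T) : U \is unitarymx -> U ^t* *m U = 1%:M.
Proof. by move=> /unitarymxP UU; exact: mulmx1C. Qed.

Lemma conj_mulmx (T : finType) (U A B : op R T) : U \is unitarymx ->
  U *m (A *m B) *m U ^t* = (U *m A *m U ^t*) *m (U *m B *m U ^t*).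
Proof.
move=> Uu; rewrite !mulmxA -[_ *m U ^t* *m U]mulmxA unitary_adjK //.
by rewrite mulmx1.
Qed.

(** Conjugating the relation [pauliC] by U leaves its sign unchanged. *)
Lemma conj_action_symp U M f g : conj_action U M -> symp (M f) (M g) = symp f g.
Proof.
move=> [Uu UM]; have [c cE] := UM f; have [d dE] := UM g.
have := congr1 (fun A => U *m A *m U ^t*) (pauliC R f g).
rewrite conj_mulmx // -scalemxAr -scalemxAl conj_mulmx // cE dE.
rewrite -!scalemxAl -!scalemxAr !pauliM !scalerA [M g + M f]addrC.
move=> /pauli_inj[|E _]; first by rewrite !mulf_neq0 ?expCi_neq0 ?sgn_neq0.
apply: (@sgn_inj R); rewrite /symp sgnD.
have n0 : 'i ^+ c * 'i ^+ d * sgn R (zdot (M g) (xpart (M f))) != 0.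
  by rewrite !mulf_neq0 ?expCi_neq0 ?sgn_neq0.
apply: (mulfI n0).
have gg := sgnK R (zdot (M g) (xpart (M f))).
transitivity ('i ^+ c * 'i ^+ d * sgn R (zdot (M f) (xpart (M g)))).
  by rewrite mulrACA gg mulr1.
by rewrite E; ring.
Qed.

Lemma conj_actionD U M f g : conj_action U M -> M (f + g) = M f + M g.
Proof.
move=> [Uu UM]; have [c cE] := UM f; have [d dE] := UM g; have [e eE] := UM (f + g).
have := congr1 (fun A => U *m A *m U ^t*) (pauliM R f g).
rewrite conj_mulmx // -scalemxAr -scalemxAl cE dE eE.
rewrite -!scalemxAl -!scalemxAr !pauliM !scalerA => E; symmetry.
by have [] := pauli_inj _ E; rewrite ?mulf_neq0 ?expCi_neq0 ?sgn_neq0.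
Qed.

Lemma conj_action0 U M : conj_action U M -> M 0 = 0.
Proof.
by move=> UM; have := conj_actionD 0 0 UM; rewrite addff; rewrite addff.
Qed.

(** A map preserving a nondegenerate form has trivial kernel: some h anticommutes with f + g, hence
    distinguishes M f from M g. *)
Lemma conj_action_inj U M : conj_action U M -> injective M.
Proof.
move=> UM f g fg; apply/eqP; rewrite -addff_eq0; apply: contraT => fg0.
have [h] := exists_anticomm R fg0; rewrite -(conj_action_symp _ _ UM).
by rewrite (conj_actionD _ _ UM) fg symC sympDl; case: (symp _ _).
Qed.

Lemma conj_action_comp U M V K : conj_action U M -> conj_action V K ->
  conj_action (V *m U) (K \o M).
Proof.
move=> [Uu UM] [Vu VK]; split=> [|f]; first exact: mul_unitarymx.
have [c cE] := UM f; have [d dE] := VK (M f).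
have [e eE] := expCi_mod (c + d); exists e; rewrite -eE exprD.
by rewrite adjM !mulmxA -2![V *m _ *m _]mulmxA cE -scalemxAr -scalemxAl dE scalerA.
Qed.

Lemma conj_action_clifford U M : conj_action U M -> clifford U.
Proof.
move=> [Uu UM]; split=> // -[c f]; have [d dE] := UM f.
have [e eE] := expCi_mod (c + d); exists ((e, M f) : pauli_elt Q).
by rewrite !pauliZ -scalemxAr -scalemxAl dE scalerA -exprD eE.
Qed.

(* The Clifford unitary (1 + G) / sqrt 2, with G a phase times P g such that
   G^2 = -1, multiplies by G the strings anticommuting with g. *)
Definition transvection (g f : pstr) : pstr := if symp g f then f + g else f.

Lemma transvectionP g : exists U, conj_action U (transvection g).
Proof.
(* [P g] squares to +1 or -1; the factor i is inserted exactly in the first case, so that G squares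
   to -1 and is anti-Hermitian. *)
pose k : nat := ~~ zdot g (xpart g).
pose G : op R {ffun Q -> bool} := 'i ^+ k *: P g.
have GG : G *m G = - 1%:M.
  rewrite /G -scalemxAl -scalemxAr pauli_sqr !scalerA /k -exprD addnn -muln2 mulnC.
  by rewrite exprM sqrCi /sgn -signr_addb; case: zdot => /=; rewrite expr1 scaleN1r.
have Gadj : G ^t* = - G.
  rewrite /G adjZ pauli_adj scalerA -scaleNr; congr (_ *: _).
  rewrite /k rmorphXn /= conjCi; case: zdot => /=; rewrite /sgn ?expr0 ?expr1 ?mul1r //.
  by rewrite mulr1.
have Gc f : P f *m G = sgn R (symp g f) *: (G *m P f).
  by rewrite /G -scalemxAr -scalemxAl [in LHS]pauliC symC !scalerA mulrC.
pose a : C := (sqrtC 2)^-1.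
have aa : a * a^* = 2^-1.
  rewrite /a fmorphV /= (CrealP (ger0_real _)) ?sqrtC_ge0 ?ler0n //.
  by rewrite -invfM -expr2 sqrtCK.
have half (A : op R {ffun Q -> bool}) : (a * a^*) *: (A + A) = A.
  have h2 : 2^-1 + 2^-1 = 1 :> C by field.
  by rewrite aa scalerDr -scalerDl h2 scale1r.
exists (a *: (1%:M + G)).
have Wadj : (a *: (1%:M + G)) ^t* = a^* *: (1%:M - G).
  by rewrite adjZ adjD adj1 Gadj.
split.
  apply/unitarymxP; rewrite Wadj -scalemxAl -scalemxAr scalerA.
  by rewrite mulmxBr mulmx1 mulmxDl mul1mx GG opprB addrACA subrr addr0 half.
move=> f; rewrite Wadj -!scalemxAl -scalemxAr scalerA -mulmxA mulmxBr mulmx1 Gc.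
(* (1 + G) P (1 - G) is (1 + G)^2 P = 2 G P if P anticommutes with G, and (1 - G^2) P = 2 P if it
   commutes. *)
rewrite /transvection; case: (symp g f).
  rewrite /sgn expr1 scaleN1r opprK mulmxDl mul1mx mulmxDr mulmxA GG mulNmx mul1mx.
  have -> : P f + G *m P f + (G *m P f - P f) = G *m P f + G *m P f.
    by rewrite addrA addrC !addrA addNr add0r.
  rewrite half /G -scalemxAl pauliM scalerA sgn_expCi -exprD [g + f]addrC.
  by have [e ->] := expCi_mod (k + 2 * zdot g (xpart f)); exists e.
exists ord0; rewrite /sgn !expr0 !scale1r mulmxDl mul1mx mulmxBr mulmxA GG.
by rewrite mulNmx mul1mx opprK addrA subrK half.
Qed.

(** For h anticommuting with both, the transvection by g + h sends g to h and the one by h + g'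
    sends h to g'. *)
Lemma clifford_transitive (g g' : pstr) : g != 0 -> g' != 0 ->
  exists U M, conj_action U M /\ M g = g'.
Proof.
move=> g0 g0'; have [h [hg hg']] := exists_anticomm2 R g0 g0'.
have [U UM] := transvectionP (g + h); have [V VM] := transvectionP (h + g').
exists (V *m U); eexists; split; first exact: conj_action_comp UM VM.
have T1 : transvection (g + h) g = h.
  by rewrite /transvection sympDl sympff hg /= addrA addff add0r.
have T2 : transvection (h + g') h = g'.
  by rewrite /transvection sympDl sympff symC hg' /= addrA addff add0r.
by rewrite /= T1.
Qed.

Definition class_action (t : clifford_class R Q) (f : pstr) : pstr := (val t f).2.

Lemma clifford_rep_action (t : clifford_class R Q) :
  conj_action (clifford_rep t) (class_action t).
Proof.
rewrite /clifford_rep; case: cid => U /= [[Uu _] UE]; split=> // f.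
exists (val t f).1; rewrite [LHS]UE -pauliZ.
by rewrite /class_action -surjective_pairing.
Qed.

Lemma clifford_acts_as (U : op R {ffun Q -> bool}) : clifford U -> exists t : clifford_class R Q, acts_as U (val t).
Proof.
move=> Uc; pose t : clifford_action Q := [ffun f => sval (cid (Uc.2 ((ord0, f) : pauli_elt Q)))].
have Ut : acts_as U t by split=> // f; rewrite ffunE; case: cid.
have ht : `[< exists U : op R _, acts_as U t >] by apply/asboolP; exists U.
by exists (Sub t ht).
Qed.

Lemma pauli_elt_inj : injective (@pauli R Q).
Proof.
move=> [c f] [d g]; rewrite !pauliZ => /pauli_inj[|E ->]; first exact: expCi_neq0.
congr (_, _); apply/val_inj; move: E; case: c d => [c c4] [d d4] /=.
wlog cd : c d c4 d4 / (c <= d)%N.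
  by move=> H E; case/orP: (leq_total c d) => cd; [|symmetry]; exact: H.
rewrite -(subnK cd) exprD -{1}['i ^+ c]mul1r => /(mulIf (expCi_neq0 _)).
have : (d - c < 4)%N by apply: leq_ltn_trans d4; exact: leq_subr.
have N1 : (1 : C) != -1 by rewrite -subr_eq0 opprK -[1 + 1]/(2%:R) pnatr_eq0.
have i1 : ('i : C) != 1.
  by apply: contra N1 => /eqP i1; rewrite -sqrCi i1 expr1n.
case: (d - c)%N => [|[|[|[|//]]]] _; rewrite ?add0n //.
- by rewrite expr1 => /esym/eqP; rewrite (negPf i1).
- by rewrite sqrCi => /eqP; rewrite (negPf N1).
- rewrite exprS sqrCi mulrN1 => /esym/eqP; rewrite eqr_oppLR => /eqP iN.
  by move: N1; rewrite -sqrCi iN sqrrN expr1n eqxx.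
Qed.

(** Left multiplication by a Clifford permutes the classes. Injectivity is obtained from the full
    Pauli elements, phases included, since a class records them. *)
Lemma class_action_mul U M : conj_action U M ->
  exists2 phi : clifford_class R Q -> clifford_class R Q, injective phi &
    forall t f, class_action (phi t) f = M (class_action t f).
Proof.
move=> UM.
have H (t : clifford_class R Q) : exists t' : clifford_class R Q,
    forall f, pauli R (val t' f) = U *m pauli R (val t f) *m U ^t*.
  have [t' [_ tE]] := clifford_acts_as (conj_action_clifford
    (conj_action_comp (clifford_rep_action t) UM)).
  exists t' => f; rewrite -tE adjM !mulmxA -2![U *m _ *m _]mulmxA.
  by congr (_ *m _ *m _); rewrite /clifford_rep; case: cid => V /= [_ ->].
pose phi t := sval (cid (H t)); exists phi => [t1 t2 E|t f].
  apply/val_inj/ffunP => f; apply: pauli_elt_inj.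
  have e1 := svalP (cid (H t1)) f; have e2 := svalP (cid (H t2)) f.
  rewrite -/(phi t1) in e1; rewrite -/(phi t2) -E e1 in e2.
  have := congr1 (fun A => U ^t* *m A *m U) e2.
  by rewrite !mulmxA unitary_adjK ?UM.1 // !mul1mx -!mulmxA unitary_adjK ?UM.1 // !mulmx1.
have := svalP (cid (H t)) f; rewrite -/(phi t) /class_action.
case: (val (phi t) f) (val t f) => [c h] [d h'] /=.
have [e eE] := UM.2 h'.
rewrite !pauliZ -scalemxAr -scalemxAl eE scalerA => /pauli_inj[|//].
exact: expCi_neq0.
Qed.

Lemma card_class_gt0 : (0 < #|clifford_class R Q|)%N.
Proof.
have [U UM] := transvectionP (0 : pstr).
have [t _] := clifford_acts_as (conj_action_clifford UM).
by apply/card_gt0P; exists t.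
Qed.

Lemma card_pstr : #|{: pstr}| = (4 ^ #|Q|)%N.
Proof. by rewrite card_ffun card_prod card_bool. Qed.

(** By transitivity, left multiplication embeds the classes sending f to one nonzero string into
    those sending it to any other; so the fibres, one for each of the 4^|Q| - 1 nonzero strings,
    have equal size. *)
Lemma card_class_action (f g : pstr) : f != 0 -> g != 0 ->
  (#|[pred t : clifford_class R Q | class_action t f == g]| * (4 ^ #|Q|).-1)%N
    = #|clifford_class R Q|.
Proof.
move=> f0 g0; pose n g := #|[pred t : clifford_class R Q | class_action t f == g]|.
have le g1 g2 : g1 != 0 -> g2 != 0 -> (n g1 <= n g2)%N.
  move=> g10 g20; have [U [M [UM Mg]]] := clifford_transitive g10 g20.
  have [phi phi_inj phiE] := class_action_mul UM.
  rewrite /n -(fintype.card_image phi_inj); apply/subset_leq_card/fintype.subsetP => _ /fintype.imageP[t tg ->].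
  by move: tg; rewrite !inE phiE => /eqP ->; rewrite Mg.
have nE g1 : g1 != 0 -> n g1 = n g.
  by move=> g10; apply/eqP; rewrite eqn_leq !le.
rewrite -[RHS]sum1_card (partition_big (fun t => class_action t f) (fun g => g != 0)) /=.
  rewrite (eq_bigr (fun=> n g)) => [|h h0]; last first.
    by rewrite -(nE h h0) /n -sum1_card; apply: eq_bigl => t.
  rewrite sum_nat_const mulnC -card_pstr; congr (_ * _)%N.
  by rewrite -(cardC1 (0 : pstr)); apply: eq_card => h; rewrite !inE.
move=> t _; apply: contra f0 => /eqP E; apply/eqP.
apply: (conj_action_inj (clifford_rep_action t)).
by rewrite E (conj_action0 (clifford_rep_action t)).
Qed.

Lemma average_class_action (F : pstr -> R) (f : pstr) : f != 0 ->
  uniform_average (fun t : clifford_class R Q => F (class_action t f))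
  = (\sum_(g : pstr | g != 0) F g) / (4 ^ #|Q|).-1%:R.
Proof.
move=> f0; rewrite /uniform_average.
have cl0 := card_class_gt0.
rewrite (partition_big (fun t => class_action t f) (fun g => g != 0)) /=; last first.
  move=> t _; apply: contra f0 => /eqP E; apply/eqP.
  apply: (conj_action_inj (clifford_rep_action t)).
  by rewrite E (conj_action0 (clifford_rep_action t)).
rewrite !mulr_suml; apply: eq_bigr => g g0.
have cE := card_class_action f0 g0; set n := #|_| in cE.
have -> : \sum_(t | class_action t f == g) F (class_action t f) = F g * n%:R.
  by rewrite (eq_bigr (fun=> F g)) => [|t /eqP -> //]; rewrite sumr_const mulr_natr.
have p0 : (4 ^ #|Q|).-1%:R != 0 :> R.
  by rewrite pnatr_eq0; apply: contraL cl0 => /eqP p0; rewrite -cE p0 muln0.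
have n0 : n%:R != 0 :> R.
  by rewrite pnatr_eq0; apply: contraL cl0 => /eqP n0; rewrite -cE n0 mul0n.
rewrite -cE natrM invfM -mulrA; congr (_ * _).
by rewrite mulrA mulfV ?mul1r.
Qed.
End OneRegister.
End CliffordAction.

(** * Layers of gates on disjoint registers *)

Section Gates.
Variables (Q Q' : finType) (l : nat) (g : 'I_l -> Q' -> Q).
Hypothesis g_inj : forall i j a b, g i a = g j b -> i = j /\ a = b.

Definition covered (q : Q) : bool := [exists i, q \in codom (g i)].

Lemma covered_gate i a : covered (g i a).
Proof. by apply/existsP; exists i; exact: codom_f. Qed.

Definition gate_at (q : Q) : option ('I_l * Q') := [pick p | g p.1 p.2 == q].

Lemma gate_at_gate i a : gate_at (g i a) = Some (i, a).
Proof.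
rewrite /gate_at; case: pickP => [[j b] /= /eqP/g_inj[-> ->] //|/(_ (i, a))].
by rewrite eqxx.
Qed.

Lemma gate_at_out q : ~~ covered q -> gate_at q = None.
Proof.
move=> qN; rewrite /gate_at; case: pickP => [[j b] /= /eqP E|//].
by rewrite -E covered_gate in qN.
Qed.

Lemma big_gates (V : Type) (idx : V) (op : Monoid.com_law idx) (F : Q -> V) :
  \big[op/idx]_q F q =
  op (\big[op/idx]_i \big[op/idx]_a F (g i a)) (\big[op/idx]_(q | ~~ covered q) F q).
Proof.
rewrite (bigID covered) /=; congr (op _ _).
rewrite pair_bigA /=.
have hinj : {in [pred p : 'I_l * Q' | true] &, injective (fun p => g p.1 p.2)}.
  by move=> [i a] [j b] _ _ /= /g_inj[-> ->].
rewrite -(big_imset (fun q => F q) hinj); apply: eq_bigl => q.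
apply/existsP/imsetP => [[i /codomP[a ->]]|[[i a] _ ->]].
  by exists (i, a).
by exists i; exact: codom_f.
Qed.

(** Each [F i] is expanded over a local value u, with indicators that e agrees with u. For a fixed
    choice [phi] of local values the summand is then a product over single sites, and the sum over e
    factorises. *)
Lemma sum_gates (S : comNzRingType) (T : finType)
    (F : 'I_l -> {ffun Q' -> T} -> S) (G : Q -> T -> S) :
  \sum_(e : {ffun Q -> T})
    (\prod_i F i (Defs.restrict (g i) e)) * \prod_(q | ~~ covered q) G q (e q)
  = (\prod_i \sum_u F i u) * \prod_(q | ~~ covered q) \sum_x G q x.
Proof.
pose H (phi : {ffun 'I_l -> {ffun Q' -> T}}) q x : S :=
  if gate_at q is Some p then (x == phi p.1 p.2)%:R else G q x.
have FE i (e : {ffun Q -> T}) : F i (Defs.restrict (g i) e) =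
    \sum_u F i u * \prod_a (e (g i a) == u a)%:R.
  rewrite (bigD1 (Defs.restrict (g i) e)) //= [X in _ + X]big1 ?addr0.
    by rewrite big1 ?mulr1 // => a _; rewrite ffunE eqxx.
  move=> u ue; rewrite prod_natb; case: forallP => [ua|]; last by rewrite mulr0.
  by case/eqP: ue; apply/ffunP => a; rewrite ffunE; apply/esym/eqP.
transitivity (\sum_(e : {ffun Q -> T}) \sum_(phi : {ffun 'I_l -> {ffun Q' -> T}})
    (\prod_i (F i (phi i) * \prod_a (e (g i a) == phi i a)%:R))
      * \prod_(q | ~~ covered q) G q (e q)).
  apply: eq_bigr => e _; rewrite -big_distrl /=; congr (_ * _).
  by rewrite (eq_bigr _ (fun i _ => FE i e)) bigA_distr_bigA.
rewrite exchange_big /= bigA_distr_bigA big_distrl /=; apply: eq_bigr => phi _.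
transitivity (\sum_(e : {ffun Q -> T}) \prod_i F i (phi i) * \prod_q H phi q (e q)).
  apply: eq_bigr => e _; rewrite big_split /= -mulrA; congr (_ * _).
  rewrite big_gates; congr (_ * _).
    by apply: eq_bigr => i _; apply: eq_bigr => a _; rewrite /H gate_at_gate.
  by apply: eq_bigr => q qN; rewrite /H gate_at_out.
rewrite -big_distrr /= -bigA_distr_bigA /=; congr (_ * _).
rewrite big_gates /= [X in X * _]big1 ?mul1r => [|i _].
  apply: eq_bigr => q qN; apply: eq_bigr => x _.
  by rewrite /H gate_at_out.
rewrite big1 // => a _; rewrite (bigD1 (phi i a)) //= /H gate_at_gate /= eqxx.
by rewrite big1 ?addr0 // => x /negPf ->.
Qed.

Variable R : realType.
Local Notation C := R[i].
Local Open Scope sesquilinear_scope.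

Lemma kent_layer (V : 'I_l -> op R {ffun Q' -> bool}) y z :
  kent (layer g V) y z =
  (\prod_i kent (V i) (Defs.restrict (g i) y) (Defs.restrict (g i) z))
    * \prod_(q | ~~ covered q) (y q == z q)%:R.
Proof.
rewrite kentE; congr (_ * _); rewrite -prod_natb [RHS]big_mkcond.
by apply: eq_bigr => q _; rewrite -/(covered q); case: (covered q).
Qed.

Lemma layerM (V W : 'I_l -> op R {ffun Q' -> bool}) :
  layer g V *m layer g W = layer g (fun i => V i *m W i).
Proof.
apply: kentP => y z; rewrite kentM kent_layer.
under [in RHS]eq_bigr do rewrite kentM.
transitivity (\sum_(w : {ffun Q -> bool})
   (\prod_i (fun u => kent (V i) (Defs.restrict (g i) y) u * kent (W i) u (Defs.restrict (g i) z))
     (Defs.restrict (g i) w)) *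
   \prod_(q | ~~ covered q) (fun x => (y q == x)%:R * (x == z q)%:R) (w q)).
  by apply: eq_bigr => w _; rewrite !kent_layer mulrACA -!big_split.
rewrite (sum_gates (fun i u => kent (V i) (Defs.restrict (g i) y) u
  * kent (W i) u (Defs.restrict (g i) z)) (fun q x => (y q == x)%:R * (x == z q)%:R)).
by congr (_ * _); apply: eq_bigr => q _; rewrite sum_mulb.
Qed.

Lemma layer1 : layer g (fun=> 1%:M : op R {ffun Q' -> bool}) = 1%:M.
Proof.
apply: kentP => y z; rewrite kent_layer kent1 eq_ffunb -prod_natb [RHS]big_gates.
congr (_ * _); apply: eq_bigr => i _; rewrite kent1 eq_ffunb -prod_natb.
by apply: eq_bigr => a _; rewrite !ffunE.
Qed.

Lemma layer_adj (V : 'I_l -> op R {ffun Q' -> bool}) :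
  (layer g V) ^t* = layer g (fun i => (V i) ^t*).
Proof.
apply: kentP => y z; rewrite kent_adj !kent_layer rmorphM !rmorph_prod /=.
congr (_ * _); apply: eq_bigr => i _; first by rewrite kent_adj.
by rewrite rmorph_nat eq_sym.
Qed.

Lemma layer_unitary (V : 'I_l -> op R {ffun Q' -> bool}) :
  (forall i, V i \is unitarymx) -> layer g V \is unitarymx.
Proof.
move=> Vu; apply/unitarymxP; rewrite layer_adj layerM -[RHS]layer1.
by congr layer; apply/funext => i; exact: unitary_Kadj.
Qed.

Definition layer_action (m : 'I_l -> {ffun Q' -> bool * bool} -> {ffun Q' -> bool * bool})
    (f : {ffun Q -> bool * bool}) : {ffun Q -> bool * bool} :=
  [ffun q => if gate_at q is Some p then m p.1 (Defs.restrict (g p.1) f) p.2 else f q].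

Lemma restrict_layer_action m f i : Defs.restrict (g i) (layer_action m f) = m i (Defs.restrict (g i) f).
Proof. by apply/ffunP => a; rewrite !ffunE gate_at_gate. Qed.

Lemma layer_action_out m f q : ~~ covered q -> layer_action m f q = f q.
Proof. by move=> qN; rewrite ffunE gate_at_out. Qed.

Lemma conj_actionE (T : finType) (U : op R {ffun T -> bool}) M f : conj_action U M ->
  exists c : 'I_4, U *m pauli0 R f = 'i ^+ c *: (pauli0 R (M f) *m U).
Proof.
move=> [Uu UM]; have [c cE] := UM f; exists c.
by rewrite scalemxAl -cE -[RHS]mulmxA (unitary_adjK Uu) mulmx1.
Qed.

Lemma restrictD (h : Q' -> Q) (y z : {ffun Q -> bool}) :
  Defs.restrict h (y + z) = Defs.restrict h y + Defs.restrict h z.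
Proof. by apply/ffunP => a; rewrite !ffunE. Qed.

Lemma restrict_xpart (h : Q' -> Q) f : Defs.restrict h (xpart f) = xpart (Defs.restrict h f).
Proof. by apply/ffunP => a; rewrite !ffunE. Qed.

Lemma sgn_zdot_gates f t :
  sgn R (zdot f t) = (\prod_i sgn R (zdot (Defs.restrict (g i) f) (Defs.restrict (g i) t)))
    * \prod_(q | ~~ covered q) sgn R ((f q).2 * t q).
Proof.
rewrite sgn_sum big_gates; congr (_ * _); apply: eq_bigr => i _.
by rewrite sgn_sum; apply: eq_bigr => a _; rewrite !ffunE.
Qed.

(** In the form U P = phase P' U the claim can be checked on matrix elements, which factor over
    gates and untouched sites; the phases of the gates multiply. *)
Lemma layer_conj_action (V : 'I_l -> op R {ffun Q' -> bool}) m :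
  (forall i, conj_action (V i) (m i)) -> conj_action (layer g V) (layer_action m).
Proof.
move=> Vm; have Lu : layer g V \is unitarymx by apply: layer_unitary => i; case: (Vm i).
split=> // f.
have /choice[c cE] i : exists c : 'I_4,
    V i *m pauli0 R (Defs.restrict (g i) f) =
    'i ^+ c *: (pauli0 R (m i (Defs.restrict (g i) f)) *m V i).
  exact: conj_actionE.
have [e eE] := expCi_mod R (\sum_i c i); exists e; rewrite -eE.
suff -> : layer g V *m pauli0 R f =
    'i ^+ (\sum_i c i) *: (pauli0 R (layer_action m f) *m layer g V).
  by rewrite -scalemxAl -[in LHS]mulmxA (unitary_Kadj Lu) mulmx1.
apply: kentP => y t; rewrite kentZ kent_mul_pauli kent_pauli_mul !kent_layer.
rewrite !sgn_zdot_gates.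
have gateE i : kent (V i) (Defs.restrict (g i) y) (Defs.restrict (g i) (t + xpart f))
      * sgn R (zdot (Defs.restrict (g i) f) (Defs.restrict (g i) t)) =
    'i ^+ c i * (sgn R (zdot (Defs.restrict (g i) (layer_action m f))
        (Defs.restrict (g i) (y + xpart (layer_action m f))))
      * kent (V i) (Defs.restrict (g i) (y + xpart (layer_action m f))) (Defs.restrict (g i) t)).
  rewrite restrict_layer_action !restrictD !restrict_xpart restrict_layer_action.
  have := congr1 (fun A => kent A (Defs.restrict (g i) y) (Defs.restrict (g i) t)) (cE i).
  by rewrite kentZ kent_mul_pauli kent_pauli_mul.
rewrite -prodrXr mulrACA -!big_split /=.
rewrite [in RHS]mulrACA -!big_split mulrA -big_split /=; congr (_ * _).
  by apply: eq_bigr => i _; exact: gateE.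
apply: eq_bigr => q qN; rewrite layer_action_out // !ffunE gate_at_out //.
by case: (f q) (y q) (t q) => [[] []] [] [] /=; rewrite ?mul0r ?mulr0 ?mul1r ?mulr1.
Qed.
End Gates.

(** * Bounds on the entanglement fidelity *)

Section EntanglementFidelity.
Local Open Scope sesquilinear_scope.
Variable R : realType.
Local Notation C := R[i].

Lemma trace_projector_ge0 n (s Q : 'M[C]_n) :
  psdmx s -> Q ^t* = Q -> Q *m Q = Q -> 0 <= \tr (s *m Q).
Proof.
move=> sp QH QQ; rewrite -QQ mulmxA mxtrace_mulC mulmxA -{2}QH.
exact/psdmx_tr/psdmx_conj.
Qed.

Lemma form_trace n (s : 'M[C]_n) (v : 'cV[C]_n) :
  (v ^t* *m s *m v) 0 0 = \tr (s *m (v *m v ^t*)).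
Proof. by rewrite mulmxA mxtrace_mulC mulmxA [RHS]trace_mx11. Qed.

Lemma form_le_trace n (s : 'M[C]_n) (v : 'cV[C]_n) :
  psdmx s -> v ^t* *m v = 1%:M -> (v ^t* *m s *m v) 0 0 <= \tr s.
Proof.
move=> sp v1.
have : 0 <= \tr (s *m (1%:M - v *m v ^t*)).
  apply: trace_projector_ge0 => //; first by rewrite adjB adj1 adjM trmxCK.
  rewrite mulmxBr mulmx1 mulmxBl mul1mx -mulmxA [v ^t* *m _]mulmxA v1 mul1mx.
  by rewrite subrr subr0.
by rewrite mulmxBr mulmx1 raddfB /= -form_trace subr_ge0.
Qed.

(** The complement of the span of v and w is the range of a projector, on which s has nonnegative
    trace. *)
Lemma form2_le_trace n (s : 'M[C]_n) (v w : 'cV[C]_n) :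
  psdmx s -> v ^t* *m v = 1%:M -> w ^t* *m w = 1%:M -> v ^t* *m w = 0 ->
  (v ^t* *m s *m v) 0 0 + (w ^t* *m s *m w) 0 0 <= \tr s.
Proof.
move=> sp v1 w1 vw.
have wv : w ^t* *m v = 0 by rewrite -[v]trmxCK -adjM vw trmx0 map_mx0.
have pp : (v *m v ^t* + w *m w ^t*) *m (v *m v ^t* + w *m w ^t*)
    = v *m v ^t* + w *m w ^t*.
  rewrite mulmxDr !mulmxDl -!mulmxA ![_ ^t* *m (_ *m _)]mulmxA v1 w1 vw wv.
  by rewrite !mul1mx !mul0mx !mulmx0 addr0 add0r.
have : 0 <= \tr (s *m (1%:M - (v *m v ^t* + w *m w ^t*))).
  apply: trace_projector_ge0 => //; first by rewrite adjB adj1 adjD !adjM !trmxCK.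
  by rewrite mulmxBr mulmx1 mulmxBl mul1mx pp subrr subr0.
by rewrite mulmxBr mulmx1 raddfB /= mulmxDr raddfD /= -!form_trace subr_ge0.
Qed.

Section OneChannel.
Variables (L : finType) (T : superop R L L).
Hypotheses (L0 : (0 < #|L|)%N) (Tch : channel T).
Local Notation sigma := (ext_id T (max_entangled R L)).

Let Tlin : linear T. Proof. by case: Tch. Qed.

Let sigma_psd : psd sigma.
Proof. by case: Tch => _ Tcp _; apply: channel_ext_id_psd => //; exact: max_entangled_psd. Qed.

Let sigma_tr : \tr sigma = 1.
Proof. by case: Tch => _ _ Ttp; rewrite ext_id_trace // max_entangled_trace. Qed.

Lemma efid_ge0 : 0 <= efid T.
Proof. by rewrite -max_vec_ext_id. Qed.

Lemma efid_le1 : efid T <= 1.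
Proof. by rewrite -max_vec_ext_id // -sigma_tr; apply: form_le_trace => //; exact: max_vec_unit. Qed.
End OneChannel.

Lemma kent_adj_pauli_conj (Q : finType) (X : op R {ffun Q -> bool}) f x y :
  kent ((pauli0 R f) ^t* *m X *m pauli0 R f) x y =
  sgn R (zdot f x) * sgn R (zdot f y) * kent X (x + xpart f) (y + xpart f).
Proof.
rewrite kent_mul_pauli kentM (bigD1 (x + xpart f)) //= [X in _ + X]big1 ?addr0.
  by rewrite kent_adj pauli0E eqxx mul1r sgn_conj; ring.
by move=> z /negPf zx; rewrite kent_adj pauli0E zx mul0r conjC0 mul0r.
Qed.

(* If T does not change under a nontrivial Pauli f, then its output on the
   maximally entangled state has the same overlap with this state and with
   its image by f, and these two states are orthogonal. *)
Lemma efid_pauli_invariant (Q : finType) (T : superop R {ffun Q -> bool} {ffun Q -> bool}) f :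
  channel T -> f != 0 ->
  (forall X, T (pauli0 R f *m X *m (pauli0 R f) ^t*) = T X) ->
  complex.Re (efid T) <= 1 / 2.
Proof.
move=> Tch f0 Tinv; have [Tlin Tcp Ttp] := Tch.
pose L : finType := {ffun Q -> bool}.
have L0 : (0 < #|L|)%N by apply/card_gt0P; exists 0.
set P := pauli0 R f in Tinv *.
pose v := @max_vec R L; pose w := lift_id L P *m v.
pose s := ext_id T (max_entangled R L).
have sp : psd s by apply: channel_ext_id_psd => //; exact: max_entangled_psd.
have str : \tr s = 1 by rewrite ext_id_trace // max_entangled_trace.
have LL : (lift_id L P) ^t* *m lift_id L P = 1%:M.
  apply: kentP => u u'; rewrite kentM kent1 sum_pair.
  have := congr1 (fun A => kent A u.1 u'.1) (pauli_adjK R f).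
  rewrite kentM kent1 => PP.
  transitivity (\sum_y (kent (P ^t*) u.1 y * kent P y u'.1) * (u.2 == u'.2)%:R).
    apply: eq_bigr => y _.
    transitivity (\sum_z (kent (P ^t*) u.1 y * kent P y u'.1) * (u.2 == z)%:R * (z == u'.2)%:R).
      by apply: eq_bigr => z _; rewrite !kent_adj !kentE /= rmorphM /= rmorph_nat
        [u'.2 == z]eq_sym; ring.
    by rewrite (sum_mulb (fun z => _ * (u.2 == z)%:R)).
  rewrite -big_distrl /= PP -natrM mulnb.
  by case: u u' {PP} => [? ?] [? ?].
have v1 : v ^t* *m v = 1%:M by exact: max_vec_unit.
have w1 : w ^t* *m w = 1%:M by rewrite adjM mulmxA -[_ *m _ *m lift_id L P]mulmxA LL mulmx1.
have vw : v ^t* *m w = 0.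
  apply/matrixP => i j; rewrite !ord1 mulmxA max_vec_form [RHS]mxE.
  suff -> : \sum_x \sum_y ent (lift_id L P : op R (L * L)%type) (x, x) (y, y) = \tr P.
    by rewrite pauli_trace // mulr0.
  rewrite kent_trace; apply: eq_bigr => x _.
  by rewrite -(sum_mulb (fun y => kent P x y)); apply: eq_bigr => y _; rewrite ent_kent kentE.
have fv : (v ^t* *m s *m v) 0 0 = efid T by rewrite max_vec_ext_id.
(* The Pauli applied to the output is matched by one inserted at the input, where T does not see it.
   The two pairs of signs cancel, and the shift of the basis by [xpart f] is absorbed by
   reindexing. *)
have fw : (w ^t* *m s *m w) 0 0 = efid T.
  have -> : w ^t* *m s *m w = v ^t* *m ext_id (krausmap xpredT (fun _ : unit => P ^t*) \o T)
      (max_entangled R L) *m v.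
    rewrite ext_id_comp ext_id_krausmap /krausmap big_const card_unit /= addr0.
    have -> : lift_id L (P ^t*) = (lift_id L P) ^t*.
      apply: kentP => u u'; rewrite kent_adj [LHS]kentE kent_adj [in RHS]kentE.
      by rewrite rmorphM /= rmorph_nat eq_sym.
    by rewrite trmxCK /w adjM !mulmxA.
  rewrite max_vec_ext_id; last first.
    by move=> a X Y /=; rewrite Tlin krausmap_linear.
  rewrite /efid; congr (_ * _).
  transitivity (\sum_(x : L) \sum_(y : L) ent (T (munit R (x + xpart f) (y + xpart f)))
      (x + xpart f) (y + xpart f)).
    apply: eq_bigr => x _; apply: eq_bigr => y _ /=.
    rewrite /krausmap big_const card_unit /= addr0 -[in LHS]Tinv.
    have -> : P *m munit R x y *m P ^t* =
        (sgn R (zdot f x) * sgn R (zdot f y)) *: munit R (x + xpart f) (y + xpart f).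
      apply: kentP => a b; rewrite kentZ kent_munit kent_conj.
      rewrite (bigD1 x) //= [X in _ + X]big1 ?addr0; last first.
        by move=> c /negPf cx; apply: big1 => d _; rewrite kent_munit cx mulr0 mul0r.
      rewrite (bigD1 y) //= [X in _ + X]big1 ?addr0; last first.
        by move=> c /negPf cy; rewrite kent_munit cy andbF mulr0 mul0r.
      rewrite kent_munit !eqxx mulr1 !pauli0E rmorphM /= rmorph_nat sgn_conj.
      by rewrite -mulnb natrM; ring.
    rewrite linear_mapZ // -scalemxAr -scalemxAl !ent_kent kentZ trmxCK.
    rewrite kent_adj_pauli_conj mulrA mulrACA !sgnK !mul1r.
    by [].
  have sb : {on [pred i | true], bijective (fun x : L => x + xpart f)}.
    by apply: onW_bij; exists (fun x => x + xpart f) => x; rewrite -addrA addbb_ffun addr0.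
  rewrite [RHS](reindex (fun x : L => x + xpart f)) //=; apply: eq_bigr => x _.
  by rewrite [RHS](reindex (fun x : L => x + xpart f)).
have := form2_le_trace sp v1 w1 vw; rewrite fv fw str.
rewrite lecE /= => /andP[_]; case: (efid T) => x y /=; lra.
Qed.
End EntanglementFidelity.

(** * The erasure channel as a mixture of erasure patterns *)

Section ErasureKraus.
Local Open Scope sesquilinear_scope.
Variable R : realType.
Local Notation C := R[i].
Variables (p : R).

Lemma sum_option (V : nmodType) (T : finType) (F : option T -> V) :
  \sum_k F k = F None + \sum_x F (Some x).
Proof.
rewrite (bigD1 None) //=; congr (_ + _).
rewrite (reindex_omap Some id) //=; last by case.
by apply: eq_bigl => x; rewrite eqxx.
Qed.

(* Kraus index of one site: None means kept, Some x means erased in state x. *)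
Definition eras1 (k u : option bool) (y : bool) : bool :=
  if k is Some x then (u == None) && (y == x) else u == Some y.

Definition weight1 (e : bool) : R := if e then p else 1 - p.

Lemma erasureE (s t : bool) (u v : option bool) :
  ent (erasure p (munit R s t)) u v =
  \sum_k (weight1 (isSome k))%:C%C * (eras1 k u s)%:R * (eras1 k v t)%:R.
Proof.
rewrite sum_option big_bool /= ent_kent /erasure kentD !kentZ kentE.
have -> : \tr (munit R s t) = (s == t)%:R.
  rewrite kent_trace big_bool !kent_munit.
  by case: s; case: t; rewrite /= ?addr0 ?add0r.
rewrite kent_munit.
by case: u v => [a|] [b|] /=; rewrite ?ent_kent ?kent_munit; case: s; case: t;
  try case: a; try case: b; rewrite /= ?(mulr1, mulr0, mul0r, addr0, add0r).
Qed.

Section Register.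
Variable Q : finType.
Local Notation bits := {ffun Q -> bool}.
Local Notation qutrits := {ffun Q -> option bool}.

Definition eras (k : qutrits) : 'M[C]_(#|{ffun Q -> option bool} : finType|, #|{ffun Q -> bool} : finType|) :=
  mkk (fun (u : qutrits) (y : bits) => \prod_q (eras1 (k q) (u q) (y q))%:R).

Lemma kent_eras k u y : kent (eras k) u y = \prod_q (eras1 (k q) (u q) (y q))%:R.
Proof. exact: kentE. Qed.

Lemma eras_conj k u y : (kent (eras k) u y)^* = kent (eras k) u y.
Proof. by rewrite kent_eras rmorph_prod; apply: eq_bigr => q _; rewrite rmorph_nat. Qed.

Definition pattern (k : qutrits) : bits := [ffun q => isSome (k q)].

Definition weight (e : bits) : R := \prod_q weight1 (e q).

Lemma iid_erasureE (X : op R bits) :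
  iid_erasure p X = \sum_k (weight (pattern k))%:C%C *: (eras k *m X *m (eras k) ^t*).
Proof.
apply: kentP => u v; rewrite kentE kent_sum.
under eq_bigr do under eq_bigr do rewrite (eq_bigr _ (fun q _ => erasureE _ _ _ _))
  bigA_distr_bigA /= big_distrr /=.
under eq_bigr do rewrite exchange_big /=.
rewrite exchange_big /=; apply: eq_bigr => k _.
rewrite kentZ kent_conj big_distrr /=; apply: eq_bigr => s _.
rewrite big_distrr /=; apply: eq_bigr => t _.
rewrite eras_conj !kent_eras !big_split /= ent_kent.
have -> : \prod_q (weight1 (isSome (k q)))%:C%C = (weight (pattern k))%:C%C :> C.
  by rewrite /weight rmorph_prod; apply: eq_bigr => q _; rewrite ffunE.
by ring.
Qed.

Definition erase (e : bits) : superop R bits qutrits :=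
  krausmap (fun k => pattern k == e) eras.

Lemma iid_erasure_patterns (X : op R bits) :
  iid_erasure p X = \sum_e (weight e)%:C%C *: erase e X.
Proof.
rewrite iid_erasureE (partition_big pattern xpredT) //=; apply: eq_bigr => e _.
by rewrite /erase /krausmap scaler_sumr; apply: eq_bigr => k /eqP ->.
Qed.

Lemma weight_sum : \sum_e weight e = 1.
Proof.
rewrite /weight -(bigA_distr_bigA (fun _ b => weight1 b)) big1 // => q _.
by rewrite big_bool /weight1 /= addrC subrK.
Qed.

Lemma weight_ge0 (e : bits) : 0 <= p <= 1 -> 0 <= weight e.
Proof.
move=> /andP[p0 p1]; apply: prodr_ge0 => q _.
by rewrite /weight1; case: ifP => _ //; rewrite subr_ge0.
Qed.

Lemma erase_tp (e : bits) :
  \sum_(k | pattern k == e) (eras k) ^t* *m eras k = 1%:M.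
Proof.
apply: kentP => y y'; rewrite kent_sum kent1 big_mkcond /=.
transitivity (\sum_(k : qutrits) \prod_q \sum_u ((isSome (k q) == e q)%:R
    * (eras1 (k q) u (y q))%:R * (eras1 (k q) u (y' q))%:R : C)).
  apply: eq_bigr => k _; rewrite bigA_distr_bigA /= kentM.
  under [RHS]eq_bigr do rewrite !big_split /= prod_natb.
  have -> : [forall q, isSome (k q) == e q] = (pattern k == e).
    by rewrite eq_ffunb; apply: eq_forallb => q; rewrite ffunE.
  case: (_ == e); last by rewrite big1 // => u _; rewrite !mul0r.
  by apply: eq_bigr => u _; rewrite kent_adj eras_conj !kent_eras mul1r.
rewrite -(bigA_distr_bigA (fun q k => \sum_u ((isSome k == e q)%:R
    * (eras1 k u (y q))%:R * (eras1 k u (y' q))%:R : C))).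
rewrite eq_ffunb -prod_natb; apply: eq_bigr => q _.
rewrite sum_option big_bool !sum_option !big_bool.
by case: (e q) (y q) (y' q) => [] [] [] /=;
  rewrite /= ?(mulr1, mulr0, mul0r, addr0, add0r).
Qed.

Lemma erase_channel (e : bits) : channel (erase e).
Proof. exact/krausmap_channel/erase_tp. Qed.

Lemma krausmap_comp (T1 T2 T3 I J : finType) (P : pred I) (P' : pred J)
    (K : I -> 'M[C]_(#|T3|, #|T2|)) (K' : J -> 'M[C]_(#|T2|, #|T1|)) :
  krausmap P K \o krausmap P' K' =
  krausmap (fun u : I * J => P u.1 && P' u.2) (fun u => K u.1 *m K' u.2).
Proof.
apply/funext => X /=; rewrite /krausmap.
rewrite -(pair_big P P' (fun i j => (K i *m K' j) *m X *m (K i *m K' j) ^t*)) /=.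
apply: eq_bigr => i _; rewrite mulmx_sumr mulmx_suml; apply: eq_bigr => j _.
by rewrite adjM !mulmxA.
Qed.

Lemma iid_erasure_krausmap : 0 <= p <= 1 ->
  iid_erasure p = krausmap xpredT (fun k => sqrtC (weight (pattern k))%:C%C *: eras k).
Proof.
move=> p01; apply/funext => X; rewrite iid_erasureE; apply: eq_bigr => k _.
rewrite adjZ -!scalemxAl -scalemxAr scalerA; congr (_ *: _).
have w0 : 0 <= (weight (pattern k))%:C%C :> C.
  by rewrite ler0c weight_ge0.
by rewrite (CrealP (ger0_real _)) ?sqrtC_ge0 // -expr2 sqrtCK.
Qed.

(** On an erased site the Kraus operators are |2><x| for the two values of x; a Pauli permutes them
    up to sign, so a string supported on e only reorders the Kraus sum. *)
Lemma erase_pauli (e : bits) (f : {ffun Q -> bool * bool}) (X : op R bits) :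
  [forall q, (f q != 0) ==> e q] ->
  erase e (pauli0 R f *m X *m (pauli0 R f) ^t*) = erase e X.
Proof.
move=> /forallP fe.
pose sh (k : qutrits) : qutrits := [ffun q => if k q is Some x then Some (x + (f q).1) else None].
have shK : involutive sh.
  move=> k; apply/ffunP => q; rewrite !ffunE; case: (k q) => // x.
  by congr Some; rewrite -addrA; case: (f q).1; rewrite ?addr0.
have pat_sh k : pattern (sh k) = pattern k.
  by apply/ffunP => q; rewrite !ffunE; case: (k q).
have shE k : pattern k = e -> exists b,
    eras k *m pauli0 R f = sgn R b *: eras (sh k).
  move=> ke; exists (\sum_q ((f q).2 * odflt false (sh k q))).
  apply: kentP => u y; rewrite kent_mul_pauli kentZ !kent_eras mulrC !sgn_sum -!big_split.
  apply: eq_bigr => q _ /=; rewrite !ffunE.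
  have := fe q; rewrite -ke ffunE.
  case: (k q) => [x|] /= => [_|]; last by rewrite implybF negbK => /eqP ->; rewrite /= addr0 !mul0r.
  case: (u q) => [c|]; rewrite /= ?mulr0 //.
  by case: (f q) => [[] z]; case: (y q) x => [] [] /=; rewrite ?mulr0.
rewrite /erase /krausmap [RHS](reindex_inj (inv_inj shK)) /=.
rewrite [RHS](eq_bigl (fun k => pattern k == e)) => [|k]; last by rewrite pat_sh.
apply: eq_bigr => k /eqP/shE[b bE].
have -> : eras k *m (pauli0 R f *m X *m (pauli0 R f) ^t*) *m (eras k) ^t*
    = (eras k *m pauli0 R f) *m X *m (eras k *m pauli0 R f) ^t*.
  by rewrite adjM !mulmxA.
by rewrite bE adjZ sgn_conj -!scalemxAl -scalemxAr scalerA sgnK scale1r.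
Qed.
End Register.
End ErasureKraus.

(** * Encoders, logical strings, and the lower bound on the Choi error *)

Section Encoding.
Local Open Scope sesquilinear_scope.
Variable R : realType.
Local Notation C := R[i].
Variables (m a b : nat).
Local Notation Site := (site m a b).
Local Notation Log := (logical m a).
Definition ancilla : finType := ('I_m * 'I_b)%type.
Local Notation Anc := ancilla.
Local Notation sbits := {ffun Site -> bool}.
Local Notation lbits := {ffun Log -> bool}.
Local Notation abits := {ffun Anc -> bool}.
Local Notation pstr Q := {ffun Q -> bool * bool}.

Definition log_sites (q : Log) : Site := (q.1, lshift b q.2).
Definition anc_sites (q : Anc) : Site := (q.1, rshift a q.2).

Definition anc_part (y : sbits) : abits := [ffun q => y (anc_sites q)].
Definition log_str (f : pstr Site) : pstr Log := [ffun q => f (log_sites q)].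
Definition anc_str (f : pstr Site) : pstr Anc := [ffun q => f (anc_sites q)].

Lemma big_site (V : Type) (idx : V) (op : Monoid.com_law idx) (F : Site -> V) :
  \big[op/idx]_q F q =
  op (\big[op/idx]_(q : Log) F (log_sites q)) (\big[op/idx]_(q : Anc) F (anc_sites q)).
Proof.
transitivity (\big[op/idx]_(r < m) \big[op/idx]_(j < a + b) F (r, j)).
  by rewrite pair_bigA; apply: eq_bigr => -[].
transitivity (\big[op/idx]_(r < m) op (\big[op/idx]_(i < a) F (r, lshift b i))
    (\big[op/idx]_(j < b) F (r, rshift a j))).
  by apply: eq_bigr => r _; exact: big_split_ord.
by rewrite big_split /= !pair_bigA.
Qed.

Definition join_parts (l : lbits) (s : abits) : sbits :=
  [ffun q => match fintype.split q.2 with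
    | inl i => l (q.1, i)
    | inr j => s (q.1, j)
    end].

Lemma logical_part_join l s : logical_part (join_parts l s) = l.
Proof.
apply/ffunP => -[r i]; rewrite !ffunE /=.
by rewrite -[lshift b i]/(unsplit (inl i)) unsplitK.
Qed.

Lemma anc_part_join l s : anc_part (join_parts l s) = s.
Proof.
apply/ffunP => -[r i]; rewrite !ffunE /=.
by rewrite -[rshift a i]/(unsplit (inr i)) unsplitK.
Qed.

Lemma join_partsK y : join_parts (logical_part y) (anc_part y) = y.
Proof.
apply/ffunP => -[r i]; rewrite ffunE /=; case: splitP => j ij; rewrite ffunE /=.
  by congr (y (_, _)); apply/val_inj.
by congr (y (_, _)); apply/val_inj.
Qed.

Lemma sum_join_parts (V : nmodType) (F : sbits -> V) :
  \sum_y F y = \sum_l \sum_s F (join_parts l s).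
Proof.
rewrite pair_bigA (reindex (fun u : lbits * abits => join_parts u.1 u.2)) //.
exists (fun y => (logical_part y, anc_part y)) => [[l s] _|y _] /=.
  by rewrite logical_part_join anc_part_join.
exact: join_partsK.
Qed.

(** The isometry adjoining ancillas in the basis state s: s = 0 is the encoder before U, and the
    other s are the syndromes that the decoder measures. *)
Definition Winc (s : abits) : 'M[C]_(#|{ffun Site -> bool} : finType|, #|{ffun Log -> bool} : finType|) :=
  mkk (fun (y : sbits) (l : lbits) => (logical_part y == l)%:R * (anc_part y == s)%:R).

Lemma kent_Winc s y l : kent (Winc s) y l = (logical_part y == l)%:R * (anc_part y == s)%:R.
Proof. exact: kentE. Qed.

Lemma Winc_conj s y l : (kent (Winc s) y l)^* = kent (Winc s) y l.
Proof. by rewrite kent_Winc rmorphM /= !rmorph_nat. Qed.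

Lemma ancillas_zeroE (y : sbits) : ancillas_zero y = (anc_part y == 0).
Proof.
apply/forallP/eqP => [y0|y0 r].
  by apply/ffunP => -[r j]; rewrite !ffunE; have /forallP/(_ j)/eqP := y0 r.
apply/forallP => j; apply/eqP.
by have /ffunP/(_ (r, j)) := y0; rewrite !ffunE.
Qed.

Lemma adjoin_ancillasE (rho : op R lbits) :
  adjoin_ancillas b rho = Winc 0 *m rho *m (Winc 0) ^t*.
Proof.
apply: kentP => y z; rewrite kentE kent_conj !ancillas_zeroE.
rewrite (bigD1 (logical_part y)) //= [X in _ + X]big1 ?addr0; last first.
  move=> l; rewrite eq_sym => /negPf yl; apply: big1 => l' _.
  by rewrite kent_Winc yl !mul0r.
rewrite (bigD1 (logical_part z)) //= [X in _ + X]big1 ?addr0; last first.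
  by move=> l; rewrite eq_sym => /negPf zl; rewrite Winc_conj [kent _ z _]kent_Winc zl mul0r mulr0.
rewrite Winc_conj !kent_Winc !eqxx !mul1r ent_kent; ring.
Qed.

Lemma Winc_orth s s' : (Winc s) ^t* *m Winc s' = (s == s')%:R *: 1%:M.
Proof.
apply: kentP => l l'; rewrite kentZ kent1 kentM sum_join_parts.
transitivity (\sum_(l1 : lbits) \sum_(s1 : abits)
    ((l1 == l)%:R * (l1 == l')%:R * (s1 == s')%:R) * (s1 == s)%:R : C).
  apply: eq_bigr => l1 _; apply: eq_bigr => s1 _.
  by rewrite kent_adj Winc_conj !kent_Winc !logical_part_join !anc_part_join; ring.
under eq_bigr do rewrite (sum_mulb (fun s1 => _ * _ * (s1 == s')%:R)) mulrAC -mulrA mulrC.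
by rewrite (sum_mulb (fun l1 => (s == s')%:R * (l1 == l')%:R)).
Qed.

Lemma Winc_complete : \sum_s Winc s *m (Winc s) ^t* = 1%:M.
Proof.
apply: kentP => y y'; rewrite kent_sum kent1.
transitivity (\sum_(s : abits) ((logical_part y == logical_part y')%:R * (anc_part y == s)%:R)
    * (s == anc_part y')%:R : C).
  apply: eq_bigr => s _; rewrite kentM.
  transitivity (\sum_l ((logical_part y == l)%:R * (anc_part y == s)%:R * (s == anc_part y')%:R)
     * (l == logical_part y')%:R : C).
    apply: eq_bigr => l _; rewrite kent_adj Winc_conj !kent_Winc.
    by rewrite [logical_part y' == _]eq_sym [anc_part y' == _]eq_sym; ring.
  by rewrite (sum_mulb (fun l => (logical_part y == l)%:R * _ * _)).
rewrite (sum_mulb (fun s => _ * (anc_part y == s)%:R)) -natrM mulnb.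
congr (nat_of_bool _)%:R; apply/andP/eqP => [[/eqP ll /eqP aa]|-> //].
by rewrite -[y]join_partsK ll aa join_partsK.
Qed.

Lemma logical_partD (y z : sbits) : logical_part (y + z) = logical_part y + logical_part z.
Proof. by apply/ffunP => q; rewrite !ffunE. Qed.

Lemma anc_partD (y z : sbits) : anc_part (y + z) = anc_part y + anc_part z.
Proof. by apply/ffunP => q; rewrite !ffunE. Qed.

Lemma log_strD f h : log_str (f + h) = log_str f + log_str h.
Proof. by apply/ffunP => q; rewrite !ffunE. Qed.

Lemma anc_strD f h : anc_str (f + h) = anc_str f + anc_str h.
Proof. by apply/ffunP => q; rewrite !ffunE. Qed.

Lemma addr_eq_swap (T : finType) (x y z : {ffun T -> bool}) : (x + y == z) = (x == z + y).
Proof.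
by apply/eqP/eqP => [<-|->]; rewrite -addrA addbb_ffun addr0.
Qed.

(** The x part on the ancillas shifts the syndrome, their z part is only a sign, and the rest acts
    logically. So f preserves the code space when its ancilla part has no x component, the first
    condition in [uncorrectable]. *)
Lemma pauli_Winc (f : pstr Site) s :
  pauli0 R f *m Winc s = sgn R (zdot (anc_str f) s) *:
    (Winc (s + xpart (anc_str f)) *m pauli0 R (log_str f)).
Proof.
apply: kentP => y l; rewrite kent_pauli_mul kentZ kent_mul_pauli !kent_Winc.
have -> : zdot f (y + xpart f) = zdot (log_str f) (logical_part (y + xpart f))
    + zdot (anc_str f) (anc_part (y + xpart f)).
  rewrite /zdot big_site /=; congr (_ + _); apply: eq_bigr => q _.
    by rewrite !ffunE.
  by rewrite !ffunE.
rewrite logical_partD anc_partD.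
have -> : logical_part (xpart f) = xpart (log_str f) by apply/ffunP => q; rewrite !ffunE.
have -> : anc_part (xpart f) = xpart (anc_str f) by apply/ffunP => q; rewrite !ffunE.
rewrite !addr_eq_swap; case: eqP => [->|_]; last by rewrite !(mul0r, mulr0).
case: eqP => [->|_]; last by rewrite !(mul0r, mulr0).
rewrite -!addrA !addbb_ffun !addr0 sgnD; ring.
Qed.

(* Some string g acting on the code space as a nontrivial logical Pauli is
   mapped by the encoder into the erased region. *)
Definition uncorrectable (M : pstr Site -> pstr Site) (e : sbits) : bool :=
  [exists g, [&& xpart (anc_str g) == 0, log_str g != 0 &
    [forall q, (M g q != 0) ==> e q]]].

Section OneCircuit.
Variables (U : op R sbits) (M : pstr Site -> pstr Site).
Hypothesis UM : conj_action U M.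

Lemma encodingE (rho : op R lbits) :
  encoding U rho = (U *m Winc 0) *m rho *m (U *m Winc 0) ^t*.
Proof. by rewrite /encoding adjoin_ancillasE adjM !mulmxA. Qed.

Lemma encoding_krausmap :
  encoding U = krausmap xpredT (fun _ : unit => U *m Winc 0).
Proof.
by apply/funext => X; rewrite encodingE /krausmap big_const card_unit /= addr0.
Qed.

Lemma encoder_isometry : (U *m Winc 0) ^t* *m (U *m Winc 0) = 1%:M.
Proof.
by rewrite adjM mulmxA -[_ *m U ^t* *m U]mulmxA (unitary_adjK UM.1) mulmx1 Winc_orth eqxx scale1r.
Qed.

Lemma encoding_channel : channel (encoding U).
Proof.
rewrite encoding_krausmap; apply: krausmap_channel.
by rewrite big_const card_unit /= addr0 encoder_isometry.
Qed.

Lemma comp_channel (T1 T2 T3 : finType) (D : superop R T2 T3) (F : superop R T1 T2) :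
  channel D -> channel F -> channel (D \o F).
Proof.
move=> [Dl Dcp Dtp] [Fl Fcp Ftp]; split.
- by move=> c X Y /=; rewrite Fl Dl.
- by move=> k X Xp; rewrite ext_id_comp; apply: Dcp; apply: Fcp.
- by move=> X /=; rewrite Dtp Ftp.
Qed.

Lemma expCi_norm (c : nat) : ('i ^+ c : C) * ('i ^+ c)^* = 1.
Proof. by rewrite rmorphXn /= -exprMn conjCi mulrN -expr2 sqrCi opprK expr1n. Qed.

Lemma encoding_pauli g (X : op R lbits) : xpart (anc_str g) = 0 ->
  encoding U (pauli0 R (log_str g) *m X *m (pauli0 R (log_str g)) ^t*) =
  pauli0 R (M g) *m encoding U X *m (pauli0 R (M g)) ^t*.
Proof.
move=> g0; rewrite !encodingE.
have WL : Winc 0 *m pauli0 R (log_str g) = pauli0 R g *m Winc 0.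
  rewrite pauli_Winc g0 addr0 /zdot big1 ?scale1r // => q _.
  by rewrite !ffunE mulr0.
have [c cE] := conj_actionE g UM.
have E : U *m Winc 0 *m pauli0 R (log_str g) = 'i ^+ c *: (pauli0 R (M g) *m (U *m Winc 0)).
  by rewrite -mulmxA WL mulmxA cE -scalemxAl mulmxA.
transitivity ((U *m Winc 0 *m pauli0 R (log_str g)) *m X *m
   (U *m Winc 0 *m pauli0 R (log_str g)) ^t*).
  by rewrite [in RHS]adjM !mulmxA.
rewrite E adjZ -!scalemxAl -scalemxAr scalerA expCi_norm scale1r.
by rewrite [in LHS]adjM !mulmxA.
Qed.

Lemma circuit_channel e (D : superop R {ffun Site -> option bool} lbits) :
  channel D -> channel (D \o erase e \o encoding U).
Proof.
move=> Dch; apply: comp_channel encoding_channel.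
by apply: comp_channel => //; exact: erase_channel.
Qed.

(** The logical Pauli of g passes through the encoder as [M g], which the erasure absorbs; the whole
    map is therefore invariant under it. *)
Lemma efid_uncorrectable e (D : superop R {ffun Site -> option bool} lbits) :
  channel D -> uncorrectable M e ->
  complex.Re (efid (D \o erase e \o encoding U)) <= 1 / 2.
Proof.
move=> Dch /existsP[g /and3P[/eqP g0 lg ge]].
apply: (efid_pauli_invariant (circuit_channel e Dch) lg) => X.
by rewrite /= encoding_pauli // erase_pauli.
Qed.

Lemma lbits_gt0 : (0 < #|{ffun Log -> bool} : finType|)%N.
Proof. by apply/card_gt0P; exists (0 : lbits). Qed.

Lemma noisy_encoding_cp p : 0 <= p <= 1 ->
  linear (iid_erasure p \o encoding U) /\ completely_positive (iid_erasure p \o encoding U).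
Proof.
move=> p01; rewrite iid_erasure_krausmap // encoding_krausmap krausmap_comp.
by split; [exact: krausmap_linear | exact: krausmap_cp].
Qed.

Lemma exchange_big3 (I J K : finType) (F : I -> J -> K -> C) :
  \sum_i \sum_j \sum_k F i j k = \sum_k \sum_i \sum_j F i j k.
Proof.
rewrite [RHS]exchange_big; apply: eq_bigr => i _.
by rewrite [RHS]exchange_big.
Qed.

Lemma efid_iid_erasure p (D : superop R {ffun Site -> option bool} lbits) :
  channel D ->
  complex.Re (efid (D \o (iid_erasure p \o encoding U))) =
  \sum_(e : sbits) weight p e * complex.Re (efid (D \o erase e \o encoding U)).
Proof.
move=> [Dl _ _].
have -> : efid (D \o (iid_erasure p \o encoding U)) =
    \sum_(e : sbits) (weight p e)%:C%C * efid (D \o erase e \o encoding U).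
  rewrite /efid /=.
  transitivity ((#|{ffun Log -> bool} : finType|%:R : C)^-2 * \sum_(x : lbits) \sum_(y : lbits)
      \sum_(e : sbits) (weight p e)%:C%C * ent (D (erase e (encoding U (munit R x y)))) x y).
    congr (_ * _); apply: eq_bigr => x _; apply: eq_bigr => y _.
    rewrite iid_erasure_patterns linear_map_sum // ent_linear_sum.
    by apply: eq_bigr => e _; rewrite linear_mapZ // ent_kent kentZ.
  rewrite (exchange_big3 (fun x y e => (weight p e)%:C%C
    * ent (D (erase e (encoding U (munit R x y)))) x y)).
  rewrite big_distrr /=; apply: eq_bigr => e _.
  rewrite mulrCA; congr (_ * _); rewrite big_distrr /=; apply: eq_bigr => x _.
  by rewrite big_distrr.
rewrite raddf_sum /=; apply: eq_bigr => e _.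
by case: (efid _) => x y /=; rewrite mul0r subr0.
Qed.

(** With q the total weight of the fatal patterns, the fidelity is at most q / 2 + (1 - q). *)
Lemma choi_error_lower p : 0 <= p <= 1 ->
  Num.sqrt ((\sum_(e | uncorrectable M e) weight p e) / 2) <=
  choi_error (iid_erasure p) (encoding U).
Proof.
move=> p01; have [Nl Ncp] := noisy_encoding_cp p01.
apply: choi_error_ge => // [|D Dch]; first exact: lbits_gt0.
have w1 := weight_sum p Site; rewrite (bigID (uncorrectable M)) /= in w1.
rewrite efid_iid_erasure // (bigID (uncorrectable M)) /=.
have le1 : \sum_(e | uncorrectable M e)
      weight p e * complex.Re (efid (D \o erase e \o encoding U))
    <= (\sum_(e | uncorrectable M e) weight p e) * (1 / 2).
  rewrite mulr_suml; apply: ler_sum => e ue.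
  by apply: ler_wpM2l; [exact: weight_ge0 | exact: efid_uncorrectable].
have le2 : \sum_(e | ~~ uncorrectable M e)
      weight p e * complex.Re (efid (D \o erase e \o encoding U))
    <= \sum_(e | ~~ uncorrectable M e) weight p e.
  apply: ler_sum => e _; rewrite -[leRHS]mulr1; apply: ler_wpM2l; first exact: weight_ge0.
  by have := efid_le1 lbits_gt0 (circuit_channel e Dch); rewrite lecE /= => /andP[].
lra.
Qed.
End OneCircuit.
End Encoding.

(** * A decoder attaining fidelity 1 on every correctable pattern *)

Section Decoder.
Local Open Scope sesquilinear_scope.
Variable R : realType.
Local Notation C := R[i].

Section Refill.
Variable Q : finType.
Local Notation bits := {ffun Q -> bool}.
Local Notation qutrits := {ffun Q -> option bool}.

Definition fill1 (e y : bool) (u : option bool) : bool :=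
  if e then (u == None) && (y == false) else u == Some y.

(* Kraus operator reading the erasure pattern e and putting the erased sites in state 0. *)
Definition fill (e : bits) : 'M[C]_(#|{ffun Q -> bool} : finType|, #|{ffun Q -> option bool} : finType|) :=
  mkk (fun (y : bits) (u : qutrits) => \prod_q (fill1 (e q) (y q) (u q))%:R).

Lemma kent_fill e y u : kent (fill e) y u = \prod_q (fill1 (e q) (y q) (u q))%:R.
Proof. exact: kentE. Qed.

Lemma fill_conj e y u : (kent (fill e) y u)^* = kent (fill e) y u.
Proof. by rewrite kent_fill rmorph_prod; apply: eq_bigr => q _; rewrite rmorph_nat. Qed.

Lemma fill_complete : \sum_e (fill e) ^t* *m fill e = 1%:M.
Proof.
apply: kentP => u u'; rewrite kent_sum kent1.
transitivity (\sum_(e : bits) \prod_q \sum_y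
    ((fill1 (e q) y (u q))%:R * (fill1 (e q) y (u' q))%:R : C)).
  apply: eq_bigr => e _; rewrite bigA_distr_bigA /= kentM; apply: eq_bigr => y _.
  by rewrite kent_adj fill_conj !kent_fill -big_split.
rewrite -(bigA_distr_bigA (fun q e => \sum_y
    ((fill1 e y (u q))%:R * (fill1 e y (u' q))%:R : C))).
have -> : (u == u') = [forall q, u q == u' q].
  by apply/eqP/forallP => [-> // | uu]; apply/ffunP => q; exact/eqP.
rewrite -prod_natb; apply: eq_bigr => q _.
rewrite big_bool !big_bool.
by case: (u q) (u' q) => [[]|] [[]|] /=; rewrite ?(mulr1, mulr0, mul0r, addr0, add0r).
Qed.

Lemma kent_fill_eras e k y t : kent (fill e *m eras R k) y t =
  \prod_q \sum_u ((fill1 (e q) (y q) u)%:R * (eras1 (k q) u (t q))%:R).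
Proof.
rewrite kentM bigA_distr_bigA /=; apply: eq_bigr => u _.
by rewrite kent_fill kent_eras big_split.
Qed.

Lemma fill_eras0 e k : pattern k != e -> fill e *m eras R k = 0.
Proof.
rewrite eq_ffunb negb_forall => /existsP[q]; rewrite ffunE => ke.
apply: kentP => y t; rewrite kent_fill_eras kent0 (bigD1 q) //= big1 ?mul0r // => u _.
by case: (e q) (k q) u ke => [] [x|] [c|] //= _; rewrite ?mul0r ?mulr0.
Qed.

Definition kraus_str (k : qutrits) (z : bits) : {ffun Q -> bool * bool} :=
  [ffun q => if k q is Some x then (x, z q) else 0].

Definition kraus_coef1 (k : option bool) (z : bool) : C :=
  if k is Some x then 2^-1 * sgn R (z * x) else (~~ z)%:R.

(* |0><x| is the average over z of sgn (z x) Z^z X^x. *)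
Lemma fill_eras k : fill (pattern k) *m eras R k =
  \sum_(z : bits) (\prod_q kraus_coef1 (k q) (z q)) *: pauli0 R (kraus_str k z).
Proof.
apply: kentP => y t; rewrite kent_fill_eras kent_sum.
pose F q z : C := kraus_coef1 (k q) z * (y q == t q + (if k q is Some x then x else false))%:R
  * sgn R ((if k q then z else false) * t q).
transitivity (\sum_(z : bits) \prod_q F q (z q)); last first.
  apply: eq_bigr => z _; rewrite kentZ pauli0E eq_ffunb -prod_natb sgn_sum mulrA.
  rewrite -!big_split; apply: eq_bigr => q _; rewrite /F !ffunE.
  by case: (k q).
rewrite -bigA_distr_bigA; apply: eq_bigr => q _; rewrite /F ffunE.
rewrite sum_option !big_bool /= /kraus_coef1.
by case: (k q) (y q) (t q) => [[]|] [] [] /=; rewrite /sgn /=; field.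
Qed.

Lemma kraus_str_supp k z : [forall q, (kraus_str k z q != 0) ==> pattern k q].
Proof. by apply/forallP => q; rewrite !ffunE; case: (k q) => [x|]; rewrite ?implybT ?eqxx. Qed.
End Refill.

(** Trace preservation forces c = 1. *)
Lemma efid_scalar (L : finType) (T : superop R L L) (c : C) :
  (0 < #|L|)%N -> channel T -> (forall X, T X = c *: X) -> efid T = 1.
Proof.
move=> L0 [_ _ Ttp] TE; have /card_gt0P[x _] := L0.
have c1 : c = 1.
  have := Ttp (munit R x x); rewrite TE mxtraceZ.
  have -> : \tr (munit R x x) = 1.
    rewrite kent_trace (bigD1 x) //= big1 ?addr0 ?kent_munit ?eqxx // => y /negPf yx.
    by rewrite kent_munit yx.
  by rewrite mulr1.
rewrite /efid (eq_bigr (fun=> #|L|%:R)) => [|y _].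
  by rewrite sumr_const -[#|L|%:R *+ _]mulr_natr -expr2 mulVf // expf_neq0 // pnatr_eq0 -lt0n.
rewrite (eq_bigr (fun=> 1)) ?sumr_const // => z _.
by rewrite TE c1 scale1r ent_kent kent_munit !eqxx.
Qed.

Variables (m a b : nat).
Local Notation Site := (site m a b).
Local Notation Log := (logical m a).
Local Notation Anc := (ancilla m b).
Local Notation sbits := {ffun Site -> bool}.
Local Notation lbits := {ffun Log -> bool}.
Local Notation abits := {ffun Anc -> bool}.
Local Notation pstr Q := {ffun Q -> bool * bool}.
Local Notation W := (@Winc R m a b).
Variables (U : op R sbits) (M : pstr Site -> pstr Site).
Hypothesis UM : conj_action U M.

(** A string explaining the syndrome s by an error on the erased sites e. If e is correctable, all
    such strings have the same logical part; the default 0 is reached only for syndromes that no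
    error on e produces. *)
Definition correction (e : sbits) (s : abits) : pstr Site :=
  odflt 0 [pick g | (xpart (anc_str g) == s) && [forall q, (M g q != 0) ==> e q]].

(** Read from right to left: refill the sites of pattern [u.1], undo U, find the ancillas in state
    [u.2] and drop them, undo the logical part of the correction. *)
Definition decoder_kraus (u : sbits * abits) :
    'M[C]_(#|{ffun Log -> bool} : finType|, #|{ffun Site -> option bool} : finType|) :=
  (pauli0 R (log_str (correction u.1 u.2))) ^t* *m (W u.2) ^t* *m U ^t* *m fill u.1.

Definition decoder := krausmap xpredT decoder_kraus.

Lemma decoder_channel : channel decoder.
Proof.
apply: krausmap_channel; rewrite sum_pair -[RHS]fill_complete; apply: eq_bigr => e _.
transitivity ((fill e) ^t* *m (\sum_s U *m (W s *m (W s) ^t*) *m U ^t*) *m fill e).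
  rewrite mulmx_sumr mulmx_suml; apply: eq_bigr => s _; rewrite /decoder_kraus /=.
  set P := pauli0 R _; rewrite !adjM !trmxCK !mulmxA.
  by rewrite -[_ *m P *m P ^t*]mulmxA pauli_Kadj mulmx1.
rewrite -mulmx_suml -mulmx_sumr Winc_complete mulmx1 unitary_Kadj ?mulmx1 //.
by case: UM.
Qed.

(** Undoing U turns the error f into [Mi f] up to a phase, so only the syndrome of [Mi f] survives.
    For that syndrome the sum of the correction and [Mi f] has no ancilla x part and is moved into
    e; a nontrivial logical part would make it a witness that e is uncorrectable. *)
Lemma correction_scalar (e : sbits) s (f : pstr Site) : ~~ uncorrectable M e ->
  [forall q, (f q != 0) ==> e q] ->
  exists c, (pauli0 R (log_str (correction e s))) ^t* *m (W s) ^t* *m U ^t*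
    *m pauli0 R f *m (U *m W 0) = c *: 1%:M.
Proof.
move=> ue fe.
have [Mi MK KM] := injF_bij (conj_action_inj UM).
have [c cE] := UM.2 (Mi f); rewrite KM in cE.
have UPU : U ^t* *m pauli0 R f *m U = ('i ^+ c)^-1 *: pauli0 R (Mi f).
  have -> : pauli0 R f = ('i ^+ c)^-1 *: (U *m pauli0 R (Mi f) *m U ^t*).
    by rewrite cE scalerA mulVf ?scale1r // expCi_neq0.
  rewrite -scalemxAr -scalemxAl !mulmxA (unitary_adjK UM.1) mul1mx.
  by rewrite -mulmxA (unitary_adjK UM.1) mulmx1.
set P := pauli0 R (log_str _).
have -> : P ^t* *m (W s) ^t* *m U ^t* *m pauli0 R f *m (U *m W 0) =
    P ^t* *m (W s) ^t* *m (U ^t* *m pauli0 R f *m U *m W 0).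
  by rewrite !mulmxA.
rewrite UPU -scalemxAl pauli_Winc add0r scalerA -scalemxAr !mulmxA.
rewrite -[_ *m _ *m W _]mulmxA Winc_orth -scalemxAr mulmx1 -scalemxAl scalerA.
have [sE|_] := eqVneq s (xpart (anc_str (Mi f))); last first.
  by exists 0; rewrite mulr0 !scale0r.
suff PE : log_str (correction e s) = log_str (Mi f).
  by rewrite /P PE pauli_adjK; eexists.
rewrite /correction; case: pickP => [g /andP[/eqP gs ge] /=|/(_ (Mi f))]; last first.
  by rewrite KM fe -sE eqxx.
apply/eqP; rewrite -addff_eq0 -log_strD; apply: contraR ue => lg.
apply/existsP; exists (g + Mi f); apply/and3P; split=> //.
  by rewrite anc_strD xpartD gs sE addbb_ffun.
apply/forallP => q; rewrite (conj_actionD _ _ UM) KM ffunE.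
have /forallP/(_ q) := ge; have /forallP/(_ q) := fe.
case: (e q); rewrite ?implybT // !implybF !negbK => /eqP -> /eqP ->.
by rewrite addr0.
Qed.

(** All Kraus operators of the composite are scalars: after refilling, each erasure operator is a
    combination of strings on e, to which [correction_scalar] applies. *)
Lemma efid_correctable e : ~~ uncorrectable M e ->
  efid (decoder \o erase e \o encoding U) = 1.
Proof.
move=> ue.
have K_scalar u k : pattern k = e -> exists c,
    decoder_kraus u *m eras R k *m (U *m W 0) = c *: 1%:M.
  move=> ke; case: u => e' s; rewrite /decoder_kraus /= -[_ *m eras R k]mulmxA.
  have [e'e|e'e] := eqVneq (pattern k) e'; last first.
    by exists 0; rewrite fill_eras0 // mulmx0 mul0mx scale0r.
  rewrite -e'e fill_eras.
  have supp z : [forall q, (kraus_str k z q != 0) ==> e q].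
    by rewrite -ke; exact: kraus_str_supp.
  have /choice[c cE] z := correction_scalar s ue (supp z).
  exists (\sum_(z : sbits) (\prod_q kraus_coef1 (k q) (z q)) * c z).
  rewrite mulmx_sumr mulmx_suml scaler_suml; apply: eq_bigr => z _.
  by rewrite -scalemxAr -scalemxAl ke cE scalerA.
have TE : decoder \o erase e \o encoding U =
    krausmap (fun u => pattern u.1.2 == e)
      (fun u : (sbits * abits) * {ffun Site -> option bool} * unit =>
        decoder_kraus u.1.1 *m eras R u.1.2 *m (U *m W 0)).
  rewrite encoding_krausmap /decoder /erase !krausmap_comp.
  by congr krausmap; apply/funext => u /=; rewrite andbT.
have Tch := circuit_channel UM e decoder_channel.
have /choice[c cE] (u : (sbits * abits) * {ffun Site -> option bool} * unit) :
    exists c, pattern u.1.2 = e ->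
    decoder_kraus u.1.1 *m eras R u.1.2 *m (U *m W 0) = c *: 1%:M.
  have [ke|ke] := eqVneq (pattern u.1.2) e; last by exists 0 => k; rewrite k eqxx in ke.
  by have [c cE] := K_scalar u.1.1 _ ke; exists c.
apply: (@efid_scalar _ _ (\sum_(u | pattern u.1.2 == e) c u * (c u)^*)) => //.
  exact: lbits_gt0.
move=> X; rewrite TE /krausmap scaler_suml; apply: eq_bigr => u /eqP/cE ->.
by rewrite adjZ adj1 -scalemxAl mul1mx -scalemxAr mulmx1 scalerA mulrC.
Qed.

Lemma choi_error_upper (p : R) : 0 <= p <= 1 ->
  choi_error (iid_erasure p) (encoding U) <=
  Num.sqrt (\sum_(e | uncorrectable M e) weight p e).
Proof.
move=> p01; have [Nl Ncp] := noisy_encoding_cp U p01.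
apply: (choi_error_le _ Nl Ncp decoder_channel); first exact: lbits_gt0.
rewrite efid_iid_erasure //; last exact: decoder_channel.
have w1 := weight_sum p Site; rewrite (bigID (uncorrectable M)) /= in w1.
rewrite [X in _ <= X](bigID (uncorrectable M)) /=.
have le1 : 0 <= \sum_(e | uncorrectable M e)
      weight p e * complex.Re (efid (decoder \o erase e \o encoding U)).
  apply: sumr_ge0 => e _; apply: mulr_ge0; first exact: weight_ge0.
  have := efid_ge0 (circuit_channel UM e decoder_channel).
  by rewrite lecE /= => /andP[].
have le2 : \sum_(e | ~~ uncorrectable M e)
      weight p e * complex.Re (efid (decoder \o erase e \o encoding U))
    = \sum_(e | ~~ uncorrectable M e) weight p e.
  by apply: eq_bigr => e ue; rewrite efid_correctable //= mulr1.
lra.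
Qed.
End Decoder.

(** * Fatal patterns of a stabilizer code by counting *)

Section BlockCodes.
Variable R : realType.
Local Notation C := R[i].
Variables (m a b : nat).
Local Notation Site := (site m a b).
Local Notation Anc := (ancilla m b).
Local Notation sbits := {ffun Site -> bool}.
Local Notation pstr := {ffun Site -> bool * bool}.
Variables (U : op R sbits) (M : pstr -> pstr).
Hypothesis UM : conj_action U M.

Definition supported (e : sbits) (f : pstr) : bool := [forall q, (f q != 0) ==> e q].
Definition is_stabilizer (z : pstr) : bool := (log_str z == 0) && (xpart (anc_str z) == 0).

Lemma supportedN (e : sbits) (f : pstr) :
  [forall q, e q ==> (f q == 0)] = supported [ffun q => ~~ e q] f.
Proof. by apply: eq_forallb => q; rewrite ffunE; case: (e q) (f q == 0) => [] []. Qed.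

(** Again character orthogonality: the sum detects the strings commuting with all stabilizers, which
    are those without x part on the ancillas. *)
Lemma sum_stabilizer (g : pstr) :
  \sum_(z | is_stabilizer z) sgn R (symp g z) =
  2 ^+ #|Anc| * (xpart (anc_str g) == 0)%:R.
Proof.
pose ok (q : Site) (c : bool * bool) : bool :=
  if fintype.split q.2 is inl _ then c == 0 else ~~ c.1.
have okE z : is_stabilizer z = [forall q : Site, ok q (z q)].
  apply/andP/forallP => [[/eqP/ffunP lz /eqP/ffunP az] [r c]|zok].
    rewrite /ok /=; case: splitP => j cj.
      have := lz (r, j); rewrite !ffunE /log_sites /= => <-.
      by apply/eqP; congr (z (_, _)); apply/val_inj.
    have := az (r, j); rewrite !ffunE /anc_sites /= => h.
    by rewrite (_ : c = rshift a j) ?h //; apply/val_inj.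
  split; apply/eqP/ffunP => q; rewrite !ffunE.
    have := zok (log_sites b q); rewrite /ok /= -[lshift b q.2]/(unsplit (inl q.2)) unsplitK.
    by move/eqP.
  have := zok (anc_sites a q); rewrite /ok /= -[rshift a q.2]/(unsplit (inr q.2)) unsplitK.
  by move/negPf.
pose F (q : Site) c : C := (ok q c)%:R * sgn R (symp1 (g q) c).
transitivity (\sum_(z : pstr) \prod_q F q (z q)).
  rewrite big_mkcond; apply: eq_bigr => z _; rewrite okE big_split /= prod_natb -sgn_symp.
  by case: ifP => _; rewrite ?mul1r ?mul0r.
rewrite -bigA_distr_bigA big_site /= [X in X * _]big1 ?mul1r; last first.
  move=> q _; rewrite sum_pair !big_bool /F /ok /= -[lshift b q.2]/(unsplit (inl q.2)) unsplitK.
  rewrite /= /symp1 /= mulr0 mul0r /sgn /= expr0; ring.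
rewrite (eq_bigr (fun q => 2 * ((xpart (anc_str g)) q == 0)%:R)) => [|q _].
  rewrite big_split /= prodr_const prod_natb; congr (_ * (nat_of_bool _)%:R).
  by rewrite eq_ffunb; apply: eq_forallb => q; rewrite [(0 : {ffun _ -> _}) q]ffunE.
rewrite sum_pair !big_bool /F /ok /= -[rshift a q.2]/(unsplit (inr q.2)) unsplitK.
rewrite /= /symp1 !ffunE /=; case: (g (anc_sites a q)) => [[] z] /=;
  rewrite ?(mulr0, mul0r, mulr1, mul1r, addr0, add0r) /sgn /= ?expr0 ?expr1; ring.
Qed.

Definition stab_count (e : sbits) : nat := #|[pred z | is_stabilizer z && supported e (M z)]|.

(* Quantum MacWilliams identity: without uncorrectable strings on e, the strings
   commuting with all stabilizers and supported on e are the stabilizers on e. *)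
Lemma macwilliams (e : sbits) : ~~ uncorrectable M e ->
  (stab_count e * 2 ^ #|Anc| = 4 ^ #|[pred q | e q]| * stab_count [ffun q => ~~ e q])%N.
Proof.
move=> ue; apply/eqP; rewrite -(eqr_nat C) !natrM !natrX; apply/eqP.
have [Mi MK KM] := injF_bij (conj_action_inj UM).
have M_bij : {on [pred f | supported e f], bijective M} by apply: onW_bij; exists Mi.
(* Both sides evaluate this double sum of commutation signs, the left one by summing first over
   stabilizers, the right one by summing first over strings on e. *)
transitivity (\sum_(f | supported e f) \sum_(z | is_stabilizer z) sgn R (symp f (M z))).
  rewrite (reindex M) //=.
  under eq_bigr => g _.
    under eq_bigr do rewrite (conj_action_symp _ _ UM).
    rewrite sum_stabilizer.
  over.
  rewrite -big_distrr /= mulrC; congr (_ * _).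
  rewrite -natr_sum; congr (_%:R); rewrite /stab_count -sum1_card [RHS]big_mkcond [LHS]big_mkcond.
  apply: eq_bigr => g _; rewrite !inE.
  have [sg|] := boolP (supported e (M g)); last by rewrite andbF.
  rewrite andbT /is_stabilizer; have [ag|] := boolP (xpart (anc_str g) == 0); last by rewrite andbF.
  rewrite andbT; have [//|lg] := boolP (log_str g == 0).
  by case/negP: ue; apply/existsP; exists g; rewrite ag lg.
rewrite exchange_big /=.
under eq_bigr => z _ do rewrite (sum_symp_supp R e) supportedN.
rewrite -big_distrr /=; congr (_ * _); rewrite -natr_sum; congr (_%:R).
rewrite /stab_count -sum1_card [RHS]big_mkcond [LHS]big_mkcond.
by apply: eq_bigr => g _; rewrite !inE; case: (is_stabilizer g); case: supported.
Qed.

Lemma stab_count_gt0 e : (0 < stab_count e)%N.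
Proof.
apply/card_gt0P; exists 0; rewrite !inE (conj_action0 UM) /is_stabilizer.
have -> : log_str (0 : pstr) == 0 by apply/eqP/ffunP => q; rewrite !ffunE.
have -> : xpart (anc_str (0 : pstr)) == 0 by apply/eqP/ffunP => q; rewrite !ffunE.
by apply/forallP => q; rewrite ffunE eqxx.
Qed.

Lemma stab_count_le (e e' : sbits) : (forall q, e q -> e' q) -> (stab_count e <= stab_count e')%N.
Proof.
move=> ee; apply/subset_leq_card/fintype.subsetP => z; rewrite !inE => /andP[-> /forallP ze] /=.
by apply/forallP => q; apply/implyP => zq; apply: ee; have := ze q; rewrite zq.
Qed.

(** No cloning in counting form. Were both correctable, [macwilliams] and e2 lying in the complement
    of e1 would give 4^j A2 <= 2^|Anc| A1 for the stabilizer counts, and symmetrically with A1 and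
    A2 exchanged, impossible for 4^j > 2^|Anc|. *)
Lemma uncorrectable_disjoint (e1 e2 : sbits) j :
  (forall q, ~~ (e1 q && e2 q)) -> #|[pred q | e1 q]| = j -> #|[pred q | e2 q]| = j ->
  (#|Anc| < 2 * j)%N -> uncorrectable M e1 || uncorrectable M e2.
Proof.
move=> e12 c1 c2 lj; apply: contraT; rewrite negb_or => /andP[u1 u2].
have := macwilliams u1; have := macwilliams u2; rewrite c1 c2.
have l1 : (stab_count e2 <= stab_count [ffun q => ~~ e1 q])%N.
  by apply: stab_count_le => q eq2; rewrite ffunE; have := e12 q; rewrite eq2 andbT.
have l2 : (stab_count e1 <= stab_count [ffun q => ~~ e2 q])%N.
  by apply: stab_count_le => q eq1; rewrite ffunE; have := e12 q; rewrite eq1.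
have p1 := stab_count_gt0 e1.
have lt : (2 ^ #|Anc| < 4 ^ j)%N by rewrite -[4%N]/(2 ^ 2)%N -expnM ltn_exp2l.
move: l1 l2 p1 lt; move: (stab_count [ffun q => ~~ e1 q]) (stab_count [ffun q => ~~ e2 q]) => B1 B2.
  move: (stab_count e1) (stab_count e2) (2 ^ _)%N (4 ^ _)%N.
move=> A1 A2 s f l1 l2 p1 lt h2 h1.
have x1 : (f * A2 <= s * A1)%N by rewrite [(s * A1)%N]mulnC h1 leq_mul2l l1 orbT.
have x2 : (f * A1 <= s * A2)%N by rewrite [(s * A2)%N]mulnC h2 leq_mul2l l2 orbT.
nia.
Qed.
End BlockCodes.

(** * Half of the subsets of a given size *)

Section HalfSubsets.
Variable T : finType.
Local Notation bits := {ffun T -> bool}.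

Lemma card_bits_draws (d : pred T) j :
  #|[pred e : bits | [forall q, e q ==> d q] && (#|[pred q | e q]| == j)]| = 'C(#|d|, j).
Proof.
have -> : #|d| = #|finset d| by rewrite cardsE.
rewrite -cards_draws -!sum1_card.
pose phi (A : {set T}) : bits := [ffun q => q \in A].
rewrite (reindex phi) /=.
  apply: eq_bigl => A; rewrite !inE.
  have -> : #|[pred q | phi A q]| = #|A| by apply: eq_card => q; rewrite !inE ffunE.
  congr (_ && _); apply/forallP/fintype.subsetP => [h q qA|h q].
    by rewrite inE; have := h q; rewrite ffunE qA.
  by rewrite ffunE; apply/implyP => /h; rewrite inE.
apply: onW_bij; exists (fun e : bits => finset e) => [A|e].
  by apply/finset.setP => q; rewrite inE ffunE.
by apply/ffunP => q; rewrite ffunE inE.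
Qed.

(** Double counting of ordered pairs of disjoint j-subsets: every j-subset has the same number D > 0
    of partners, and every pair has a bad member. *)
Lemma half_subsets (bad : pred bits) j : (2 * j <= #|T|)%N ->
  (forall e1 e2 : bits, (forall q, ~~ (e1 q && e2 q)) ->
    #|[pred q | e1 q]| = j -> #|[pred q | e2 q]| = j -> bad e1 || bad e2) ->
  ('C(#|T|, j) <= 2 * #|[pred e : bits | bad e && (#|[pred q | e q]| == j)]|)%N.
Proof.
move=> jT badP.
pose P (e : bits) := #|[pred q | e q]| == j.
pose dis (e1 e2 : bits) := [forall q, ~~ (e1 q && e2 q)].
pose D := 'C(#|T| - j, j).
have D0 : (0 < D)%N by rewrite bin_gt0; lia.
have disC e1 e2 : dis e1 e2 = dis e2 e1 by apply: eq_forallb => q; rewrite andbC.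
have partners (e : bits) : P e -> (\sum_(e' | P e' && dis e e') 1 = D)%N.
  move=> /eqP Pe; rewrite sum1_card.
  have cD : #|[pred q | ~~ e q]| = (#|T| - j)%N.
    rewrite -(cardC [pred q | e q]) Pe addKn.
    by apply: eq_card => q; rewrite !inE.
  rewrite /D -cD -card_bits_draws; apply: eq_card => e'; rewrite !inE /P andbC.
  congr (_ && _); apply: eq_forallb => q.
  by rewrite /=; case: (e q); case: (e' q).
have total : (\sum_(e | P e) 1 = 'C(#|T|, j))%N.
  rewrite sum1_card -[in RHS](eq_card (_ : xpredT =i T)) // -card_bits_draws.
  by apply: eq_card => e; rewrite !inE (_ : [forall q, _]) //; apply/forallP => q; rewrite implybT.
have nbad : (\sum_(e | P e) (bad e : nat) = #|[pred e : bits | bad e && P e]|)%N.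
  rewrite -sum1_card [RHS]big_mkcond [LHS]big_mkcond; apply: eq_bigr => e _; rewrite !inE.
  by case: (P e); case: (bad e).
have s1 : (\sum_(e1 | P e1) \sum_(e2 | P e2 && dis e1 e2) (bad e1 : nat)
    = D * #|[pred e : bits | bad e && P e]|)%N.
  rewrite -nbad big_distrr /=; apply: eq_bigr => e1 /partners <-.
  by rewrite big_distrl /=; apply: eq_bigr => e2 _; rewrite mul1n.
have s2 : (\sum_(e1 | P e1) \sum_(e2 | P e2 && dis e1 e2) (bad e2 : nat)
    = D * #|[pred e : bits | bad e && P e]|)%N.
  rewrite -s1; under eq_bigr do rewrite big_mkcondr.
  rewrite exchange_big /=; apply: eq_bigr => e1 _; rewrite [RHS]big_mkcondr.
  by apply: eq_bigr => e2 _; rewrite disC.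
have : (\sum_(e1 | P e1) \sum_(e2 | P e2 && dis e1 e2) 1 <=
   \sum_(e1 | P e1) \sum_(e2 | P e2 && dis e1 e2) ((bad e1 : nat) + bad e2))%N.
  apply: leq_sum => e1 /eqP P1; apply: leq_sum => e2 /andP[/eqP P2 /forallP d12].
  by have := badP e1 e2 d12 P1 P2; case: (bad e1); case: (bad e2).
under [X in (_ <= X)%N]eq_bigr do rewrite big_split /=.
rewrite big_split /= s1 s2 (eq_bigr (fun=> D)) => [|e /partners //].
have -> : (\sum_(e | P e) D = 'C(#|T|, j) * D)%N.
  by rewrite -total big_distrl /=; apply: eq_bigr => e _; rewrite mul1n.
rewrite -/P => h.
have : ('C(#|T|, j) * D <= (2 * #|[pred e : bits | bad e && P e]|) * D)%N by lia.
by rewrite leq_pmul2r.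
Qed.
End HalfSubsets.

(** * The block ensemble: independent blocks *)

Section BlockCircuit.
Variable R : realType.
Local Notation C := R[i].

Lemma gate_sites_inj (m a b w l : nat) (st : 'I_l -> nat) (sw : forall i, (st i + w <= m)%N) :
  (forall i j x y, (x < w)%N -> (y < w)%N -> (st i + x = st j + y)%N -> i = j) ->
  forall i j p q, @gate_sites m a b _ w (sw i) p = @gate_sites m a b _ w (sw j) q ->
    i = j /\ p = q.
Proof.
move=> st_inj i j [r c] [r' c'] [E ->].
have ij := st_inj _ _ _ _ (ltn_ord r) (ltn_ord r') E; subst j; split=> //.
by congr (_, _); apply/val_inj; move/addnI: E.
Qed.

Section LocalToGlobal.
Variables (m a b w l : nat) (g : 'I_l -> site w a b -> site m a b).
Hypothesis g_inj : forall i j p q, g i p = g j q -> i = j /\ p = q.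
Hypothesis g_pos : forall i p, (g i p).2 = p.2.
Variable ms : 'I_l -> {ffun site w a b -> bool * bool} -> {ffun site w a b -> bool * bool}.
Hypothesis ms0 : forall i, ms i 0 = 0.

Definition embed (i : 'I_l) (h : {ffun site w a b -> bool * bool}) :
    {ffun site m a b -> bool * bool} :=
  [ffun q => if gate_at g q is Some p then if p.1 == i then h p.2 else 0 else 0].

Lemma gate_atP q p : gate_at g q = Some p -> g p.1 p.2 = q.
Proof. by rewrite /gate_at; case: pickP => // p' /eqP E [<-]. Qed.

Lemma restrict_embed i j h : Defs.restrict (g j) (embed i h) = if j == i then h else 0.
Proof.
by apply/ffunP => p; rewrite !ffunE gate_at_gate //=; case: eqP => // _; rewrite ffunE.
Qed.

(** The witness of one gate, extended by the identity, serves the whole layer: the other gates fix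
    the identity, and [g_pos] matches logical and ancilla positions. *)
Lemma uncorrectable_gate i (e : {ffun site m a b -> bool}) :
  uncorrectable (ms i) (Defs.restrict (g i) e) ->
  uncorrectable (layer_action g ms) e.
Proof.
move=> /existsP[h /and3P[/eqP/ffunP h0 hl /forallP he]].
apply/existsP; exists (embed i h); apply/and3P; split.
- apply/eqP/ffunP => q; rewrite !ffunE.
  case E: gate_at => [[i' p]|//] /=; case: eqP => // _.
  have /(congr1 snd) := gate_atP E; rewrite g_pos /= => pq.
  have := h0 (p.1, q.2); rewrite !ffunE => <-; congr ((h _).1).
  by rewrite /anc_sites /= -pq; case: (p).
- apply: contra hl => /eqP/ffunP hl; apply/eqP/ffunP => q.
  have E : g i (log_sites b q) = log_sites b ((g i (log_sites b q)).1, q.2).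
    by rewrite [LHS]surjective_pairing g_pos.
  have := hl ((g i (log_sites b q)).1, q.2); rewrite !ffunE -E gate_at_gate //= eqxx.
  by [].
- apply/forallP => q; apply/implyP; rewrite ffunE.
  case E: gate_at => [[i' p]|] /=; last by rewrite ffunE E eqxx.
  rewrite restrict_embed; have [i'i|_] := eqVneq i' i; last by rewrite ms0 ffunE eqxx.
  move=> hp; have := he p; rewrite -i'i hp /= ffunE.
  by rewrite (gate_atP E).
Qed.

Lemma weight_gates p (e : {ffun site m a b -> bool}) :
  weight p e = (\prod_i weight p (Defs.restrict (g i) e))
    * \prod_(q | ~~ covered g q) weight1 p (e q) :> R.
Proof.
rewrite /weight (big_gates g_inj); congr (_ * _); apply: eq_bigr => i _.
by apply: eq_bigr => q _; rewrite ffunE.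
Qed.

(** A globally harmless pattern is harmless in every gate, and these local events are
    independent. *)
Lemma uncorrectable_weight_ge (p : R) : 0 <= p <= 1 ->
  1 - \prod_i (1 - \sum_(u | uncorrectable (ms i) u) weight p u) <=
  \sum_(e | uncorrectable (layer_action g ms) e) weight p e.
Proof.
move=> p01; have w1 := weight_sum p (site m a b).
rewrite (bigID (uncorrectable (layer_action g ms))) /= in w1.
suff : \sum_(e | ~~ uncorrectable (layer_action g ms) e) weight p e <=
    \prod_i (1 - \sum_(u | uncorrectable (ms i) u) weight p u) by lra.
pose F i (u : {ffun site w a b -> bool}) : R := (~~ uncorrectable (ms i) u)%:R * weight p u.
have FE i : 1 - \sum_(u | uncorrectable (ms i) u) weight p u = \sum_u F i u.
  have := weight_sum p (site w a b); rewrite (bigID (uncorrectable (ms i))) /= => <-.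
  rewrite addrAC subrr add0r big_mkcond; apply: eq_bigr => u _; rewrite /F.
  by case: ifP => _; rewrite ?mul1r ?mul0r.
rewrite (eq_bigr _ (fun i _ => FE i)).
have := sum_gates g_inj F (fun _ => weight1 p).
rewrite [X in _ = _ * X -> _]big1 ?mulr1 => [<-|q _]; last first.
  by rewrite big_bool /weight1 /= addrC subrK.
rewrite big_mkcond /=; apply: ler_sum => e _.
have F0 i u : 0 <= F i u by rewrite mulr_ge0 ?ler0n // weight_ge0.
have w0 x : 0 <= weight1 p x.
  by rewrite /weight1; move: p01 => /andP[]; case: ifP => _ //; rewrite subr_ge0.
case: ifP => ue; last by rewrite mulr_ge0 ?prodr_ge0.
rewrite weight_gates; apply: ler_wpM2r; first by rewrite prodr_ge0.
apply: ler_prod => i _; rewrite weight_ge0 //= /F.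
suff -> : ~~ uncorrectable (ms i) (Defs.restrict (g i) e) by rewrite mul1r.
by apply: contra ue; exact: uncorrectable_gate.
Qed.
End LocalToGlobal.

Lemma weight_card (Q : finType) (p : R) (e : {ffun Q -> bool}) :
  weight p e = p ^+ #|[pred q | e q]| * (1 - p) ^+ (#|Q| - #|[pred q | e q]|).
Proof.
rewrite /weight (bigID (fun q => e q)) /=; congr (_ * _).
  rewrite (eq_bigr (fun=> p)) => [|q eq]; last by rewrite /weight1 eq.
  by rewrite prodr_const.
rewrite (eq_bigr (fun=> 1 - p)) => [|q /negPf eq]; last by rewrite /weight1 eq.
rewrite prodr_const -(cardC [pred q | e q]) addKn; congr (_ ^+ _).
Qed.

(** A single binomial term: the probability of [w./2 * b + 1] erasures, which for even w is one more
    than half of the w b ancillas. *)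
Definition erasure_tail (p : R) (w a b : nat) : R :=
  'C(w * (a + b), (w./2 * b).+1)%:R * p ^+ (w./2 * b).+1
    * (1 - p) ^+ (w * (a + b) - (w./2 * b).+1).

Lemma uncorrectable_tail (p : R) (a b : nat) (U : op R {ffun site 4 a b -> bool}) M :
  0 <= p <= 1 -> (0 < a)%N -> conj_action U M ->
  erasure_tail p 4 a b / 2 <= \sum_(u | uncorrectable M u) weight p u.
Proof.
move=> p01 a0 UM; set j := (4./2 * b).+1.
have cS : #|site 4 a b| = (4 * (a + b))%N by rewrite card_prod !card_ord.
have cA : #|ancilla 4 b| = (4 * b)%N by rewrite card_prod !card_ord.
have half := @half_subsets (site 4 a b) (uncorrectable M) j.
rewrite cS in half.
have {}half : ('C(4 * (a + b), j) <= 2 * #|[pred e : {ffun site 4 a b -> bool}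
    | uncorrectable M e && (#|[pred q | e q]| == j)]|)%N.
  (* Two disjoint patterns of size 2 b + 1 fit in the block because a > 0, so that 4 b + 2 <= 4 (a +
     b). *)
  apply: half => [|e1 e2 d c1 c2]; first by rewrite /j /=; lia.
  by apply: (uncorrectable_disjoint UM d c1 c2); rewrite cA /j /=; lia.
rewrite (bigID (fun u : {ffun site 4 a b -> bool} => #|[pred q | u q]| == j)) /=.
apply: ler_wpDr; first by apply: sumr_ge0 => u _; exact: weight_ge0.
rewrite (eq_bigr (fun=> p ^+ j * (1 - p) ^+ (4 * (a + b) - j))) => [|u /andP[_ /eqP uj]]; last first.
  by rewrite weight_card uj cS.
rewrite sumr_const /erasure_tail -/j -[_%:R * _ * _]mulrA -[leRHS]mulr_natl mulrAC.
have w0 : 0 <= p ^+ j * (1 - p) ^+ (4 * (a + b) - j).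
  by move: p01 => /andP[p0 p1]; rewrite mulr_ge0 ?exprn_ge0 // subr_ge0.
apply: ler_wpM2r => //.
rewrite ler_pdivrMr // mulrC -natrM ler_nat; exact: half.
Qed.

Lemma one_sub_pow_le (x : R) M : 0 <= x <= 1 -> (1 - x) ^+ M * (1 + M%:R * x) <= 1.
Proof.
move=> /andP[x0 x1]; elim: M => [|M IH]; first by rewrite expr0 mul0r addr0 mulr1.
apply: le_trans IH; rewrite exprSr -mulrA; apply: ler_wpM2l.
  by rewrite exprn_ge0 // subr_ge0.
have M0 : 0 <= M%:R :> R by exact: ler0n.
rewrite -addn1 natrD; nra.
Qed.

(** For y = M x <= 1 the argument of the root is at least y / 4, and a root dominates its argument
    on [0, 1]. Dropping the root is affordable since the target exponent 8 D is twice the 4 D of a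
    block. *)
Lemma sqrt_one_sub_pow_ge (x : R) M : 0 <= x <= 1 ->
  Num.min (M%:R * x) 1 / 4 <= Num.sqrt ((1 - (1 - x) ^+ M) / 2).
Proof.
move=> x01; have := one_sub_pow_le M x01; set y := M%:R * x; set z := (1 - x) ^+ M => zy.
have y0 : 0 <= y by move: x01 => /andP[x0 _]; rewrite mulr_ge0 ?ler0n.
have z0 : 0 <= z by move: x01 => /andP[_ x1]; rewrite exprn_ge0 // subr_ge0.
have [y1|y1] := leP y 1.
  have h : y / 4 <= (1 - z) / 2 by nra.
  have q0 : 0 <= y / 4 by lra.
  apply: le_trans (ler_wsqrtr h).
  have {1}-> : y / 4 = Num.sqrt ((y / 4) ^+ 2) by rewrite sqrtr_sqr ger0_norm.
  by apply: ler_wsqrtr; rewrite expr2; nra.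
have h : (1 / 4) ^+ 2 <= (1 - z) / 2 by rewrite expr2; nra.
by apply: le_trans (ler_wsqrtr h); rewrite sqrtr_sqr ger0_norm //; lra.
Qed.

Lemma expected_choi_block_ge (p : R) (N a b : nat) :
  0 <= p <= 1 -> (0 < a)%N ->
  Num.min ((N./2)%:R * (erasure_tail p 4 a b / 2)) 1 / 4 <= expected_choi_block p N a b.
Proof.
move=> p01 a0; set x := erasure_tail p 4 a b / 2.
rewrite /expected_choi_block /uniform_average.
have T0 : 0 < #|{: {ffun 'I_(N./2) -> clifford_class R (site 4 a b)}}|%:R :> R.
  rewrite ltr0n card_ffun expn_gt0; apply/orP; left; exact: card_class_gt0.
(* The bound is shown for each circuit of the ensemble separately. *)
rewrite ler_pdivlMr // mulr_natr -sumr_const; apply: ler_sum => V _.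
pose g i := @gate_sites (2 * N) a b _ 4 (@block_bound N i).
have g_inj : forall i j p q, g i p = g j q -> i = j /\ p = q.
  apply: gate_sites_inj => i j y z y4 z4 E; apply/val_inj => /=; lia.
pose ms i := class_action (V i).
have msP i : conj_action (clifford_rep (V i)) (ms i) by exact: clifford_rep_action.
have UM : conj_action (block_circuit V) (layer_action g ms).
  exact: layer_conj_action.
apply: le_trans (choi_error_lower UM p01).
have x_le i : x <= \sum_(u | uncorrectable (ms i) u) weight p u.
  exact: uncorrectable_tail (msP i).
have q_le1 i : \sum_(u | uncorrectable (ms i) u) weight p u <= 1.
  rewrite -(weight_sum p (site 4 a b)) [leRHS](bigID (uncorrectable (ms i))) /=.
  by rewrite ler_wpDr // sumr_ge0 // => u _; exact: weight_ge0.
have x0 : 0 <= x.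
  move: p01 => /andP[p0 p1]; rewrite /x /erasure_tail.
  by rewrite !mulr_ge0 ?ler0n ?exprn_ge0 ?subr_ge0.
(* The bound x <= 1 is read off a block, so the circuit without blocks is treated apart. *)
have [N0|N0] := eqVneq (N./2) 0%N.
  by rewrite [X in X%:R * x]N0 mul0r min_l // mul0r sqrtr_ge0.
have x1 : x <= 1.
  have i0 : 'I_(N./2) by apply: (@Ordinal _ 0); rewrite lt0n.
  exact: le_trans (x_le i0) (q_le1 i0).
apply: le_trans (sqrt_one_sub_pow_ge (N./2) _) _; first by rewrite x0 x1.
apply: ler_wsqrtr; rewrite ler_pM2r ?invr_gt0 //.
apply: le_trans (uncorrectable_weight_ge g_inj _ _ p01); last 2 first.
- by move=> i q.
- by move=> i; exact: conj_action0 (msP i).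
rewrite lerB //.
apply: le_trans (_ : \prod_(i < N./2) (1 - x) <= _); last by rewrite prodr_const card_ord.
apply: ler_prod => i _; rewrite subr_ge0 q_le1 /= lerB //.
Qed.
End BlockCircuit.

(** * Binomial probabilities and relative entropy *)

Section BinomialTail.

(* The binomial(m, i/m) distribution has its mode at i. *)
Lemma binomial_mode m i j : (i < m)%N -> (j <= m)%N ->
  ('C(m, j) * ((m - i) ^ (m - j) * i ^ j) <= 'C(m, i) * ((m - i) ^ (m - i) * i ^ i))%N.
Proof.
move=> im; pose T j := ('C(m, j) * ((m - i) ^ (m - j) * i ^ j))%N.
have step k : (k < m)%N -> (T k.+1 * (k.+1 * (m - i)) = T k * ((m - k) * i))%N.
  move=> km; have := mul_bin_left m k; rewrite /T.
  have -> : (m - k = (m - k.+1).+1)%N by lia.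
  rewrite !expnS => h.
  transitivity ((k.+1 * 'C(m, k.+1)) * ((m - i) * (m - i) ^ (m - k.+1) * (i * i ^ k)))%N; first by ring.
  by rewrite h; ring.
have up k : (k < i)%N -> (T k <= T k.+1)%N.
  move=> ki; have := step k (ltn_trans ki im).
  have le : (k.+1 * (m - i) <= (m - k) * i)%N by nia.
  have p0 : (0 < k.+1 * (m - i))%N by rewrite muln_gt0 subn_gt0.
  by move=> E; rewrite -(leq_pmul2r p0) E leq_mul2l le orbT.
have down k : (i <= k)%N -> (k < m)%N -> (T k.+1 <= T k)%N.
  move=> ik km; have := step k km.
  have le : ((m - k) * i <= k.+1 * (m - i))%N by nia.
  have p0 : (0 < k.+1 * (m - i))%N by rewrite muln_gt0 subn_gt0.
  by move=> E; rewrite -(leq_pmul2r p0) E leq_mul2l le orbT.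
move=> jm; rewrite -/(T j) -/(T i).
have [ji|ij] := leqP j i.
  rewrite -(subKn ji); elim: (i - j)%N (leq_subr j i) => [|d IH] di; first by rewrite subn0.
  apply: leq_trans (IH (ltnW di)).
  have -> : (i - d = (i - d.+1).+1)%N by lia.
  by apply: up; lia.
rewrite -(subnK (ltnW ij)).
have : (j - i + i <= m)%N by lia.
elim: (j - i)%N => [|d IH] dm //.
by rewrite addSn; apply: leq_trans (IH (ltnW dm)); apply: down => //; exact: leq_addl.
Qed.

(** Expand ((m - i) + i)^m: there are m + 1 terms, none above the i-th. *)
Lemma binomial_mode_ge m i : (i < m)%N ->
  (m ^ m <= m.+1 * ('C(m, i) * ((m - i) ^ (m - i) * i ^ i)))%N.
Proof.
move=> im; have {1}-> : m = (m - i + i)%N by lia.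
rewrite expnDn; set X := ('C(m, i) * _)%N.
have -> : (m.+1 * X = \sum_(j < m.+1) X)%N by rewrite sum_nat_const card_ord.
by apply: leq_sum => j _; apply: binomial_mode => //; rewrite -ltnS.
Qed.

Variable R : realType.

Lemma ln_ge_1BV (t : R) : 0 < t -> 1 - t^-1 <= ln t.
Proof.
move=> t0; have := @le_ln1Dx R (t^-1 - 1).
rewrite addrCA subrr addr0 lnV ?posrE // => h.
have : - ln t <= t^-1 - 1 by apply: h; rewrite ltrBrDr addNr invr_gt0.
lra.
Qed.

Lemma ln2_gt0 : 0 < ln 2 :> R.
Proof. by apply: ln_gt0; rewrite ltr1n. Qed.

Lemma relative_entropy_ln (x y : R) :
  relative_entropy x y * ln 2 = x * ln (x / y) + (1 - x) * ln ((1 - x) / (1 - y)).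
Proof.
have := ln2_gt0; rewrite /relative_entropy /log2 => l2.
by field; rewrite gt_eqF.
Qed.

(** Gibbs' inequality: by [ln_ge_1BV] the two terms are at least x - y and y - x. *)
Lemma relative_entropy_ge0 (x y : R) : 0 < x < 1 -> 0 < y < 1 -> 0 <= relative_entropy x y.
Proof.
move=> /andP[x0 x1] /andP[y0 y1].
rewrite -(pmulr_lge0 _ ln2_gt0) relative_entropy_ln.
have h1 : x * (1 - (x / y)^-1) <= x * ln (x / y).
  by apply: ler_wpM2l; [lra | apply: ln_ge_1BV; rewrite divr_gt0].
have h2 : (1 - x) * (1 - ((1 - x) / (1 - y))^-1) <= (1 - x) * ln ((1 - x) / (1 - y)).
  by apply: ler_wpM2l; [lra | apply: ln_ge_1BV; rewrite divr_gt0 ?subr_gt0].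
have e1 : x * (1 - (x / y)^-1) = x - y by field; rewrite !gt_eqF.
have e2 : (1 - x) * (1 - ((1 - x) / (1 - y))^-1) = y - x.
  by field; rewrite !gt_eqF ?subr_gt0.
lra.
Qed.

(** Change of measure: on a pattern of i erasures among m sites, the likelihood ratio of the erasure
    rates p and i / m is 2^(-m D). *)
Lemma expR_entropy (p : R) (m i : nat) : 0 < p < 1 -> (0 < i < m)%N ->
  expR (- (m%:R * (relative_entropy (i%:R / m%:R) p * ln 2))) * (i%:R / m%:R) ^+ i
    * (1 - i%:R / m%:R) ^+ (m - i) = p ^+ i * (1 - p) ^+ (m - i).
Proof.
move=> /andP[p0 p1] /andP[i0 im]; set x := i%:R / m%:R.
have m0 : 0 < m%:R :> R by rewrite ltr0n; lia.
have x0 : 0 < x by rewrite divr_gt0 // ltr0n.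
have x1 : 0 < 1 - x by rewrite subr_gt0 ltr_pdivrMr // mul1r ltr_nat.
have q1 : 0 < 1 - p by rewrite subr_gt0.
have mx : m%:R * x = i%:R by rewrite /x mulrC divfK // gt_eqF.
have m1x : m%:R * (1 - x) = (m - i)%:R by rewrite mulrBr mulr1 mx natrB // ltnW.
clearbody x.
have -> : - (m%:R * (relative_entropy x p * ln 2)) =
    i%:R * ln (p / x) + (m - i)%:R * ln ((1 - p) / (1 - x)).
  rewrite relative_entropy_ln -mx -m1x -[p / x]invf_div -[(1 - p) / _]invf_div.
  by rewrite !lnV ?posrE ?divr_gt0 //; ring.
rewrite expRD !expRM_natl !lnK ?posrE ?divr_gt0 //.
rewrite -mulrA mulrACA -!exprMn.
by congr (_ ^+ _ * _ ^+ _); field; rewrite ?gt_eqF.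
Qed.

Lemma binomial_mode_prob (m i : nat) : (0 < i < m)%N ->
  1 <= m.+1%:R * ('C(m, i)%:R * ((i%:R / m%:R) ^+ i * (1 - i%:R / m%:R) ^+ (m - i))) :> R.
Proof.
move=> /andP[i0 im]; have m0 : 0 < m%:R :> R by rewrite ltr0n; lia.
have := binomial_mode_ge im; rewrite -(ler_nat R) !natrM !natrX => h.
have -> : 1 - i%:R / m%:R = (m - i)%:R / m%:R :> R.
  by rewrite natrB; [field; rewrite gt_eqF | exact: ltnW].
have mm : m%:R ^+ m = m%:R ^+ i * m%:R ^+ (m - i) :> R by rewrite -exprD subnKC // ltnW.
rewrite mm in h; rewrite !expr_div_n.
have A0 : 0 < m%:R ^+ i :> R by rewrite exprn_gt0.
have B0 : 0 < m%:R ^+ (m - i) :> R by rewrite exprn_gt0.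
move: (m%:R ^+ i) (m%:R ^+ (m - i)) A0 B0 h => A B A0 B0.
move: (_%:R ^+ (m - i)) (_%:R ^+ i) ('C(m, i)%:R) (m.+1%:R) => d e c f h.
have -> : f * (c * (e / A * (d / B))) = f * (c * (d * e)) / (A * B).
  by field; rewrite !gt_eqF.
by rewrite ler_pdivlMr ?mulr_gt0 // mul1r.
Qed.

(** The change of measure is made at i = 2 b, where i / m is exactly (1 - r) / 2. Passing to the
    fatal size i + 1 costs at most a factor p, as binomial coefficients increase up to the
    middle. *)
Lemma erasure_tail_ge (p : R) (a b : nat) : 0 < p < 1 -> (0 < a)%N -> (0 < b)%N ->
  p / (4 * (a + b)).+1%:R * expR (- ((4 * (a + b))%:R
     * (relative_entropy ((2 * b)%:R / (4 * (a + b))%:R) p * ln 2)))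
  <= erasure_tail p 4 a b.
Proof.
move=> p01 a0 b0; set m := (4 * (a + b))%N; set i := (2 * b)%N.
have im : (0 < i < m)%N by rewrite /i /m; lia.
have /andP[p0 p1] := p01.
have m0 : 0 < m%:R :> R by rewrite ltr0n; lia.
set E := expR _; have E0 : 0 < E by exact: expR_gt0.
have key := expR_entropy p01 im; rewrite -/E in key.
set x := i%:R / m%:R in key.
have bx := binomial_mode_prob im; rewrite -/x in bx.
have Ebound : E / m.+1%:R <= 'C(m, i)%:R * (p ^+ i * (1 - p) ^+ (m - i)).
  rewrite -key ler_pdivrMr ?ltr0n //.
  have -> : 'C(m, i)%:R * (E * x ^+ i * (1 - x) ^+ (m - i)) * m.+1%:R =
    E * (m.+1%:R * ('C(m, i)%:R * (x ^+ i * (1 - x) ^+ (m - i)))) by ring.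
  by rewrite ler_peMr // ltW.
have -> : p / m.+1%:R * E = p * (E / m.+1%:R) by ring.
apply: le_trans (ler_wpM2l (ltW p0) Ebound) _.
rewrite /erasure_tail /= -/m -/i.
have binle : ('C(m, i) <= 'C(m, i.+1))%N.
  have := mul_bin_left m i; have : (i.+1 <= m - i)%N by rewrite /i /m; lia.
  by move=> h E1; rewrite -(leq_pmul2l (ltn0Sn i)) E1 leq_mul2r h orbT.
have -> : (m - i = (m - i.+1).+1)%N by rewrite /i /m; lia.
rewrite !exprS.
have q0 : 0 <= (1 - p) ^+ (m - i.+1) by rewrite exprn_ge0 // subr_ge0 ltW.
have pi0 : 0 <= p ^+ i by rewrite exprn_ge0 // ltW.
apply: le_trans (_ : 'C(m, i)%:R * (p * p ^+ i) * (1 - p) ^+ (m - i.+1) <= _).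
  have -> : p * ('C(m, i)%:R * (p ^+ i * ((1 - p) * (1 - p) ^+ (m - i.+1)))) =
    (1 - p) * ('C(m, i)%:R * (p * p ^+ i) * (1 - p) ^+ (m - i.+1)) by ring.
  by rewrite ler_piMl //; [rewrite !mulr_ge0 // ?ler0n // ltW | lra].
apply: ler_wpM2r => //; apply: ler_wpM2r; first by rewrite mulr_ge0 // ltW.
by rewrite ler_nat.
Qed.

(* The o(1) term, absorbing the polynomial factors of the tail bound. *)
Definition tail_correction (p : R) (xi : nat) : R :=
  8 / p / ln 2 / Num.sqrt xi%:R.

Lemma tail_correction_cvg (p : R) : 0 < p -> tail_correction p xi @[xi --> \oo] --> (0 : R).
Proof.
move=> p0; apply/cvgrPdist_lt => e e0.
set K := 8 / p / ln 2.
have K0 : 0 < K by rewrite !divr_gt0 // ln2_gt0.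
exists (Num.truncn ((K / e) ^+ 2)).+1 => // xi /= hxi.
have h : (K / e) ^+ 2 < xi%:R.
  by apply: lt_le_trans (truncnS_gt _) _; rewrite ler_nat.
have hs : K / e < Num.sqrt xi%:R.
  rewrite -[ltLHS]ger0_norm; last by rewrite divr_ge0 // ltW.
  by rewrite -sqrtr_sqr ltr_sqrt // (le_lt_trans _ h) // sqr_ge0.
have s0 : 0 < Num.sqrt (xi%:R : R) by apply: (le_lt_trans _ hs); rewrite divr_ge0 // ltW.
rewrite sub0r normrN ger0_norm; last by rewrite divr_ge0 // ltW.
by rewrite /tail_correction -/K ltr_pdivrMr // mulrC -ltr_pdivrMr.
Qed.

Lemma tail_correction_bound (p : R) (xi : nat) : 0 < p < 1 -> (0 < xi)%N ->
  32 * xi%:R * (4 * xi).+1%:R / p <= expR (tail_correction p xi * xi%:R * ln 2).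
Proof.
move=> /andP[p0 p1] x0; set x : R := xi%:R; have x1 : 1 <= x by rewrite ler1n.
have -> : tail_correction p xi * x * ln 2 = 8 / p * Num.sqrt x.
  rewrite /tail_correction -/x -{2}[x]sqr_sqrtr; last by lra.
  field; rewrite !gt_eqF ?sqrtr_gt0 ?ln2_gt0 //; lra.
set k := 8 / p; have k1 : 8 <= k by rewrite /k ler_pdivlMr //; lra.
have s0 : 0 <= Num.sqrt x by exact: sqrtr_ge0.
(* The quartic term of the exponential is quadratic in x, as is the left-hand side. *)
have := @expR_ge1Dxn R (k * Num.sqrt x) 3; rewrite mulr_ge0 //; last by lra.
move=> /(_ isT); apply: le_trans.
have -> : (k * Num.sqrt x) ^+ 4 = k ^+ 4 * x ^+ 2.
  have ss : Num.sqrt x ^+ 2 = x by apply: sqr_sqrtr; lra.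
  by rewrite exprMn -[in RHS]ss -exprM.
have -> : (4 * xi).+1%:R = 4 * x + 1 :> R by rewrite -addn1 natrD natrM.
have -> : (4`!)%:R = 24 :> R by [].
have k2 : 8 * k <= k ^+ 2 by rewrite expr2; nra.
have k4 : 512 * k <= k ^+ 4 by rewrite -[4%N]/(2 * 2)%N exprM [leRHS]expr2; nra.
have x2 : x * (4 * x + 1) <= 5 * x ^+ 2 by rewrite expr2; nra.
have -> : 32 * x * (4 * x + 1) / p = 4 * k * (x * (4 * x + 1)).
  by rewrite /k; field; rewrite gt_eqF.
have x20 : 0 <= x ^+ 2 by exact: sqr_ge0.
have h1 : 4 * k * (x * (4 * x + 1)) <= 4 * k * (5 * x ^+ 2) by apply: ler_wpM2l => //; lra.
have h2 : 512 * k * x ^+ 2 <= k ^+ 4 * x ^+ 2 by apply: ler_wpM2r.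
have h3 : 0 <= k * x ^+ 2 by rewrite mulr_ge0 //; lra.
lra.
Qed.
End BinomialTail.

(** * Lower bound for the block ensemble *)

Section BlockLowerBound.
Variable R : realType.

Lemma admissible_rate (n k N a b : nat) (eps r : R) :
  admissible n k N a b eps -> k%:R / n%:R = r ->
  [/\ (0 < a + b)%N, r = a%:R / (a + b)%:R & eps / n%:R = expR (- ((a + b)%:R * ln 2))].
Proof.
move=> [[n0 e0] _ nE kE xiE] kr.
have x0 : (0 < a + b)%N by move: n0; rewrite nE muln_gt0 => /andP[].
have n0' : 0 < n%:R :> R by rewrite ltr0n.
have x0' : 0 < (a + b)%:R :> R by rewrite ltr0n.
split=> //.
  have kE' : k%:R * (a + b)%:R = a%:R * n%:R :> R by rewrite -[LHS]natrM kE natrM.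
  apply: (mulIf (lt0r_neq0 x0')); rewrite divfK ?gt_eqF // -kr mulrAC kE'.
  by rewrite mulfK // gt_eqF.
rewrite xiE /log2 divfK ?gt_eqF ?ln2_gt0 // -lnV ?posrE ?divr_gt0 //.
by rewrite lnK ?posrE ?invr_gt0 ?divr_gt0 // invf_div.
Qed.

Lemma block_choi_lower (p r : R) : 0 < p < 1 -> 0 < r -> 0 < 1 - r - 2 * p ->
  forall (n k N a b : nat) (eps : R),
    admissible n k N a b eps -> k%:R / n%:R = r ->
    Num.min
      (n%:R * (eps / n%:R) `^
         (8 * relative_entropy ((1 - k%:R / n%:R) / 2) p + tail_correction p (a + b)%N))
      (1 / 4)
    <= expected_choi_block p N a b.
Proof.
move=> p01 r0 rp n k N a b eps adm kr; have /andP[p0 p1] := p01.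
have [x0 rE epsE] := admissible_rate adm kr.
have [[n0 e0] Nodd nE _ _] := adm.
set xi := (a + b)%N in x0 rE epsE *.
have x0' : 0 < xi%:R :> R by rewrite ltr0n.
have a0 : (0 < a)%N.
  by rewrite lt0n; apply: contraTneq r0 => a0; rewrite rE a0 mul0r ltxx.
have b0 : (0 < b)%N.
  rewrite lt0n; apply: contraTneq rp => b0.
  have r1 : r = 1 by rewrite rE /xi b0 addn0 mulfV // pnatr_eq0 -lt0n.
  by rewrite r1 -leNgt; lra.
have x01 : 0 <= p <= 1 by rewrite !ltW.
apply: le_trans (expected_choi_block_ge N b x01 a0).
rewrite kr; set X := _ `^ _; set D := relative_entropy _ _ in X *.
have DE : D = relative_entropy ((2 * b)%:R / (4 * xi)%:R) p.
  rewrite /D; congr (relative_entropy _ p); rewrite rE /xi !natrM natrD; field.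
  by rewrite -natrD gt_eqF.
have D0 : 0 <= D.
  rewrite DE; apply: relative_entropy_ge0 => //.
  rewrite divr_gt0 ?ltr0n ?muln_gt0 ?x0 ?b0 //= ltr_pdivrMr ?ltr0n ?muln_gt0 ?x0 //.
  by rewrite mul1r ltr_nat /xi; lia.
have tail := erasure_tail_ge p01 a0 b0; rewrite -/xi -DE in tail.
have corr := tail_correction_bound p01 x0.
set t := tail_correction p xi in X corr *.
have XE : X = expR (- (8 * D * xi%:R * ln 2)) / expR (t * xi%:R * ln 2).
  have y0 : 0 < eps / n%:R by rewrite divr_gt0 // ltr0n.
  rewrite /X /powR gt_eqF // epsE expRK -expRN -expRD; congr expR; ring.
(* 32 xi is the 4 xi sites of a block, times 2 for the fatal half of the patterns, times 4 from
   [sqrt_one_sub_pow_ge]. *)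
have key : 32 * xi%:R * X <= erasure_tail p 4 a b.
  apply: le_trans tail; rewrite XE.
  have m1 : 0 < (4 * xi).+1%:R :> R by rewrite ltr0n.
  set E1 := expR (t * _ * _) in corr *; have E10 : 0 < E1 by exact: expR_gt0.
  (* The block gives the exponent 4 D; it is weakened to the 8 D of the statement, as D >= 0. *)
  have E2 : expR (- (8 * D * xi%:R * ln 2)) <= expR (- ((4 * xi)%:R * (D * ln 2))) :> R.
    have := ln2_gt0 R => l2.
    have : 0 <= D * xi%:R * ln 2 by rewrite !mulr_ge0 // ltW.
    by rewrite ler_expR natrM; lra.
  have c1 : 32 * xi%:R / E1 <= p / (4 * xi).+1%:R.
    rewrite ler_pdivrMr // mulrAC ler_pdivlMr //.
    by move: corr; rewrite ler_pdivrMr // [E1 * p]mulrC.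
  have -> : 32 * xi%:R * (expR (- (8 * D * xi%:R * ln 2)) / E1) =
    32 * xi%:R / E1 * expR (- (8 * D * xi%:R * ln 2)) by ring.
  by apply: ler_pM => //; rewrite ?expR_ge0 // divr_ge0 ?mulr_ge0 // ltW.
have X0 : 0 <= X by exact: powR_ge0.
have nM : n%:R = 4 * (N./2)%:R * xi%:R :> R.
  rewrite nE -/xi -{1}(odd_double_half N) (negPf Nodd) add0n -muln2 !natrM; ring.
have M0 : 0 <= (N./2)%:R :> R by exact: ler0n.
have nX : n%:R * X <= (N./2)%:R * (erasure_tail p 4 a b / 2) / 4.
  rewrite nM; have := ler_wpM2l M0 key; nra.
rewrite -[X in _ <= X / 4]/(Num.min _ _) ler_pdivlMr //.
have [h|h] := leP ((N./2)%:R * (erasure_tail p 4 a b / 2)) 1.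
  have : Num.min (n%:R * X) (1 / 4) <= n%:R * X by rewrite ge_min lexx.
  lra.
have : Num.min (n%:R * X) (1 / 4) <= 1 / 4 by rewrite ge_min lexx orbT.
lra.
Qed.
End BlockLowerBound.

(** * Averages over the gates of one layer *)

Section FirstMoment.
Variable R : realType.

Lemma average_prod (I T : finType) (F : I -> T -> R) :
  uniform_average (fun V : {ffun I -> T} => \prod_i F i (V i)) =
  \prod_i uniform_average (F i).
Proof.
rewrite /uniform_average -bigA_distr_bigA big_split /= prodr_const card_ffun natrX.
by rewrite exprVn.
Qed.

Lemma average_pair (T1 T2 : finType) (F : T1 * T2 -> R) :
  uniform_average F =
  uniform_average (fun V1 => uniform_average (fun V2 => F (V1, V2))).
Proof.
rewrite /uniform_average sum_pair card_prod natrM invfM mulrCA mulrC mulr_suml.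
by rewrite mulr_suml; apply: eq_bigr => x _; rewrite mulrAC.
Qed.

Lemma average_le (T : finType) (F G : T -> R) :
  (forall x, F x <= G x) -> uniform_average F <= uniform_average G.
Proof. by move=> FG; apply: ler_wpM2r; rewrite ?invr_ge0 ?ler0n // ler_sum. Qed.

Lemma average_const (T : finType) (c : R) : (0 < #|T|)%N ->
  uniform_average (fun _ : T => c) = c.
Proof.
by move=> T0; rewrite /uniform_average sumr_const -[c *+ _]mulr_natr mulfK // pnatr_eq0 -lt0n.
Qed.

Lemma average_sum (T I : finType) (P : pred I) (F : I -> T -> R) :
  uniform_average (fun x => \sum_(i | P i) F i x) =
  \sum_(i | P i) uniform_average (F i).
Proof. by rewrite /uniform_average exchange_big mulr_suml. Qed.

Lemma averageZ (T : finType) (c : R) (F : T -> R) :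
  uniform_average (fun x => c * F x) = c * uniform_average F.
Proof. by rewrite /uniform_average -mulr_sumr mulrA. Qed.

Lemma average_ext (T : finType) (F G : T -> R) : F =1 G -> uniform_average F = uniform_average G.
Proof. by move=> FG; rewrite /uniform_average (eq_bigr G). Qed.

Section Weights.
Variable p : R.
Hypothesis p01 : 0 <= p <= 1.

(* Probability that all the sites where f acts are erased. *)
Definition pauli_weight (Q : finType) (f : {ffun Q -> bool * bool}) : R :=
  \prod_q (if f q == 0 then 1 else p).

Lemma pauli_weight_ge0 (Q : finType) (f : {ffun Q -> bool * bool}) : 0 <= pauli_weight f.
Proof. by apply: prodr_ge0 => q _; case: ifP => // _; case/andP: p01. Qed.

Lemma sum_supported (m a b : nat) (f : {ffun site m a b -> bool * bool}) :
  \sum_(e | supported e f) weight p e = pauli_weight f.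
Proof.
transitivity (\sum_(e : {ffun site m a b -> bool})
    \prod_q (((f q != 0) ==> e q)%:R * weight1 p (e q)) : R).
  rewrite big_mkcond; apply: eq_bigr => e _; rewrite big_split /= prod_natb /supported.
  by case: ifP => _; rewrite ?mul1r ?mul0r.
rewrite -(bigA_distr_bigA (fun q x => ((f q != 0) ==> x)%:R * weight1 p x)).
apply: eq_bigr => q _; rewrite big_bool /weight1 implybT implybF negbK mul1r.
by case: eqP => _ /=; rewrite ?mul1r ?mul0r ?addr0 ?[p + _]addrC ?subrK.
Qed.

(** Strings preserving the code space, stabilizers included: a condition site by site, which can
    thus be split among the first-layer gates. *)
Definition is_codelike (m a b : nat) (g : {ffun site m a b -> bool * bool}) : bool :=
  xpart (anc_str g) == 0.

(** Union bound over the witnesses, a nontrivial logical part being relaxed to g != 0. *)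
Lemma uncorrectable_weight_le (m a b : nat) M :
  \sum_(e | @uncorrectable m a b M e) weight p e <=
  \sum_(g | is_codelike g && (g != 0)) pauli_weight (M g).
Proof.
under [leRHS]eq_bigr do rewrite -sum_supported big_mkcond /=.
rewrite exchange_big /= big_mkcond; apply: ler_sum => e _.
have s0 (P : pred {ffun site m a b -> bool * bool}) :
    0 <= \sum_(g | P g) (if supported e (M g) then weight p e else 0).
  by apply: sumr_ge0 => g _; case: ifP => // _; exact: weight_ge0.
case: ifP => [/existsP[g /and3P[g0 lg ge]]|_]; last exact: s0.
rewrite (bigD1 g) /=; first by rewrite /supported ge ler_wpDr.
rewrite /is_codelike g0; apply: contra lg => /eqP ->.
by apply/eqP/ffunP => q; rewrite !ffunE.
Qed.

Lemma sum_pauli_weight (Q : finType) :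
  \sum_(f : {ffun Q -> bool * bool}) pauli_weight f = (1 + 3 * p) ^+ #|Q|.
Proof.
rewrite /pauli_weight -(bigA_distr_bigA (fun (_ : Q) (c : bool * bool) => if c == 0 then 1 else p)).
rewrite -[RHS]prodr_const; apply: eq_bigr => q _.
by rewrite sum_pair !big_bool /=; ring.
Qed.

Variables (a b : nat).
Local Notation xi := (a + b)%N.
Local Notation Gate := (site 2 a b).
Local Notation cls := (clifford_class R (site 2 a b)).

Lemma card_gate : #|site 2 a b| = (2 * xi)%N.
Proof. by rewrite card_prod !card_ord. Qed.

(** Mean of [pauli_weight] over the 4^(2 xi) strings of a gate. *)
Definition gate_damping : R := (1 + 3 * p) ^+ (2 * xi) / 4 ^+ (2 * xi).
(** Fraction of codelike strings on a gate: 4^(2 a) 2^(2 b) out of 4^(2 (a + b)). *)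
Definition code_fraction : R := 2 ^- (2 * b).

Lemma gate_damping_ge0 : 0 <= gate_damping.
Proof. by case/andP: p01 => p0 _; rewrite divr_ge0 // exprn_ge0 //; lra. Qed.

Lemma gate_damping_le1 : gate_damping <= 1.
Proof.
case/andP: p01 => p0 p1; rewrite /gate_damping ler_pdivrMr ?exprn_gt0 // mul1r.
by apply: lerXn2r; rewrite ?nnegrE; lra.
Qed.

Hypothesis xi0 : (0 < xi)%N.

Lemma pow4_gt1 : (1 < 4 ^ #|site 2 a b|)%N.
Proof. by rewrite card_gate -[1%N](expn0 4) ltn_exp2l // muln_gt0. Qed.

Lemma pow4_pred : ((4 ^ #|site 2 a b|).-1%:R : R) = 4 ^+ (2 * xi) - 1.
Proof.
have := pow4_gt1; rewrite card_gate; case E: (4 ^ _)%N => [//|k] _ /=.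
by rewrite -[4 in RHS]/(4%:R) -natrX E -addn1 natrD addrK.
Qed.

(** Means over nonzero strings are compared with means over all strings: leaving out the identity,
    of maximal weight 1, can only lower the mean. *)
Lemma ratio_pred_le (A B : R) : A <= B -> 1 < B -> (A - 1) / (B - 1) <= A / B.
Proof.
move=> AB B1; rewrite ler_pdivrMr ?subr_gt0 // mulrAC ler_pdivlMr; last lra.
nra.
Qed.

Lemma average_pauli_weight (u : {ffun site 2 a b -> bool * bool}) :
  uniform_average (fun t : cls => pauli_weight (class_action t u)) <=
  (if u == 0 then 1 else gate_damping).
Proof.
have [->|u0] := eqVneq u 0.
  rewrite (average_ext (G := fun=> 1)) ?average_const //; first exact: card_class_gt0.
  move=> t; rewrite (conj_action0 (clifford_rep_action t)) /pauli_weight big1 // => q _.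
  by rewrite ffunE eqxx.
rewrite (average_class_action (@pauli_weight _) u0) pow4_pred.
have -> : \sum_(g : {ffun site 2 a b -> bool * bool} | g != 0) pauli_weight g
    = (1 + 3 * p) ^+ (2 * xi) - 1.
  rewrite -card_gate -sum_pauli_weight [in RHS](bigD1 (0 : {ffun site 2 a b -> bool * bool})) //= addrAC.
  rewrite [X in X - 1](_ : _ = 1) ?subrr ?add0r // /pauli_weight big1 // => q _.
  by rewrite ffunE eqxx.
case/andP: p01 => p0 p1; apply: ratio_pred_le.
  by apply: lerXn2r; rewrite ?nnegrE; lra.
by have := pow4_gt1; rewrite card_gate -(ltr_nat R) natrX.
Qed.

(** The left side is the expected number of codelike preimages of v. For v = 0 this is the identity
    alone; otherwise each nonzero codelike string hits v with probability 1 / (4^(2 xi) - 1). *)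
Lemma sum_code_average (v : {ffun site 2 a b -> bool * bool}) :
  \sum_(u | is_codelike u) uniform_average (fun t : cls => (class_action t u == v)%:R)
  <= (if v == 0 then 1 else code_fraction).
Proof.
have act0 (t : cls) : class_action t 0 = 0 by exact: (conj_action0 (clifford_rep_action t)).
have code0 : is_codelike (0 : {ffun site 2 a b -> bool * bool}).
  by apply/eqP/ffunP => q; rewrite !ffunE.
rewrite (bigD1 (0 : {ffun site 2 a b -> bool * bool})) //= (average_ext (G := fun=> (0 == v)%:R)); last by move=> t; rewrite act0.
rewrite average_const ?card_class_gt0 //.
have piE u : u != 0 ->
    uniform_average (fun t : cls => (class_action t u == v)%:R) = (v != 0)%:R / (4 ^+ (2 * xi) - 1) :> R.
  move=> u0; rewrite (average_class_action (fun g => (g == v)%:R) u0) pow4_pred.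
  congr (_ / _); have [->|v0] := eqVneq v 0.
    by rewrite big1 // => g /negPf ->.
  by rewrite (bigD1 v) //= eqxx big1 ?addr0 // => g /andP[_ /negPf ->].
rewrite (eq_bigr (fun=> (v != 0)%:R / (4 ^+ (2 * xi) - 1))); last by move=> u /andP[_]; exact: piE.
rewrite eq_sym; have [v0|v0] := eqVneq v 0.
  by rewrite big1 ?addr0 // => u _; rewrite mul0r.
rewrite add0r sumr_const mul1r.
pose K := #|[pred u : {ffun site 2 a b -> bool * bool} | is_codelike u]|.
have cK : K = #|[pred u : {ffun site 2 a b -> bool * bool} | is_codelike u && (u != 0)]|.+1.
  rewrite /K (cardD1 (0 : {ffun site 2 a b -> bool * bool})) inE code0 add1n; congr _.+1; apply: eq_card => u.
  by rewrite !inE andbC.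
have KE : K%:R = 4 ^+ (2 * a) * 2 ^+ (2 * b) :> R.
  pose ok (q : site 2 a b) (c : bool * bool) : bool :=
    if fintype.split q.2 is inl _ then true else ~~ c.1.
  have -> : K%:R = \sum_(u : {ffun site 2 a b -> bool * bool}) \prod_q (ok q (u q))%:R :> R.
    rewrite /K -sum1_card natr_sum big_mkcond; apply: eq_bigr => u _.
    rewrite prod_natb !inE /is_codelike; have -> : (xpart (anc_str u) == 0) = [forall q, ok q (u q)].
      apply/eqP/forallP => [/ffunP u0 [r c]|uok].
        rewrite /ok /=; case: splitP => // j cj.
        have := u0 (r, j); rewrite !ffunE /anc_sites /= => h.
        by rewrite (_ : c = rshift a j) ?h //; apply/val_inj.
      apply/ffunP => q; rewrite !ffunE; have := uok (anc_sites a q).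
      by rewrite /ok /= -[rshift a q.2]/(unsplit (inr q.2)) unsplitK => /negPf.
    by case: forallP.
  rewrite -(bigA_distr_bigA (fun q c => (ok q c)%:R)) big_site /=; congr (_ * _).
    rewrite (eq_bigr (fun=> 4)) ?prodr_const ?card_prod ?card_ord // => q _.
    rewrite sum_pair !big_bool /ok /= -[lshift b q.2]/(unsplit (inl q.2)) unsplitK /=; ring.
  rewrite (eq_bigr (fun=> 2)) ?prodr_const ?card_prod ?card_ord // => q _.
  rewrite sum_pair !big_bool /ok /= -[rshift a q.2]/(unsplit (inr q.2)) unsplitK /=; ring.
have B1 : 1 < 4 ^+ (2 * xi) :> R.
  by have := pow4_gt1; rewrite card_gate -(ltr_nat R) natrX.
have KB : K%:R / 4 ^+ (2 * xi) = code_fraction.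
  rewrite KE /code_fraction mulnDr exprD.
  have -> : 4 ^+ (2 * b) = 2 ^+ (2 * b) * 2 ^+ (2 * b) :> R by rewrite -exprMn; congr (_ ^+ _); ring.
  by field; rewrite !expf_neq0 // pnatr_eq0.
have K_le : K%:R <= 4 ^+ (2 * xi) :> R.
  rewrite -(ler_pM2r (_ : 0 < (4 ^+ (2 * xi))^-1)) ?invr_gt0 ?exprn_gt0 //.
  rewrite KB mulfV ?gt_eqF ?exprn_gt0 // /code_fraction invf_le1 ?exprn_gt0 //.
  by rewrite exprn_ege1 // ler1n.
have := ratio_pred_le K_le B1; rewrite KB; apply: le_trans.
set K' := #|_| in cK; have -> : K%:R - 1 = K'%:R :> R by rewrite cK -natr1 addrK.
by rewrite -[leLHS]mulr_natl.
Qed.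
End Weights.
End FirstMoment.

(** * The double layer: first moment over the strings between the layers *)

Section DoubleLayer.
Variables (R : realType) (N a b : nat).
Local Notation Site := (site (2 * N) a b).
Local Notation Gate := (site 2 a b).
Local Notation pstr Q := {ffun Q -> bool * bool}.
Local Notation cls := (clifford_class R (site 2 a b)).
Local Notation tau := (code_fraction R b).

Definition gate1 (i : 'I_N) : Gate -> Site := @gate_sites (2 * N) a b _ 2 (@layer1_bound N i).
Definition gate2 (i : 'I_N.-1) : Gate -> Site := @gate_sites (2 * N) a b _ 2 (@layer2_bound N i).

Lemma gate1_inj i j u v : gate1 i u = gate1 j v -> i = j /\ u = v.
Proof.
by apply: gate_sites_inj => {}i {}j y z y2 z2 E; apply/val_inj => /=; lia.
Qed.

Lemma gate2_inj i j u v : gate2 i u = gate2 j v -> i = j /\ u = v.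
Proof.
by apply: gate_sites_inj => {}i {}j y z y2 z2 E; apply/val_inj => /=; lia.
Qed.

Lemma gate1_covers (q : Site) : exists i u, q = gate1 i u.
Proof.
case: q => r c; have rN : (r./2 < N)%N by have := ltn_ord r; lia.
have r2 : (odd r < 2)%N by case: odd.
exists (Ordinal rN), (Ordinal r2, c); rewrite /gate1 /gate_sites /=; congr (_, _).
by apply/val_inj => /=; rewrite -{1}(odd_double_half r); lia.
Qed.

Variable p : R.
Hypotheses (p01 : 0 <= p <= 1) (xi0 : (0 < a + b)%N).
Local Notation alpha := (gate_damping p a b).

Definition action1 (V : {ffun 'I_N -> cls}) : pstr Site -> pstr Site :=
  layer_action gate1 (fun i => class_action (V i)).
Definition action2 (V : {ffun 'I_N.-1 -> cls}) : pstr Site -> pstr Site :=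
  layer_action gate2 (fun i => class_action (V i)).

Lemma restrict_action1 V h i :
  Defs.restrict (gate1 i) (action1 V h) = class_action (V i) (Defs.restrict (gate1 i) h).
Proof. exact: (restrict_layer_action gate1_inj). Qed.

Lemma restrict_action2 V h i :
  Defs.restrict (gate2 i) (action2 V h) = class_action (V i) (Defs.restrict (gate2 i) h).
Proof. exact: (restrict_layer_action gate2_inj). Qed.

Lemma double_layer_action V :
  conj_action (double_layer_circuit V) (action2 V.2 \o action1 V.1).
Proof.
apply: conj_action_comp; apply: layer_conj_action.
- exact: gate1_inj.
- by move=> i; exact: clifford_rep_action.
- exact: gate2_inj.
- by move=> i; exact: clifford_rep_action.
Qed.

Definition layer2_weight (h : pstr Site) : R :=
  (\prod_i (if Defs.restrict (gate2 i) h == 0 then 1 else alpha))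
  * \prod_(q | ~~ covered gate2 q) (if h q == 0 then 1 else p).

Lemma outer_weight_ge0 (h : pstr Site) :
  0 <= \prod_(q | ~~ covered gate2 q) (if h q == 0 then 1 else p).
Proof. by apply: prodr_ge0 => q _; case: ifP => // _; case/andP: p01. Qed.

Lemma layer2_weight_ge0 h : 0 <= layer2_weight h.
Proof.
apply: mulr_ge0; last exact: outer_weight_ge0.
by apply: prodr_ge0 => i _; case: ifP => // _; exact: gate_damping_ge0.
Qed.

Lemma average_layer2 (h : pstr Site) :
  uniform_average (fun V => pauli_weight p (action2 V h)) <= layer2_weight h.
Proof.
pose w := \prod_(q | ~~ covered gate2 q) (if h q == 0 then 1 else p).
rewrite (average_ext (G := fun V : {ffun 'I_N.-1 -> cls} => w *
    \prod_i pauli_weight p (class_action (V i) (Defs.restrict (gate2 i) h)))); last first.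
  move=> V; rewrite /pauli_weight (big_gates gate2_inj) mulrC; congr (_ * _).
    apply: eq_bigr => i _; apply: eq_bigr => u _.
    by rewrite -restrict_action2 [in RHS]ffunE.
  by apply: eq_bigr => q qN; rewrite /action2 layer_action_out.
rewrite averageZ (average_prod (fun i t => pauli_weight p (class_action t (Defs.restrict (gate2 i) h)))).
rewrite mulrC; apply: ler_wpM2r; first exact: outer_weight_ge0.
apply: ler_prod => i _; rewrite average_pauli_weight // andbT.
by rewrite divr_ge0 ?ler0n // sumr_ge0 // => t _; exact: pauli_weight_ge0.
Qed.

Lemma codelike_gates (g : pstr Site) :
  is_codelike g -> forall i, is_codelike (Defs.restrict (gate1 i) g).
Proof.
move=> /eqP/ffunP g0 i; apply/eqP/ffunP => -[r c]; rewrite !ffunE.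
have := g0 ((gate1 i (anc_sites a (r, c))).1, c); rewrite !ffunE.
by rewrite /anc_sites /gate1 /gate_sites.
Qed.

Lemma action1_eq V (g h : pstr Site) :
  ((action1 V g == h)%:R : R) =
  \prod_i (class_action (V i) (Defs.restrict (gate1 i) g) == Defs.restrict (gate1 i) h)%:R.
Proof.
rewrite prod_natb; congr (nat_of_bool _)%:R; apply/eqP/forallP => [<- i|E].
  by rewrite restrict_action1.
apply/ffunP => q; have [i [u ->]] := gate1_covers q.
have /eqP := E i; rewrite -restrict_action1 => /ffunP/(_ u).
by rewrite ffunE [in RHS]ffunE.
Qed.

Definition layer1_weight (h : pstr Site) : R :=
  \prod_i (if Defs.restrict (gate1 i) h == 0 then 1 else tau).

(** The expected number of codelike strings sent to h factorises, the gates being independent and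
    every restriction of a codelike string codelike. *)
Lemma average_layer1 (h : pstr Site) :
  \sum_(g | is_codelike g) uniform_average (fun V => (action1 V g == h)%:R) <= layer1_weight h.
Proof.
pose F (i : 'I_N) (u : pstr Gate) : R := (is_codelike u)%:R *
  uniform_average (fun t : cls => (class_action t u == Defs.restrict (gate1 i) h)%:R).
have avg0 i u : 0 <= uniform_average (fun t : cls =>
    (class_action t u == Defs.restrict (gate1 i) h)%:R) :> R.
  by rewrite divr_ge0 ?ler0n // sumr_ge0 // => t _; exact: ler0n.
have F0 i u : 0 <= F i u by rewrite mulr_ge0 ?ler0n.
apply: le_trans (_ : \sum_(g : pstr Site) \prod_i F i (Defs.restrict (gate1 i) g) <= _).
  rewrite big_mkcond; apply: ler_sum => g _; case: ifP => cg; last by rewrite prodr_ge0.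
  rewrite (average_ext (fun V => action1_eq V g h)).
  rewrite (average_prod (fun i t => (class_action t (Defs.restrict (gate1 i) g)
    == Defs.restrict (gate1 i) h)%:R)).
  rewrite (eq_bigr (fun i => F i (Defs.restrict (gate1 i) g))) // => i _.
  by rewrite /F codelike_gates // mul1r.
have := sum_gates gate1_inj F (fun (_ : Site) (_ : bool * bool) => 1).
have out1 (f : Site -> R) : \prod_(q | ~~ covered gate1 q) f q = 1.
  by apply: big_pred0 => q; have [i [u ->]] := gate1_covers q; rewrite covered_gate.
rewrite !out1 -mulr_suml !mulr1.
move=> ->.
apply: ler_prod => i _; rewrite sumr_ge0 //=.
apply: le_trans (@sum_code_average R _ _ xi0 (Defs.restrict (gate1 i) h)).
rewrite [leRHS]big_mkcond; apply: ler_sum => u _; rewrite /F.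
by case: ifP; rewrite ?mul1r ?mul0r.
Qed.

(** h is the string between the layers, nonzero because the first layer acts injectively. Summing
    over it separates the averages over the two layers. *)
Lemma average_uncorrectable :
  uniform_average (fun V : {ffun 'I_N -> cls} * {ffun 'I_N.-1 -> cls} =>
    \sum_(e | uncorrectable (action2 V.2 \o action1 V.1) e) weight p e) <=
  \sum_(h : pstr Site | h != 0) layer2_weight h * layer1_weight h.
Proof.
apply: le_trans (average_le (fun V => uncorrectable_weight_le p01 _)) _.
rewrite average_pair /=.
pose G (g h : pstr Site) (V1 : {ffun 'I_N -> cls}) : R :=
  if h != 0 then layer2_weight h * (action1 V1 g == h)%:R else 0.
apply: le_trans (_ : uniform_average (fun V1 : {ffun 'I_N -> cls} =>
    \sum_(g : pstr Site | is_codelike g && (g != 0)) \sum_(h : pstr Site) G g h V1) <= _).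
  apply: average_le => V1; rewrite average_sum; apply: ler_sum => g /andP[_ g0].
  apply: le_trans (average_layer2 _) _.
  have Ag : action1 V1 g != 0.
    have UM : conj_action (layer gate1 (fun i => clifford_rep (V1 i))) (action1 V1).
      by apply: layer_conj_action; [exact: gate1_inj | move=> i; exact: clifford_rep_action].
    apply: contra g0 => /eqP E; apply/eqP; apply: (conj_action_inj UM).
    by rewrite E (conj_action0 UM).
  rewrite (bigD1 (action1 V1 g)) //= {1}/G Ag eqxx mulr1 ler_wpDr // sumr_ge0 // => h _.
  by rewrite /G; case: ifP => // _; rewrite mulr_ge0 ?ler0n // layer2_weight_ge0.
rewrite average_sum.
rewrite (eq_bigr _ (fun g _ => average_sum xpredT (fun h => G g h))).
rewrite exchange_big /= [leRHS]big_mkcond; apply: ler_sum => h _; rewrite /G.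
case: ifP => _; last first.
  rewrite big1 // => g _; rewrite /uniform_average big1 ?mul0r //.
rewrite (eq_bigr _ (fun g _ => averageZ (layer2_weight h) (fun V1 => (action1 V1 g == h)%:R))).
rewrite -mulr_sumr; apply: ler_wpM2l; first exact: layer2_weight_ge0.
apply: le_trans (average_layer1 h).
rewrite big_mkcond [leRHS]big_mkcond; apply: ler_sum => g _.
case: (is_codelike g) => //=; case: ifP => // _.
by rewrite divr_ge0 ?ler0n // sumr_ge0 // => t _; exact: ler0n.
Qed.

(** The root of eta is at most (eta / delta + delta) / 2; this bound is affine in eta and so passes
    to the average. *)
Lemma expected_choi_double_le (delta : R) : 0 < delta ->
  expected_choi_double_layer p N a b <=
  ((\sum_(h : pstr Site | h != 0) layer2_weight h * layer1_weight h) / delta + delta) / 2.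
Proof.
move=> d0; rewrite /expected_choi_double_layer.
pose eta (V : {ffun 'I_N -> cls} * {ffun 'I_N.-1 -> cls}) : R :=
  \sum_(e | uncorrectable (action2 V.2 \o action1 V.1) e) weight p e.
have cardV : (0 < #|{: {ffun 'I_N -> cls} * {ffun 'I_N.-1 -> cls}}|)%N.
  by rewrite card_prod !card_ffun muln_gt0 !expn_gt0 !card_class_gt0.
apply: le_trans (_ : uniform_average (fun V => (2 * delta)^-1 * eta V + delta / 2) <= _).
  apply: average_le => V; apply: le_trans (choi_error_upper (double_layer_action V) p01) _.
  have e0 : 0 <= eta V by apply: sumr_ge0 => e _; exact: weight_ge0.
  rewrite -/(eta V); have := sqr_sqrtr e0; have := sqrtr_ge0 (eta V).
  move: (Num.sqrt (eta V)) => s s0 <-; rewrite invfM mulrC.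
  have -> : s ^+ 2 * (2^-1 * delta^-1) + delta / 2 = s + (s - delta) ^+ 2 / (2 * delta).
    by field; rewrite gt_eqF.
  by rewrite lerDl divr_ge0 ?sqr_ge0 // mulr_ge0 // ltW.
have -> : uniform_average (fun V => (2 * delta)^-1 * eta V + delta / 2) =
    (2 * delta)^-1 * uniform_average eta + delta / 2.
  rewrite -averageZ -[X in _ + X](average_const (delta / 2) cardV) /uniform_average.
  by rewrite -mulrDl big_split.
have := average_uncorrectable; rewrite -/eta => le.
have i0 : 0 <= (2 * delta)^-1 by rewrite invr_ge0 mulr_ge0 // ltW.
have := ler_wpM2l i0 le; rewrite invfM; set X := \sum_(h : pstr Site | h != 0) _.
have -> : (X / delta + delta) / 2 = 2^-1 * delta^-1 * X + delta / 2 by ring.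
by move=> h; rewrite lerD2r.
Qed.
End DoubleLayer.

(** * Transfer matrices with two states *)

Section Chain.
Variable R : realType.

Definition snoc (n : nat) (T : finType) (J : {ffun 'I_n.+1 -> T}) (y : T) :
    {ffun 'I_n.+2 -> T} :=
  [ffun i : 'I_n.+2 => if (i <= n)%N then J (inord i) else y].

Lemma sum_snoc (n : nat) (T : finType) (F : {ffun 'I_n.+2 -> T} -> R) :
  \sum_J F J = \sum_J \sum_y F (snoc J y).
Proof.
rewrite pair_bigA (reindex (fun u : {ffun 'I_n.+1 -> T} * T => snoc u.1 u.2)) //.
apply: onW_bij; exists (fun J : {ffun 'I_n.+2 -> T} => ([ffun i : 'I_n.+1 => J (inord i)], J ord_max)).
  move=> [J y] /=; congr (_, _); last by rewrite ffunE /= ltnn.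
  apply/ffunP => i; rewrite !ffunE inordK ?(ltn_trans (ltn_ord i)) //.
  by rewrite -ltnS ltn_ord inord_val.
move=> J /=; apply/ffunP => i; rewrite ffunE; case: leqP => ni.
  by rewrite ffunE; congr (J _); apply/val_inj; rewrite /= !inordK ?ltnS // ltnW.
by congr (J _); apply/val_inj => /=; have := ltn_ord i; lia.
Qed.

Fixpoint transfer (T : finType) (init : T -> R) (st : T -> T -> R) (n : nat) : T -> R :=
  if n is k.+1 then fun y => \sum_x transfer init st k x * st x y else init.

(** Induction on the length with [fin] arbitrary: the last bond is absorbed into the final
    factor. *)
Lemma chain_sum (T : finType) (init : T -> R) (st : T -> T -> R) (n : nat) (fin : T -> R) :
  \sum_(J : {ffun 'I_n.+1 -> T}) init (J (inord 0))
    * (\prod_(i < n) st (J (inord i)) (J (inord i.+1))) * fin (J (inord n))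
  = \sum_y transfer init st n y * fin y.
Proof.
elim: n fin => [|n IH] fin.
  rewrite (reindex (fun y : T => [ffun _ : 'I_1 => y])) /=.
    by apply: eq_bigr => y _; rewrite !ffunE big_ord0 mulr1.
  apply: onW_bij; exists (fun J : {ffun 'I_1 -> T} => J ord0) => [y|J].
    by rewrite ffunE.
  by apply/ffunP => i; rewrite ffunE (ord1 i).
rewrite sum_snoc.
have sn (J : {ffun 'I_n.+1 -> T}) y k : (k <= n)%N -> snoc J y (inord k) = J (inord k).
  by move=> kn; rewrite ffunE inordK ?ltnS ?(leq_trans kn) // kn.
transitivity (\sum_(J : {ffun 'I_n.+1 -> T}) init (J (inord 0))
    * (\prod_(i < n) st (J (inord i)) (J (inord i.+1)))
    * \sum_y st (J (inord n)) y * fin y).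
  apply: eq_bigr => J _; rewrite big_distrr /=; apply: eq_bigr => y _.
  rewrite sn // big_ord_recr /= sn //.
  have -> : snoc J y (inord n.+1) = y by rewrite ffunE inordK // ltnn.
  rewrite (eq_bigr (fun i : 'I_n => st (J (inord i)) (J (inord i.+1)))) => [|i _].
    by ring.
  by rewrite !sn // ltnW.
rewrite (IH (fun x => \sum_y st x y * fin y)) /=.
under eq_bigr do rewrite big_distrr /=.
rewrite exchange_big; apply: eq_bigr => y _.
by rewrite big_distrl /=; apply: eq_bigr => x _; rewrite mulrA.
Qed.

Section TwoState.
Variables (tau E B A' : R) (n : nat).
Hypotheses (tau0 : 0 <= tau) (E1 : 1 <= E) (B0 : 0 <= B) (B2 : B <= 2)
  (A0 : 0 <= A') (tauA : tau * A' <= 1 / 2).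

(** The state is the flag of a first-layer gate, [true] forcing the identity there. [bond] is the
    weight of the second-layer gate between two flags ([gate2_factor]), [end_cost] that of an outer
    region. *)
Definition bond (x y : bool) : R :=
  if x then (if y then 1 else B) else (if y then B else A').
Definition site_cost (x : bool) : R := if x then 1 else tau.
Definition end_cost (x : bool) : R := if x then 1 else E.

Local Notation v := (transfer (fun y => site_cost y * end_cost y)
  (fun x y => bond x y * site_cost y)).

Let P := expR (8 * tau * n%:R + 4 * tau * E).

Lemma transfer_true k : v k.+1 true = v k true + B * v k false.
Proof. by rewrite /= big_bool /site_cost /=; ring. Qed.

Lemma transfer_false k : v k.+1 false = tau * (B * v k true + A' * v k false).
Proof. by rewrite /= big_bool /site_cost /=; ring. Qed.

Lemma transfer_ge0 k : 0 <= v k true /\ 0 <= v k false.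
Proof.
elim: k => [|k [IH1 IH2]]; first by rewrite /= /site_cost /end_cost mulr1; split=> //; rewrite mulr_ge0 // (le_trans ler01 E1).
rewrite transfer_true transfer_false; split; first by rewrite addr_ge0 // mulr_ge0.
by rewrite mulr_ge0 // addr_ge0 // mulr_ge0.
Qed.

Let growth_ge0 : 0 <= 1 + 8 * tau.
Proof. by rewrite addr_ge0 // mulr_ge0. Qed.

Let E0 : 0 <= E.
Proof. exact: le_trans ler01 E1. Qed.

Let tE0 : 0 <= tau * E.
Proof. exact: mulr_ge0. Qed.

(** The weight 4 is tuned to B <= 2 and tau A' <= 1/2: a [false] amplitude y contributes at most 2 y
    + 4 (y / 2) = 4 y to the next potential, so growth comes only from 4 tau B <= 8 tau. *)
Lemma transfer_potential k :
  v k true + 4 * v k false <= (1 + 8 * tau) ^+ k * (1 + 4 * tau * E).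
Proof.
elim: k => [|k IH]; first by rewrite /= /site_cost /end_cost expr0; lra.
have [a0 b0] := transfer_ge0 k.
apply: le_trans (_ : (1 + 8 * tau) * (v k true + 4 * v k false) <= _).
  rewrite transfer_true transfer_false.
  move: (v k true) (v k false) a0 b0 {IH} => x y x0 y0.
  have h1 : B * y <= 2 * y by apply: ler_wpM2r.
  have h2 : tau * (B * x) <= tau * (2 * x) by apply: ler_wpM2l => //; apply: ler_wpM2r.
  have h3 : tau * A' * y <= 1 / 2 * y by apply: ler_wpM2r.
  have h4 : 0 <= tau * y by rewrite mulr_ge0.
  lra.
by rewrite exprS -mulrA; apply: ler_wpM2l.
Qed.

Lemma transfer_potential_le k : (k <= n)%N -> v k true + 4 * v k false <= P.
Proof.
move=> kn; apply: le_trans (transfer_potential k) _.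
rewrite /P expRD; apply: ler_pM.
- exact: exprn_ge0.
- by move: tE0; lra.
- apply: le_trans (_ : expR (8 * tau) ^+ k <= _).
    by apply: lerXn2r; rewrite ?nnegrE ?expR_ge0 ?expR_ge1Dx.
  rewrite -expRM_natr ler_expR; apply: ler_wpM2l; first exact: mulr_ge0.
  by rewrite ler_nat.
- exact: expR_ge1Dx.
Qed.

(** The bound is stable: tau A' <= 1/2 halves the previous value, which leaves room for the inflow 2
    tau P. Its factor tau is needed because the end of the chain multiplies this amplitude by the
    large E. *)
Lemma transfer_false_le k : (k <= n)%N -> v k false <= tau * (E + 4 * P).
Proof.
have P0 : 0 <= P by exact: expR_ge0.
elim: k => [|k IH] kn; first by rewrite /= /site_cost /end_cost ler_wpM2l // lerDl mulr_ge0.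
have [a0 b0] := transfer_ge0 k; have := IH (ltnW kn).
have := transfer_potential_le (ltnW kn); rewrite transfer_false.
move: (v k true) (v k false) a0 b0 => x y x0 y0 hP hy.
have xP : x <= P by lra.
have h2 : tau * (B * x) <= tau * (2 * P).
  by apply: ler_wpM2l => //; apply: ler_pM.
have h3 : tau * A' * y <= 1 / 2 * y by apply: ler_wpM2r.
have h4 : 0 <= tau * E := tE0.
lra.
Qed.

Lemma chain_bound : \sum_y v n y * end_cost y <= P + tau * E * (E + 4 * P).
Proof.
have [a0 b0] := transfer_ge0 n.
rewrite big_bool /= /end_cost mulr1.
have h1 := transfer_potential_le (leqnn n); have h2 := transfer_false_le (leqnn n).
move: (v n true) (v n false) a0 b0 h1 h2 => x y x0 y0 h1 h2.
have h3 : y * E <= tau * (E + 4 * P) * E by apply: ler_wpM2r.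
lra.
Qed.

Lemma chain_bound_linear : 8 * tau * n%:R + 4 * tau * E ^+ 2 <= 1 / 2 ->
  \sum_y v n y * end_cost y - 1 <= 16 * tau * n%:R + 17 * tau * E ^+ 2.
Proof.
have := chain_bound; have : 0 <= P by exact: expR_ge0.
have : tau * E <= tau * E ^+ 2 by apply: ler_wpM2l => //; rewrite expr2 ler_peMr.
have : 0 <= tau * n%:R by rewrite mulr_ge0.
rewrite /P; move: tE0; move: (\sum_y _) => S.
have -> : tau * E * (E + 4 * expR (8 * tau * n%:R + 4 * tau * E)) =
  tau * E ^+ 2 + 4 * (tau * E * expR (8 * tau * n%:R + 4 * tau * E)) by ring.
rewrite -!(mulrA _ tau).
move: (tau * E) (tau * n%:R) (tau * E ^+ 2) => x y z x0 y0 xz.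
have : expR (8 * y + 4 * x) <= expR (8 * y + 4 * z) by rewrite ler_expR; lra.
(* With s = 8 y + 4 z <= 1/2 this gives exp s <= 1 + 2 s. The constants are then 16 = 2 * 8 and 17 =
   2 * 4 + 1 + 4 * 2. *)
have : (1 - (8 * y + 4 * z)) * expR (8 * y + 4 * z) <= 1.
  rewrite -[leRHS](expRxMexpNx_1 (8 * y + 4 * z)) mulrC ler_pM2l ?expR_gt0 //.
  by have := expR_ge1Dx (- (8 * y + 4 * z)).
move: (expR (8 * y + 4 * x)) (expR _) => e f h1 h2 e0 hS s2.
have f2 : f <= 2 by nra.
have f1 : f <= 1 + 2 * (8 * y + 4 * z) by nra.
have : x * e <= z * 2 by apply: ler_pM => //; lra.
lra.
Qed.
End TwoState.
End Chain.

(** * The sum over intermediate strings as a chain of flags *)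

Section DoubleLayerSum.
Variables (R : realType) (p : R) (n a b : nat).
Hypotheses (p01 : 0 <= p <= 1) (xi0 : (0 < a + b)%N).
Local Notation Site := (site (2 * n.+1) a b).
Local Notation Gate := (site 2 a b).
Local Notation pstr Q := {ffun Q -> bool * bool}.
Local Notation xi := (a + b)%N.
Local Notation alpha := (gate_damping p a b).
Local Notation tau := (code_fraction R b).
Local Notation gate1 := (@gate1 n.+1 a b).
Local Notation gate2 := (@gate2 n.+1 a b).
Local Notation flags := {ffun 'I_n.+1 -> bool}.

Definition gate1_index (q : Site) : 'I_n.+1 := inord (q.1)./2.

Lemma gate1_indexE i u : gate1_index (gate1 i u) = i.
Proof.
case: u => x c; apply/val_inj; rewrite /gate1_index /gate1 /gate_sites /=.
by have := ltn_ord x; have := ltn_ord i => iN xN; rewrite inordK; lia.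
Qed.

(** Written over sites so that it can be regrouped along the second-layer gates; [identity_onE] is
    the grouping along the first layer. *)
Definition identity_on (J : flags) (h : pstr Site) : R :=
  \prod_q (J (gate1_index q) ==> (h q == 0))%:R.

Lemma identity_onE (J : flags) h :
  identity_on J h = \prod_i (J i ==> (Defs.restrict (gate1 i) h == 0))%:R.
Proof.
rewrite /identity_on !prod_natb; congr (nat_of_bool _)%:R.
apply/forallP/forallP => H.
  move=> i; apply/implyP => Ji; apply/eqP/ffunP => u; rewrite !ffunE.
  by have /implyP := H (gate1 i u); rewrite gate1_indexE => /(_ Ji)/eqP.
move=> q; have [i [u ->]] := gate1_covers q; rewrite gate1_indexE.
apply/implyP => Ji; have /implyP/(_ Ji)/eqP/ffunP/(_ u) := H i.
by rewrite !ffunE => ->.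
Qed.

Lemma identity_on_ge0 J h : 0 <= identity_on J h.
Proof. by apply: prodr_ge0 => q _; exact: ler0n. Qed.

Lemma tau_ge0 : 0 <= tau.
Proof. by rewrite invr_ge0 exprn_ge0. Qed.

Lemma site_cost_ge0 x : 0 <= site_cost tau x.
Proof. by rewrite /site_cost; case: x => //; exact: tau_ge0. Qed.

(* Each factor [1 or tau] of the first layer is the sum over a flag of
   [(1 - tau) [h = 0 on the gate]] and [tau]; when all flags are raised the
   product vanishes because [h != 0]. *)
Lemma layer1_weight_le (h : pstr Site) : h != 0 ->
  @layer1_weight R n.+1 a b h <=
  \sum_(J : flags | J != [ffun=> true]) (\prod_i site_cost tau (J i)) * identity_on J h.
Proof.
move=> h0; pose F i (c : bool) : R :=
  if c then (1 - tau) * (Defs.restrict (gate1 i) h == 0)%:R else tau.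
have tau1 : tau <= 1 by rewrite /code_fraction invf_le1 ?exprn_gt0 // exprn_ege1 // ler1n.
have F0 i c : 0 <= F i c.
  by case: c; rewrite /F ?tau_ge0 // mulr_ge0 ?ler0n // subr_ge0.
have -> : @layer1_weight R n.+1 a b h = \prod_i \sum_c F i c.
  apply: eq_bigr => i _; rewrite big_bool /F /=.
  by case: eqP => _; rewrite ?mulr1 ?mulr0 ?subrK ?add0r.
rewrite bigA_distr_bigA (bigD1 [ffun=> true]) //=.
rewrite [X in X + _](_ : _ = 0) ?add0r; last first.
  have /existsP[i hi] : [exists i, Defs.restrict (gate1 i) h != 0].
    apply: contraR h0 => /existsPn H; apply/eqP/ffunP => q.
    have [i [u ->]] := gate1_covers q; have /negbNE/eqP/ffunP/(_ u) := H i.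
    by rewrite !ffunE.
  by rewrite (bigD1 i) //= ffunE /F (negbTE hi) mulr0 mul0r.
apply: ler_sum => J _; rewrite identity_onE -big_split /=; apply: ler_prod => i _.
rewrite F0 /F /site_cost; case: (J i) => /=; last by rewrite mulr1.
by rewrite mul1r ler_piMl ?ler0n // lerBlDr lerDl tau_ge0.
Qed.

Local Notation B := (alpha * 4 ^+ xi + (1 - alpha)).
Local Notation A' := (alpha * 16 ^+ xi + (1 - alpha)).
Local Notation E := ((1 + 3 * p) ^+ xi).

Lemma sum_implies0 (j : bool) : \sum_(c : bool * bool) (j ==> (c == 0))%:R = (if j then 1 else 4) :> R.
Proof. by rewrite sum_pair !big_bool /=; case: j; rewrite /= ; ring. Qed.

Lemma sum_damped_implies0 (j : bool) :
  \sum_(c : bool * bool) (if c == 0 then 1 else p) * (j ==> (c == 0))%:R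
  = (if j then 1 else 1 + 3 * p) :> R.
Proof. by rewrite sum_pair !big_bool /=; case: j; rewrite /= ; ring. Qed.

(** Writing the damping as alpha + (1 - alpha) [u = 0], the sum is 1 - alpha plus alpha times the
    number of strings vanishing on the flagged halves, which is 1, 4^xi or 16^xi. *)
Lemma gate2_factor (j : 'I_2 -> bool) :
  \sum_(u : pstr Gate) (if u == 0 then 1 else alpha) * \prod_v (j v.1 ==> (u v == 0))%:R
  = bond B A' (j ord0) (j ord_max).
Proof.
have Z : \sum_(u : pstr Gate) \prod_v (j v.1 ==> (u v == 0))%:R =
    (if j ord0 then 1 else 4 ^+ xi) * (if j ord_max then 1 else 4 ^+ xi) :> R.
  rewrite -(bigA_distr_bigA (fun (v : Gate) (c : bool * bool) => (j v.1 ==> (c == 0))%:R : R)).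
  rewrite (eq_bigr (fun v : Gate => if j v.1 then 1 else 4)) => [|v _]; last exact: sum_implies0.
  rewrite -(pair_bigA _ (fun (x : 'I_2) (_ : 'I_xi) => if j x then 1 else 4 : R)) /=.
  rewrite big_ord_recl big_ord1 !prodr_const card_ord.
  have -> : lift ord0 ord0 = ord_max :> 'I_2 by exact/val_inj.
  by case: (j ord0); case: (j ord_max); rewrite ?expr1n.
have -> : \sum_(u : pstr Gate) (if u == 0 then 1 else alpha) * \prod_v (j v.1 ==> (u v == 0))%:R
    = alpha * (\sum_(u : pstr Gate) \prod_v (j v.1 ==> (u v == 0))%:R) + (1 - alpha).
  rewrite (bigD1 (0 : pstr Gate)) //= eqxx [in RHS](bigD1 (0 : pstr Gate)) //=.
  have -> : \prod_v (j v.1 ==> ((0 : pstr Gate) v == 0))%:R = 1 :> R.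
    by apply: big1 => v _; rewrite ffunE eqxx implybT.
  rewrite mulr1 mulrDr mulr1 addrAC [alpha + _]addrC subrK; congr (_ + _).
  by rewrite big_distrr /=; apply: eq_bigr => u /negbTE ->.
rewrite Z /bond; case: (j ord0); case: (j ord_max); rewrite ?mulr1 ?mul1r //; last first.
  by rewrite -exprMn -natrM.
by rewrite addrC subrK.
Qed.

Lemma covered_gate2 (q : Site) : covered gate2 q = (0 < q.1 < (2 * n).+1)%N.
Proof.
apply/existsP/idP => [[i /fintype.imageP[u _ ->]]|].
  rewrite /gate2 /gate_sites /=; have := ltn_ord u.1; have := ltn_ord i; rewrite /=; lia.
case: q => r c /= rn; have iN : ((r.-1)./2 < n.+1.-1)%N by lia.
have r2 : (odd r.-1 < 2)%N by case: odd.
exists (Ordinal iN); apply/fintype.imageP; exists (Ordinal r2, c) => //.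
rewrite /gate2 /gate_sites /=; congr (_, _); apply/val_inj => /=.
by have := odd_double_half r.-1; rewrite -muln2; lia.
Qed.

Lemma outer_factor (J : flags) :
  \prod_(q : Site | ~~ covered gate2 q) (if J (gate1_index q) then 1 else 1 + 3 * p)
  = end_cost E (J (inord 0)) * end_cost E (J (inord n)) :> R.
Proof.
have l0 : (0 < 2 * n.+1)%N by [].
have l1 : ((2 * n).+1 < 2 * n.+1)%N by lia.
pose K (r : 'I_(2 * n.+1)) : R := if J (inord r./2) then 1 else 1 + 3 * p.
transitivity (\prod_(r : 'I_(2 * n.+1) | (r == Ordinal l0) || (r == Ordinal l1))
    \prod_(c : 'I_xi) K r).
  rewrite pair_big /=; apply: eq_bigl => -[r c]; rewrite covered_gate2 andbT /=.
  by rewrite -!val_eqE /=; have := ltn_ord r; lia.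
rewrite (bigD1 (Ordinal l0)) ?eqxx //= (bigD1 (Ordinal l1)) /=; last first.
  by rewrite eqxx.
rewrite [X in _ * (_ * X)]big_pred0 ?mulr1 => [|r]; last first.
  by case: (r == Ordinal l0) => //=; case: (r == Ordinal l1).
rewrite !prodr_const card_ord /K /end_cost /= mul2n uphalf_double.
by case: (J _); case: (J _); rewrite ?expr1n.
Qed.

(** For fixed flags the sum over h factorises: second-layer gate i joins the right region of
    first-layer gate i to the left region of gate i + 1, and the two outer regions remain. *)
Lemma layer2_identity_sum (J : flags) :
  \sum_h layer2_weight p h * identity_on J h =
  (\prod_(i < n) bond B A' (J (inord i)) (J (inord i.+1)))
  * (end_cost E (J (inord 0)) * end_cost E (J (inord n))).
Proof.
pose F (i : 'I_n.+1.-1) (u : pstr Gate) : R := (if u == 0 then 1 else alpha) *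
  \prod_(v : Gate) (J (inord (i + v.1)) ==> (u v == 0))%:R.
pose G (q : Site) (c : bool * bool) : R :=
  (if c == 0 then 1 else p) * (J (gate1_index q) ==> (c == 0))%:R.
transitivity (\sum_h (\prod_i F i (Defs.restrict (gate2 i) h))
    * \prod_(q : Site | ~~ covered gate2 q) G q (h q)).
  apply: eq_bigr => h _; rewrite /identity_on (big_gates (@gate2_inj n.+1 a b)).
  rewrite /layer2_weight mulrACA -!big_split /=; congr (_ * _).
  apply: eq_bigr => i _; congr (_ * _); apply: eq_bigr => v _; rewrite [in RHS]ffunE.
  (* Region 2 i + 1 + v, for v = 0 or 1, belongs to first-layer gate i + v. *)
  congr (nat_of_bool (J _ ==> _))%:R; apply/val_inj.
  rewrite /= !inordK //=; have := ltn_ord v.1; have := ltn_ord i; rewrite /=; lia.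
rewrite (sum_gates (@gate2_inj n.+1 a b)); congr (_ * _).
  apply: eq_bigr => i _; rewrite (gate2_factor (fun x => J (inord (i + x)))).
  by rewrite addn0 addn1.
rewrite -outer_factor; apply: eq_bigr => q _; exact: sum_damped_implies0.
Qed.

Lemma double_layer_sum_le :
  alpha * 4 ^+ xi <= 1 -> tau * A' <= 1 / 2 ->
  8 * tau * n%:R + 4 * tau * E ^+ 2 <= 1 / 2 ->
  \sum_(h : pstr Site | h != 0) layer2_weight p h * @layer1_weight R n.+1 a b h
    <= 16 * tau * n%:R + 17 * tau * E ^+ 2.
Proof.
move=> Bh Ah sh; have /andP[p0 p1] := p01.
have al0 : 0 <= alpha by exact: gate_damping_ge0.
have al1 : alpha <= 1 by exact: gate_damping_le1.
have E1 : 1 <= E by apply: exprn_ege1; lra.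
have B0 : 0 <= B by rewrite addr_ge0 ?subr_ge0 // mulr_ge0 // exprn_ge0.
have B2 : B <= 2 by lra.
have A0 : 0 <= A' by rewrite addr_ge0 ?subr_ge0 // mulr_ge0 // exprn_ge0.
pose Z (J : flags) := \sum_h layer2_weight p h * ((\prod_i site_cost tau (J i)) * identity_on J h).
have ZE J : Z J = site_cost tau (J (inord 0)) * end_cost E (J (inord 0)) *
    (\prod_(i < n) (bond B A' (J (inord i)) (J (inord i.+1)) * site_cost tau (J (inord i.+1))))
    * end_cost E (J (inord n)).
  rewrite /Z (eq_bigr (fun h => (\prod_i site_cost tau (J i)) *
      (layer2_weight p h * identity_on J h))) => [|h _]; last by rewrite mulrCA.
  rewrite -big_distrr /= layer2_identity_sum big_split /= big_ord_recl.
  have -> : \prod_(i < n) site_cost tau (J (lift ord0 i)) = \prod_(i < n) site_cost tau (J (inord i.+1)).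
    by apply: eq_bigr => i _; congr (site_cost _ (J _)); apply/val_inj; rewrite /= inordK // ltnS.
  have -> : ord0 = inord 0 :> 'I_n.+1 by apply/val_inj; rewrite /= inordK.
  by ring.
apply: le_trans (_ : \sum_(J : flags | J != [ffun=> true]) Z J <= _).
  rewrite /Z exchange_big /= big_mkcond; apply: ler_sum => h _; case: ifP => [h0|_].
    by rewrite -big_distrr /=; apply: ler_wpM2l (layer1_weight_le h0); exact: layer2_weight_ge0.
  apply: sumr_ge0 => J _; rewrite mulr_ge0 ?layer2_weight_ge0 // mulr_ge0 ?identity_on_ge0 //.
  by apply: prodr_ge0 => i _; exact: site_cost_ge0.
(* With all flags raised every factor of the chain is 1: this is the identity string, removed
   exactly. *)
have -> : \sum_(J : flags | J != [ffun=> true]) Z J = \sum_J Z J - 1.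
  rewrite [in RHS](bigD1 [ffun=> true]) //= [X in _ = X + _ - _](_ : _ = 1).
    by rewrite addrC addKr.
  by rewrite ZE !ffunE /= !mul1r mulr1 big1 // => i _; rewrite !ffunE /= mulr1.
rewrite (eq_bigr _ (fun J _ => ZE J)).
rewrite (chain_sum (fun y => site_cost tau y * end_cost E y)
  (fun x y => bond B A' x y * site_cost tau y)).
exact: (chain_bound_linear tau_ge0 E1 B0 B2 A0 Ah sh).
Qed.
End DoubleLayerSum.

(** * The regime separating the two ensembles *)

Section Regime.
Variable R : realType.

Definition regime_scale (n : nat) : nat := (trunc_log 2 n %/ 3).+1.

(* With xi = 4 u this makes n lie between 2^(3 u - 3) and 2^(3 u), i.e. n is of
   order 2^(3 xi / 4) and eps of order 2^(- xi / 4). *)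
Definition regime_eps (n : nat) : R :=
  if n == 0 then 1 / 2 else n%:R / 2 ^+ (4 * regime_scale n).

Lemma regime_scale_bounds n : (0 < n)%N ->
  (2 ^ (3 * regime_scale n) <= 8 * n)%N /\ (n < 2 ^ (3 * regime_scale n))%N.
Proof.
move=> n0; have := trunc_log_bounds (isT : (1 < 2)%N) n0 => /andP[lo hi]; split.
  rewrite /regime_scale mulnS expnD leq_pmul2l //.
  by apply: leq_trans lo; rewrite leq_exp2l // mulnC leq_divM.
apply: leq_trans hi _; rewrite leq_exp2l // /regime_scale mulnC.
by have := ltn_ceil (trunc_log 2 n) (isT : (0 < 3)%N).
Qed.

Lemma regime_eps_bounds n : 0 < regime_eps n < 1.
Proof.
rewrite /regime_eps; case: eqP => [_|/eqP]; first by apply/andP; split; lra.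
rewrite -lt0n => n0; have [_ hi] := regime_scale_bounds n0.
rewrite divr_gt0 ?ltr0n ?exprn_gt0 //= ltr_pdivrMr ?exprn_gt0 // mul1r -natrX ltr_nat.
by apply: leq_trans hi _; rewrite leq_exp2l // leq_mul.
Qed.

Lemma log2_pow2 m : log2 (2 ^+ m : R) = m%:R.
Proof. by rewrite /log2 lnXn // -[ln 2 *+ m]mulr_natl mulfK // gt_eqF // ln2_gt0. Qed.

Lemma regime_ratio n : (0 < n)%N -> n%:R / regime_eps n = 2 ^+ (4 * regime_scale n).
Proof.
move=> n0; have nn : n%:R != 0 :> R by rewrite pnatr_eq0 -lt0n.
by rewrite /regime_eps gtn_eqF // invf_div mulrCA divff // mulr1.
Qed.

Lemma regime_admissible n k N a b :
  admissible n k N a b (regime_eps n) -> k%:R / n%:R = 1 / 2 :> R ->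
  [/\ (0 < n)%N, (0 < N <= n)%N, a = (2 * regime_scale n)%N & b = (2 * regime_scale n)%N].
Proof.
move=> [[n0 _] _ nE kE xiE] rE.
have abE : (a + b = 4 * regime_scale n)%N.
  by apply/eqP; rewrite -(eqr_nat R) xiE regime_ratio // log2_pow2.
have nn : n%:R != 0 :> R by rewrite pnatr_eq0 -lt0n.
have kn : (2 * k = n)%N.
  apply/eqP; rewrite -(eqr_nat R) natrM; apply/eqP.
  have -> : k%:R = k%:R / n%:R * n%:R :> R by rewrite divfK.
  by rewrite rE; lra.
have aE : (a + b = 2 * a)%N.
  apply/eqP; rewrite -(@eqn_pmul2l k); last by lia.
  by rewrite kE -kn; apply/eqP; lia.
split=> //; [|lia|lia]; rewrite nE lt0n; case: N nE {xiE} => [|N] nE; first by move: n0; rewrite nE.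
by rewrite abE mulnAC leq_pmull.
Qed.

(** With u a power of two, n = 2^(3 u - 1) has scale u and is divisible by 2 * (4 u) with an even
    quotient, so both are powers of two and all parameters are integers. *)
Lemma regime_unbounded (n0 : nat) : exists n k N a b : nat,
  [/\ (n0 <= n)%N, admissible n k N a b (regime_eps n) & k%:R / n%:R = 1 / 2 :> R].
Proof.
pose w := n0.+1; pose u := (2 ^ w)%N.
have wu : (w < u)%N by exact: ltn_expl.
pose n := (2 ^ (3 * u - 1))%N; have n_gt0 : (0 < n)%N by rewrite expn_gt0.
have scale : regime_scale n = u.
  rewrite /regime_scale /n trunc_expnK //.
  rewrite (_ : (3 * u - 1) = u.-1 * 3 + 2)%N; last by lia.
  by rewrite divnMDl // addn0 prednK // (leq_ltn_trans _ wu).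
have kn : (2 * 2 ^ (3 * u - 2) = n)%N by rewrite -expnS /n; congr (2 ^ _)%N; lia.
have [N [Nodd NE]] : exists N, ~~ odd N /\ n = (2 * N * (4 * u))%N.
  exists (2 ^ (3 * u - 4 - w))%N; split.
    by rewrite oddX negb_or; apply/andP; split=> //; rewrite -lt0n; lia.
  rewrite [in (4 * u)%N]/u (_ : 4 = 2 ^ 2)%N // -!(expnD, expnS) /n.
  by rewrite (_ : 2 ^ 2 = 4)%N //; congr (2 ^ _)%N; lia.
exists n, (2 ^ (3 * u - 2))%N, N, (2 * u)%N, (2 * u)%N; split.
- apply: leq_trans (ltnW (ltn_expl (3 * u - 1) (isT : (1 < 2)%N))); lia.
- split=> //; first by split=> //; case/andP: (regime_eps_bounds n).
  + by rewrite NE; congr (_ * _)%N; lia.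
  + by rewrite -kn; lia.
  + by rewrite regime_ratio // log2_pow2 scale; congr _%:R; lia.
- by rewrite -kn natrM; field; rewrite pnatr_eq0 -lt0n expn_gt0.
Qed.

Lemma regime_scale_ge u n : (2 ^ (3 * u) <= n)%N -> (u <= regime_scale n)%N.
Proof.
move=> un; have n0 : (0 < n)%N by apply: leq_trans un; rewrite expn_gt0.
have [_ hi] := regime_scale_bounds n0.
by have := leq_ltn_trans un hi; rewrite ltn_exp2l // => h; lia.
Qed.

(** 8 D = 2 - 6 log2 (7/6), so the claim is 2^5 < (7/6)^24. It is split at 5/2 to keep the powers
    small: (7/6)^6 >= 5/2 and (5/2)^4 > 2^5. *)
Lemma relative_entropy_quarter : 8 * relative_entropy (1 / 4) (1 / 8) < 3 / 4 :> R.
Proof.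
have l2 := ln2_gt0 R.
have -> : relative_entropy (1 / 4) (1 / 8) = 1 / 4 - 3 / 4 * (ln (7 / 6) / ln 2) :> R.
  rewrite /relative_entropy /log2 (_ : 1 / 4 / (1 / 8) = 2); last by field.
  rewrite (_ : (1 - 1 / 4) / (1 - 1 / 8) = (7 / 6)^-1); last by field.
  by rewrite lnV ?posrE ?divr_gt0 //; field; rewrite gt_eqF.
suff : 5 < 24 * (ln (7 / 6) / ln 2) :> R by lra.
rewrite mulrA ltr_pdivlMr //.
have lnX m (x : R) : 0 < x -> m%:R * ln x = ln (x ^+ m).
  by move=> x0; rewrite lnXn // mulr_natl.
have h1 : ln (5 / 2) <= 6 * ln (7 / 6) :> R.
  by rewrite lnX ?divr_gt0 // ler_ln ?posrE ?divr_gt0 ?exprn_gt0 //; lra.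
have h2 : 5 * ln 2 < 4 * ln (5 / 2) :> R.
  by rewrite !lnX ?divr_gt0 // ltr_ln ?posrE ?divr_gt0 ?exprn_gt0 //; lra.
lra.
Qed.

Lemma regime_block : exists c : R, 0 < c /\ exists n0 : nat,
  forall n k N a b : nat, (n0 <= n)%N ->
    admissible n k N a b (regime_eps n) -> k%:R / n%:R = 1 / 2 :> R ->
    c <= expected_choi_block (1 / 8) N a b.
Proof.
(* 1/8 is the lower bound of n 2^(-3 u) from [regime_scale_bounds]; it lies below the constant 1/4
   of [block_choi_lower]. *)
exists (1 / 8); split; first by lra.
have := relative_entropy_quarter; set D := relative_entropy _ _ => D34.
have p0 : 0 < 1 / 8 :> R by lra.
(* This gap absorbs the correction to the exponent once xi is large. *)
have m0 : 0 < 3 / 4 - 8 * D by rewrite subr_gt0.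
have /cvgrPdist_lt/(_ _ m0)[xi1 _ xi1P] := tail_correction_cvg p0.
exists (2 ^ (3 * xi1))%N => n k N a b n_ge adm rE.
have [n0 _ aE bE] := regime_admissible adm rE.
have u_ge := regime_scale_ge n_ge.
have o_lt : tail_correction (1 / 8) (a + b) < 3 / 4 - 8 * D.
  have := xi1P (a + b)%N; rewrite /= aE bE => /(_ ltac:(lia)).
  by rewrite sub0r normrN; exact/le_lt_trans/ler_norm.
have h18 : 0 < (1 / 8 : R) < 1 by apply/andP; split; lra.
have := @block_choi_lower R (1 / 8) (1 / 2) h18 ltac:(lra) ltac:(lra) n k N a b _ adm rE.
apply: le_trans; rewrite rE (_ : (1 - 1 / 2) / 2 = 1 / 4); last by lra.
rewrite -/D le_min; apply/andP; split; last by lra.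
have nn : 0 < n%:R :> R by rewrite ltr0n.
rewrite -[regime_eps n / n%:R]invf_div regime_ratio // -exprVn.
set e := 8 * D + _; have e34 : e <= 3 / 4 by rewrite /e; lra.
have le1 : (2^-1 : R) ^+ (4 * regime_scale n) <= 1 by apply: exprn_ile1; lra.
have gt0 : 0 < (2^-1 : R) ^+ (4 * regime_scale n) by rewrite exprn_gt0 // invr_gt0.
apply: le_trans (_ : n%:R * ((2^-1 : R) ^+ (4 * regime_scale n)) `^ (3 / 4) <= _); last first.
  by apply: ler_wpM2l; [exact: ltW | rewrite ger_powR // gt0 le1].
rewrite -powR_mulrn ?invr_ge0 // -powRrM natrM (_ : 4 * _ * (3 / 4) = (3 * regime_scale n)%:R); last first.
  by rewrite natrM; field.
rewrite powR_mulrn ?invr_ge0 // exprVn -natrX ler_pdivlMr ?ltr0n ?expn_gt0 //.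
have [lo _] := regime_scale_bounds n0; move: lo; rewrite -(ler_nat R) natrM; lra.
Qed.

(** Here tau = 2^(-4 u). The number y bounds both tau m <= 2^(-u) and tau E^2 = (121/128)^(4 u), as
    (11/8)^2 / 2 = 121/128; the result is 16 y + 17 y, and y <= 1/24 gives 8 y + 4 y <= 1/2. *)
Lemma regime_sum_le (m u : nat) : (m <= 2 ^ (3 * u))%N -> (0 < u)%N ->
  let y : R := (121 / 128) ^+ u in y <= 1 / 24 ->
  \sum_(h : {ffun site (2 * m.+1) (2 * u) (2 * u) -> bool * bool} | h != 0)
    layer2_weight (1 / 8) h * layer1_weight R h <= 33 * y.
Proof.
move=> mu u0 y y24.
have y0 : 0 <= y by rewrite exprn_ge0 // divr_ge0.
have xiE : (2 * u + 2 * u = 4 * u)%N by lia.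
have xi0 : (0 < 4 * u)%N by rewrite muln_gt0.
have p01 : 0 <= (1 / 8 : R) <= 1 by apply/andP; split; lra.
pose tau : R := code_fraction R (2 * u).
have tauE : tau = 2^-1 ^+ (4 * u) by rewrite /tau /code_fraction exprVn mulnA.
have tau0 : 0 <= tau by exact: tau_ge0.
have half_y : (2^-1 : R) ^+ u <= y by apply: lerXn2r; rewrite ?nnegrE; lra.
have tau_y : tau <= y.
  apply: le_trans half_y; rewrite tauE; apply: ler_wiXn2l; [lra|lra|lia].
have taum : tau * m%:R <= y.
  apply: le_trans half_y; apply: le_trans (_ : tau * (2 ^+ (3 * u)) <= _).
    by apply: ler_wpM2l => //; rewrite -natrX ler_nat.
  rewrite tauE (_ : 4 * u = u + 3 * u)%N; last by lia.
  by rewrite exprD -mulrA -exprMn mulVf ?expr1n ?mulr1 // pnatr_eq0.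
have tauE2 : tau * (((1 + 3 * (1 / 8)) ^+ (4 * u)) ^+ 2) <= y.
  rewrite tauE exprAC -exprMn.
  rewrite (_ : 2^-1 * (1 + 3 * (1 / 8)) ^+ 2 = 121 / 128); last by field.
  by apply: ler_wiXn2l; [lra|lra|lia].
(* Hence alpha 16^xi = E^2, and the condition on the [false]-[false] bond reduces to the bounds on
   tau E^2 and tau. *)
have al : gate_damping (1 / 8) (2 * u) (2 * u) =
    ((1 + 3 * (1 / 8)) ^+ (4 * u)) ^+ 2 / 16 ^+ (4 * u) :> R.
  by rewrite /gate_damping xiE exprAC !exprM; congr (_ / _ ^+ _); ring.
have p16 : 0 < 16 ^+ (4 * u) :> R by rewrite exprn_gt0.
have := @double_layer_sum_le R (1 / 8) m (2 * u) (2 * u) p01; rewrite xiE -/tau al divfK ?gt_eqF //.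
set E2 := _ ^+ 2 in tauE2 *; set alpha := E2 / _ => H.
have E20 : 0 <= E2 by rewrite exprn_ge0.
have al0 : 0 <= alpha by rewrite divr_ge0 // ltW.
have tau_al : 0 <= tau * alpha by rewrite mulr_ge0.
have h1 : alpha * 4 ^+ (4 * u) <= 1.
  rewrite /alpha -mulrA -exprVn -exprMn /E2 exprAC -exprMn.
  by apply: exprn_ile1; lra.
have h2 : tau * (E2 + (1 - alpha)) <= 1 / 2 by rewrite mulrDr mulrBr mulr1; lra.
have h3 : 8 * tau * m%:R + 4 * tau * E2 <= 1 / 2 by rewrite -!(mulrA _ tau); lra.
have := H xi0 h1 h2 h3; move: (\sum_(h | _) _) => S; rewrite -!(mulrA _ tau); lra.
Qed.

Lemma regime_double (delta : R) : 0 < delta -> exists n0 : nat,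
  forall n k N a b : nat, (n0 <= n)%N ->
    admissible n k N a b (regime_eps n) -> k%:R / n%:R = 1 / 2 :> R ->
    `|expected_choi_double_layer (1 / 8) N a b| < delta.
Proof.
(* (33 y / delta + delta) / 2 < delta amounts to 33 y < delta^2, which y < delta^2 / 34 ensures;
   1/24 is the requirement of [regime_sum_le]. *)
move=> d0; pose d : R := Num.min (1 / 24) (delta ^+ 2 / 34).
have dd0 : 0 < d by rewrite lt_min; apply/andP; split; rewrite ?divr_gt0 ?exprn_gt0.
have y1 : `|121 / 128 : R| < 1 by rewrite ger0_norm; lra.
have /cvgrPdist_lt/(_ _ dd0)[u1 _ u1P] := cvg_expr y1.
exists (2 ^ (3 * u1))%N => n k N a b n_ge adm rE.
have [n0 /andP[N0 Nn] -> ->] := regime_admissible adm rE.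
have u_ge := regime_scale_ge n_ge; have [_ hi] := regime_scale_bounds n0.
move: (regime_scale n) u_ge hi => u u_ge hi.
have := u1P u u_ge; rewrite /= sub0r normrN ger0_norm ?exprn_ge0 ?divr_ge0 //.
rewrite lt_min => /andP[/ltW y24 yd].
have u0 : (0 < u)%N.
  by rewrite lt0n; apply: contraTneq y24 => ->; rewrite expr0 -ltNge; lra.
case: N N0 Nn {adm} => // m _ mn.
have mu : (m <= 2 ^ (3 * u))%N by lia.
have p01 : 0 <= (1 / 8 : R) <= 1 by apply/andP; split; lra.
rewrite ger0_norm; last first.
  by rewrite divr_ge0 ?ler0n // sumr_ge0 // => V _; exact: choi_error_ge0.
apply: le_lt_trans (expected_choi_double_le _ p01 _ d0) _; first by lia.
rewrite ltr_pdivrMr // -ltrBrDr ltr_pdivrMr //.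
apply: le_lt_trans (regime_sum_le mu u0 y24) _.
have : 0 <= (121 / 128 : R) ^+ u by rewrite exprn_ge0 ?divr_ge0.
move: yd; rewrite ltr_pdivlMr // expr2; move: (_ ^+ u) => y; lra.
Qed.
End Regime.

Theorem mainTheorem6 (R : realType) :
  (forall p r : R, 0 < p < 1 -> 0 < r -> 0 < 1 - r - 2 * p ->
    exists (o : nat -> R) (c : R),
      [/\ o xi @[xi --> \oo] --> (0 : R),
          0 < c &
          forall (n k N a b : nat) (eps : R),
            admissible n k N a b eps -> k%:R / n%:R = r ->
            Num.min
              (n%:R * (eps / n%:R) `^
                 (8 * relative_entropy ((1 - k%:R / n%:R) / 2) p + o (a + b)%N))
              c
            <= expected_choi_block p N a b])
  /\
  (exists (p r : R) (eps : nat -> R),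
      [/\ 0 < p < 1,
          0 < r < 1,
          (forall n, 0 < eps n < 1),
          (forall n0 : nat, exists n k N a b : nat,
             [/\ (n0 <= n)%N, admissible n k N a b (eps n) & k%:R / n%:R = r]) &
          (exists c : R, 0 < c /\ exists n0 : nat,
             forall n k N a b : nat, (n0 <= n)%N ->
               admissible n k N a b (eps n) -> k%:R / n%:R = r ->
               c <= expected_choi_block p N a b)
          /\
          (forall delta : R, 0 < delta -> exists n0 : nat,
             forall n k N a b : nat, (n0 <= n)%N ->
               admissible n k N a b (eps n) -> k%:R / n%:R = r ->
               `|expected_choi_double_layer p N a b| < delta)]).
Proof.
split=> [p r p01 r0 rp|].
  exists (tail_correction p), (1 / 4); split=> [| |n k N a b eps adm rE].
  - by apply: tail_correction_cvg; case/andP: p01.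
  - by rewrite divr_gt0.
  - exact: (block_choi_lower p01 r0 rp adm rE).
exists (1 / 8), (1 / 2), (@regime_eps R); split=> //.
- by apply/andP; split; lra.
- by apply/andP; split; lra.
- exact: regime_eps_bounds.
- exact: regime_unbounded.
- split; [exact: regime_block | exact: regime_double].
Qed.
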